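(* Let $T$ be a compact interval in $(0,\infty)\times\mathbb R^N$. Then there exist positive constants $C_3$ and $C_4$ such that for each fixed $(t,x)\in T$, $$\liminf_{r\to0}\sup_{(s,y)\in I_r(t,x)}\frac{|u(s,y)-u(t,x)|}{r^\alpha(\log\log(1/r))^{-\alpha}}\ge C_3\quad\text{a.s.,}$$ and $$\liminf_{r\to0}\inf_{(t,x)\in T}\sup_{(s,y)\in I_r(t,x)}\frac{|u(s,y)-u(t,x)|}{r^\alpha(\log(1/r))^{-\alpha}}\ge C_4\quad\text{a.s.}$$ In particular, $(t,x)\mapsto u(t,x)$ is almost surely nowhere differentiable on $(0,\infty)\times\mathbb R^N$.
   Context: Fix integers $N\ge1$, $d\ge1$, and $H\in[1/2,1)$, $\beta\in(0,N)$. Let $h_\beta:\mathbb R^N\to[0,\infty)$ be measurable with $c_1|\xi|^{-\beta}\le h_\beta(\xi)\le c_2|\xi|^{-\beta}$ for constants $0<c_1\le c_2<\infty$. Assume $N-2H-1<\beta<N-2H+1$ and set $\alpha=\frac{2H+1-N+\beta}{2}\in(0,1)$. For $t\ge0$, $x\in\mathbb R^N$, $\tau\in\mathbb R$, $\xi\in\mathbb R^N$ let $\mathcal F g_{t,x}(\tau,\xi)=\frac{e^{-ix\cdot\xi}}{2|\xi|}\Big(\frac{e^{-it\tau}-e^{it|\xi|}}{\tau+|\xi|}-\frac{e^{-it\tau}-e^{-it|\xi|}}{\tau-|\xi|}\Big)$. The field $u=(u_1,\dots,u_d)$ is the (continuous version of the) random field solution of $\partial_t^2u_j=\Delta u_j+\dot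 W_j$ on $[0,\infty)\times\mathbb R^N$ with zero initial data, where $\dot W_j$ are i.i.d. centered Gaussian noises with formal covariance $\rho_H(t-s)f_\beta(x-y)$ ($\rho_H=\delta$ if $H=1/2$, $\rho_H(r)=|r|^{2H-2}$ if $H>1/2$, $f_\beta$ the Fourier transform of $h_\beta(\xi)d\xi$). Concretely, $u_1,\dots,u_d$ are i.i.d. centered Gaussian random fields with $\mathbb E[u_1(t,x)u_1(s,y)]=c_H\int_{\mathbb R}\int_{\mathbb R^N}\mathcal F g_{t,x}(\tau,\xi)\overline{\mathcal F g_{s,y}(\tau,\xi)}\,|\tau|^{1-2H}h_\beta(\xi)\,d\xi\,d\tau$ for a constant $c_H>0$. Notation: $I_r(t,x)=[t-r,t+r]\times\prod_{\ell=1}^N[x_\ell-r,x_\ell+r]$. *)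

(* Defs.v *)
From HB Require Import structures.
From mathcomp Require Import all_boot all_order all_algebra.
From mathcomp Require Import all_classical all_reals all_analysis.
From mathcomp Require Import complex.

Set Implicit Arguments.
Unset Strict Implicit.
Unset Printing Implicit Defensive.

Import Order.TTheory GRing.Theory Num.Theory.
Import numFieldNormedType.Exports.

Local Open Scope classical_set_scope.
Local Open Scope ring_scope.

Section Defs.
Context {R : realType}.

Definition enorm {n : nat} (v : 'rV[R]_n) : R := Num.sqrt (\sum_(i < n) v 0 i ^+ 2).
Definition dotv {n : nat} (v w : 'rV[R]_n) : R := \sum_(i < n) v 0 i * w 0 i.

Definition expi (th : R) : R[i] := (cos th +i* sin th)%C.

Definition Fg {N : nat} (t : R) (x : 'rV[R]_N) (tau : R) (xi : 'rV[R]_N) : R[i] :=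
  let a := enorm xi in
  (expi (- dotv x xi) / (2 * a)%:C *
   ((expi (- (t * tau)) - expi (t * a)) / (tau + a)%:C
    - (expi (- (t * tau)) - expi (- (t * a))) / (tau - a)%:C))%C.

(* Lebesgue integral over R^n, written as the iterated integral over the
   coordinates (first coordinate outermost). *)
Fixpoint iint (n : nat) : ('rV[R]_n -> R) -> R :=
  match n with
  | 0 => fun f => f 0
  | k.+1 => fun f =>
      Rintegral lebesgue_measure setT
        (fun a : R => iint (fun v : 'rV[R]_k => f (row_mx (a%:M : 'rV[R]_1) v)))
  end.

Definition cov_integrand {N : nat} (H : R) (h : 'rV[R]_N -> R)
  (t : R) (x : 'rV[R]_N) (s : R) (y : 'rV[R]_N) (tau : R) (xi : 'rV[R]_N) : R[i] :=
  (Fg t x tau xi * (Fg s y tau xi)^* * (powR `|tau| (1 - 2 * H) * h xi)%:C)%C.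

Definition cov_integral {N : nat} (H : R) (h : 'rV[R]_N -> R)
  (t : R) (x : 'rV[R]_N) (s : R) (y : 'rV[R]_N) : R[i] :=
  (Rintegral lebesgue_measure setT
     (fun tau => iint (fun xi => complex.Re (cov_integrand H h t x s y tau xi)))
   +i*
   Rintegral lebesgue_measure setT
     (fun tau => iint (fun xi => complex.Im (cov_integrand H h t x s y tau xi))))%C.

Definition centered_gaussian {d0 : measure_display} {Omega : measurableType d0}
  (P : probability Omega R) (X : Omega -> R) : Prop :=
  measurable_fun setT X /\
  ((P [set w | X w != 0] = 0%E) \/
   exists sigma : R, 0 < sigma /\
     forall A : set R, measurable A -> P (X @^-1` A) = normal_prob 0 sigma A).

Definition centered_gaussian_field {d0 : measure_display} {Omega : measurableType d0}
  (P : probability Omega R) {N : nat} (v : R -> 'rV[R]_N -> Omega -> R) : Prop :=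
  forall s : seq (R * (R * 'rV[R]_N)),
    (forall q, q \in s -> 0 <= q.2.1) ->
    centered_gaussian P (fun w => \sum_(q <- s) q.1 * v q.2.1 q.2.2 w).

(* Mutual independence of the random fields u_0, ..., u_{d-1} (indexed by
   [0,oo) x R^N): independence of their finite-dimensional cylinder events
   (a pi-system generating the sigma-algebra of each field). *)
Definition independent_fields {d0 : measure_display} {Omega : measurableType d0}
  (P : probability Omega R) {N d : nat} (u : 'I_d -> R -> 'rV[R]_N -> Omega -> R) : Prop :=
  forall (ps : seq (R * 'rV[R]_N)) (B : 'I_d -> R * 'rV[R]_N -> set R),
    (forall p, p \in ps -> 0 <= p.1) ->
    (forall j p, measurable (B j p)) ->
    let cyl j := [set w | forall p, p \in ps -> B j p (u j p.1 p.2 w)] in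
    P (\bigcap_(j in [set: 'I_d]) cyl j) = (\prod_(j < d) P (cyl j))%E.

Definition uvec {Omega : Type} {N d : nat} (u : 'I_d -> R -> 'rV[R]_N -> Omega -> R)
  (w : Omega) (t : R) (x : 'rV[R]_N) : 'rV[R]_d := \row_(j < d) u j t x w.

Definition Ibox {N : nat} (r t : R) (x : 'rV[R]_N) : set (R * 'rV[R]_N) :=
  [set p : R * 'rV[R]_N | `|p.1 - t| <= r /\ forall l : 'I_N, `|p.2 0 l - x 0 l| <= r].

Definition supI {N : nat} (r t : R) (x : 'rV[R]_N) (F : R * 'rV[R]_N -> R) : \bar R :=
  ereal_sup [set (F p)%:E | p in Ibox r t x].

Definition liminf0 (f : R -> \bar R) : \bar R := limf_einf f 0^'+.

End Defs.

(* Main.v *)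
Require Import Defs.
From HB Require Import structures.
From mathcomp Require Import all_boot all_order all_algebra.
From mathcomp Require Import all_classical all_reals all_analysis.
From mathcomp Require Import measurable_realfun complex.
From mathcomp Require Import ring lra.

Import Order.TTheory GRing.Theory Num.Theory.
Import numFieldNormedType.Exports.

Local Open Scope classical_set_scope.
Local Open Scope ring_scope.

(* Everything is read off one component v of u on lattice points
   X_k = v(t, x + k delta e_1) at a fixed time t.

   At equal times the covariance is the Fourier transform of the density
   |Fg|^2 |tau|^(1-2H) h. The resonance of Fg at tau = |xi| makes its integral
   over tau at least of order |xi|^(-(2 alpha + N)) for large |xi|. Restricting
   the first coordinate of xi to one period of the trigonometric polynomial
   sum_k a_k e^(i k delta xi_1) and applying Parseval's identity gives
   E (sum_k a_k X_k)^2 >= kappa delta^(2 alpha) sum_k a_k^2.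

   For the vector of increments X_(j+1) - X_0, j < n, this bounds the
   characteristic function by a Gaussian one. Integrating it against a Gaussian
   kernel shows that all n increments are at most eps delta^alpha with
   probability at most e^(-n).

   At the scale r = e^(-m) take delta = r / n, with n of order log m for a fixed
   point, and of order m together with a union bound over a grid of mesh r/2 for
   all points of T. Borel-Cantelli then gives both lower bounds. A differentiable
   path would have oscillation O(r), which is incompatible with the second one
   since alpha < 1. *)

(** * Characteristic function of the normal law *)

(** Near-independence of the increments is expressed through quadratic forms only: a lower bound for
    the smallest eigenvalue of the covariance matrix of X_0, ..., X_n stands in for conditional
    variances and joint densities, so that one-dimensional normal laws suffice. Fixing the time is
    what makes this bound accessible: the oscillating factors of Fg then combine into a squared
    modulus, and positivity of the integrand allows the frequency domain to be cut down at will.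
    With delta = r / n the level eps delta^alpha equals eps r^alpha n^(-alpha), so the order of n,
    dictated by Borel-Cantelli, is exactly the logarithmic factor of the theorem.

    Two kinds of default values shape the analytic part. [Rintegral] and [iint] return a real number
    even for divergent integrals, so estimates are made in the extended reals with [eint] and moved
    to [iint] once the joint spectral density is known to have a finite integral. Division by zero
    makes Fg arbitrary at |tau| = |xi| and at xi = 0, so pointwise bounds hold off these null sets
    only. *)

Section gaussian_law.
Context {R : realType}.
Local Notation mu := (@lebesgue_measure R).
Implicit Types (s x th : R).

Lemma normal_pdf0E s x : s != 0 ->
  normal_pdf 0 s x = normal_peak s * expR (- x ^+ 2 / (s ^+ 2 *+ 2)).
Proof. by move=> s0; rewrite normal_pdfE// /normal_fun subr0. Qed.

(** Trades a factor [x^2] for a doubled standard deviation, so that no Gaussian moment has to be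
    computed. With [u = x^2 / (4 s^2)] it reduces to [u <= exp (3 u / 2)]. *)
Lemma sqr_normal_pdf_le s x : 0 < s ->
  x ^+ 2 * normal_pdf 0 s x <= 8 * s ^+ 2 * normal_pdf 0 (2 * s) x.
Proof.
move=> s0; have sn0 : s != 0 by rewrite gt_eqF.
have s20 : 2 * s != 0 by rewrite mulf_neq0.
rewrite !normal_pdf0E//.
have -> : normal_peak s = 2 * normal_peak (2 * s).
  rewrite /normal_peak.
  have -> : (2 * s) ^+ 2 * pi *+ 2 = 2 ^+ 2 * (s ^+ 2 * pi *+ 2) by ring.
  rewrite sqrtrM ?exprn_ge0// sqrtr_sqr ger0_norm// invfM mulrA divff ?mul1r//.
set p := normal_peak _.
have p0 : 0 <= p by exact: normal_peak_ge0.
set u := x ^+ 2 / (4 * s ^+ 2).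
have xu : x ^+ 2 = 4 * s ^+ 2 * u by rewrite /u; field.
have -> : - x ^+ 2 / (s ^+ 2 *+ 2) = - (2 * u) by rewrite xu; field.
have -> : - x ^+ 2 / ((2 * s) ^+ 2 *+ 2) = - (u / 2) by rewrite xu; field.
rewrite {1}xu.
have -> : 4 * s ^+ 2 * u * (2 * p * expR (- (2 * u))) =
  8 * s ^+ 2 * (p * (u * expR (- (2 * u)))) by ring.
apply: ler_wpM2l; first by rewrite mulr_ge0 ?sqr_ge0.
apply: ler_wpM2l => //.
have -> : - (u / 2) = - (2 * u) + 3 / 2 * u by field.
rewrite expRD mulrC ler_wpM2l ?expR_ge0//.
have u0 : 0 <= u by rewrite /u divr_ge0 ?sqr_ge0// mulr_ge0// sqr_ge0.
apply: le_trans (expR_ge1Dx _); nra.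
Qed.

Lemma integrable_mul_normal_pdf s (f : R -> R) (C : R) : 0 < s ->
  measurable_fun setT f -> (forall x, `|f x| <= C * (1 + x ^+ 2)) ->
  mu.-integrable setT (fun x => (f x * normal_pdf 0 s x)%:E).
Proof.
move=> s0 mf fC.
have C0 : 0 <= C.
  by have := fC 0; rewrite expr0n/= addr0 mulr1; apply: le_trans.
apply: (@le_integrable _ _ _ mu _ _ _ (fun x =>
   (C%:E * ((normal_pdf 0 s x)%:E + (8 * s ^+ 2)%:E * (normal_pdf 0 (2 * s) x)%:E))%E)) => //.
- by apply/measurable_EFinP/measurable_funM => //; exact: measurable_normal_pdf.
- move=> x _ /=; rewrite lee_fin normrM (ger0_norm (normal_pdf_ge0 _ _ _)).
  have p0 := normal_pdf_ge0 0 s x; have q0 := normal_pdf_ge0 0 (2 * s) x.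
  have pq := sqr_normal_pdf_le s x s0.
  rewrite [leRHS]ger0_norm; last by rewrite mulr_ge0// addr_ge0// mulr_ge0// mulr_ge0// sqr_ge0.
  apply: (@le_trans _ _ (C * (1 + x ^+ 2) * normal_pdf 0 s x)); first exact: ler_wpM2r.
  by rewrite -mulrA ler_wpM2l// mulrDl mul1r lerD2l.
- apply: integrableZl => //; apply: integrableD => //; first exact: integrable_normal_pdf.
  by apply: integrableZl => //; exact: integrable_normal_pdf.
Qed.

Lemma is_derive_normal_pdf s x : 0 < s ->
  is_derive x 1 (normal_pdf 0 s) (- (x / s ^+ 2) * normal_pdf 0 s x).
Proof.
move=> s0; have sn0 : s != 0 by rewrite gt_eqF.
have -> : normal_pdf 0 s = (fun x => normal_peak s * expR (- x ^+ 2 / (s ^+ 2 *+ 2))).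
  by apply/funext => y; exact: normal_pdf0E.
have H : is_derive x (1:R) (fun y : R => - y ^+ 2 / (s ^+ 2 *+ 2)) (- (x / s ^+ 2)).
  have -> : (fun y : R => - y ^+ 2 / (s ^+ 2 *+ 2)) =
     (fun y : R => (- (s ^+ 2 *+ 2)^-1) *: (y ^+ 2 : R)).
    by apply/funext => y; rewrite /GRing.scale/=; field.
  by apply: is_derive_eq; rewrite /GRing.scale/=; field.
have H2 := @is_derive1_comp _ expR (fun y : R => - y ^+ 2 / (s ^+ 2 *+ 2)) x _ _ (is_derive_expR _) H.
have H3 := is_deriveZ (normal_peak s) H2.
by apply: is_derive_eq H3 _; rewrite /GRing.scale/=; ring.
Qed.

Lemma normal_pdf_cvg0 s : 0 < s -> normal_pdf 0 s n%:R @[n --> \oo] --> 0.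
Proof.
move=> s0.
(* The moment bound gives decay like [K / n^2], weakened for [n >= 1] to [2 K / (n + 1)] to match
   the harmonic sequence. *)
apply: (@squeeze_cvgr _ _ _ _ (fun=> 0) (fun n => (8 * s ^+ 2 * normal_peak (2 * s)) * n.+1%:R^-1 * 2)).
- exists 1%N => // n /= n1.
  have n0 : 0 < n%:R :> R by rewrite ltr0n.
  rewrite normal_pdf_ge0/=.
  have H := sqr_normal_pdf_le s n%:R s0.
  have H2 : normal_pdf 0 (2 * s) n%:R <= normal_peak (2 * s).
    by apply: normal_pdf_ub; rewrite gt_eqF// mulr_gt0.
  have H3 : n%:R ^+ 2 * normal_pdf 0 s n%:R <= 8 * s ^+ 2 * normal_peak (2 * s).
    by apply: (le_trans H); rewrite ler_wpM2l// mulr_ge0// sqr_ge0.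
  set K := 8 * _ * _ in H3 *.
  have nS : n.+1%:R = n%:R + 1 :> R by rewrite -natr1.
  have n1' : 1 <= n%:R :> R by rewrite ler1n.
  have n1n : 0 < n.+1%:R :> R by rewrite ltr0n.
  rewrite -(ler_pM2l n1n).
  have -> : n.+1%:R * (K / n.+1%:R * 2) = K * 2 by field; rewrite gt_eqF//; lra.
  rewrite nS; have p0 := normal_pdf_ge0 0 s n%:R.
  have : 0 <= normal_pdf 0 s n%:R * ((n%:R - 1) * (2 * n%:R + 1)).
    by rewrite mulr_ge0// mulr_ge0//; lra.
  move: H3; set p := normal_pdf _ _ _; set m := n%:R; nra.
- exact: cvg_cst.
- rewrite -[X in _ --> X](mul0r 2) -[X in X * 2](mulr0 (8 * s ^+ 2 * normal_peak (2 * s))).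
  by apply: cvgM; [apply: cvgM; [exact: cvg_cst|exact: cvg_harmonic]|exact: cvg_cst].
Qed.

Lemma continuous_cosM th : continuous (fun x => cos (th * x)).
Proof.
move=> x; apply: (@continuous_comp _ _ _ ( *%R th) cos).
  exact: mulrl_continuous.
exact: continuous_cos.
Qed.

Lemma continuous_sinM th : continuous (fun x => sin (th * x)).
Proof.
move=> x; apply: (@continuous_comp _ _ _ ( *%R th) sin).
  exact: mulrl_continuous.
exact: continuous_sin.
Qed.

(* Integration by parts on [-n, n], the boundary terms vanishing as n grows. *)
Lemma normal_stein s th : 0 < s ->
  \int[mu]_x ((th * cos (th * x) - x / s ^+ 2 * sin (th * x)) * normal_pdf 0 s x) = 0.
Proof.
move=> s0.
pose g x := (th * cos (th * x) - x / s ^+ 2 * sin (th * x)) * normal_pdf 0 s x.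
have cf : continuous (fun x => th * cos (th * x) - x / s ^+ 2 * sin (th * x)).
  move=> x; apply: cvgB.
    apply: cvgM; first exact: cvg_cst.
    exact: continuous_cosM.
  apply: cvgM; last exact: continuous_sinM.
  by apply: cvgM; [exact: cvg_id|exact: cvg_cst].
have cg : continuous g.
  move=> x; apply: cvgM; last by apply: continuous_normal_pdf; rewrite gt_eqF.
  exact: cf.
have mg : measurable_fun setT g by exact: continuous_measurable_fun.
have ig : mu.-integrable setT (EFin \o g).
  apply: (@integrable_mul_normal_pdf s _ (`|th| + (s ^+ 2)^-1)) => //.
    exact: continuous_measurable_fun.
  move=> x; apply: (le_trans (ler_normB _ _)); rewrite !normrM normfV.
  have hc : `|cos (th * x)| <= 1 by rewrite ler_norml cos_geN1 cos_le1.
  have hs : `|sin (th * x)| <= 1 by rewrite ler_norml sin_geN1 sin_le1.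
  have i0 : 0 <= (s ^+ 2)^-1 by rewrite invr_ge0 sqr_ge0.
  rewrite (ger0_norm (sqr_ge0 s)).
  have hx : `|x| <= 1 + x ^+ 2.
    by rewrite -[x ^+ 2]real_normK ?num_real//; have := normr_ge0 x; nra.
  rewrite mulrDl; apply: lerD.
    by rewrite ler_pM// (le_trans hc)// lerDl sqr_ge0.
  rewrite -[leRHS]mulr1 ler_pM// ?mulr_ge0// mulrC ler_wpM2l//.
have dF (x : R) : is_derive x (1:R) (fun y => sin (th * y) * normal_pdf 0 s y) (g x).
  have H : is_derive x (1:R) (fun y : R => th * y) th.
    have -> : (fun y : R => th * y) = (fun y : R => th *: (y : R)) by [].
    by apply: is_derive_eq; rewrite /GRing.scale/= mulr1.
  have H2 := @is_derive1_comp _ sin (fun y : R => th * y) x _ _ (is_derive_sin _) H.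
  have H3 := is_deriveM H2 (is_derive_normal_pdf s x s0).
  by apply: is_derive_eq H3 _; rewrite /g /GRing.scale/=; ring.
have FTC (n : nat) : (\int[mu]_x ((g \_ `[(- n%:R), n%:R]) x)%:E =
    (sin (th * n%:R) * normal_pdf 0 s n%:R * 2)%:E)%E.
  transitivity (\int[mu]_(x in `[(- n%:R)%R, (n%:R)%R]) (g x)%:E)%E.
    by rewrite [RHS]integral_mkcond/=; under [RHS]eq_integral do rewrite restrict_EFin.
  case: n => [|n].
    by rewrite oppr0 set_itv1 integral_set1 mulr0 sin0 !mul0r.
  rewrite (@continuous_FTC2 _ g (fun y => sin (th * y) * normal_pdf 0 s y)).
  - rewrite mulrN sinN -EFinB; congr EFin.
    have -> : normal_pdf 0 s (- n.+1%:R) = normal_pdf 0 s n.+1%:R.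
      by rewrite !normal_pdf0E ?gt_eqF// sqrrN.
    ring.
  - by rewrite gtrN// ltr0n.
  - exact: continuous_subspaceT.
  - have cF : continuous (fun y : R => sin (th * y) * normal_pdf 0 s y).
      by move=> x; apply/differentiable_continuous/derivable1_diffP; have [] := dF x.
    split => [x _||]; first by have [] := dF x.
    + by apply: cvg_at_right_filter; exact: cF.
    + by apply: cvg_at_left_filter; exact: cF.
  - by move=> x _; rewrite derive1E; have [_ ->] := dF x.
have [|||||_ _] := @dominated_convergence _ _ _ mu setT measurableT
   (fun n x => ((g \_ `[(- n%:R), n%:R]) x)%:E) (EFin \o g) (abse \o (EFin \o g)).
- move=> n; apply/measurable_EFinP/(measurable_restrictT _ _).1 => //.
  exact: measurable_funTS.
- by apply/measurable_EFinP.
- apply: aeW => x _; apply: cvg_near_cst.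
  have [n Hn] : exists n : nat, `|x| <= n%:R.
    by exists (Num.bound `|x : R|); exact: ltW (archi_boundP (normr_ge0 _)).
  exists n => // m /= nm; rewrite patchE mem_set// /= in_itv/=.
  by rewrite -ler_norml (le_trans Hn)// ler_nat.
- exact: integrable_abse.
- apply: aeW => x n _; rewrite patchE; case: ifP => //= _.
  by rewrite normr0 lee_fin.
have -> : [sequence (\int[mu]_x ((g \_ `[(- n%:R), n%:R]) x)%:E)%E]_n =
     (fun n => (sin (th * n%:R) * normal_pdf 0 s n%:R * 2)%:E).
  by apply/funext => n; exact: FTC.
move=> /cvg_lim H1.
have H2 : (fun n => (sin (th * n%:R) * normal_pdf 0 s n%:R * 2)%:E) @ \oo --> 0%:E.
  apply: cvg_EFin; first exact: nearW.
  rewrite /comp/=.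
  apply/norm_cvg0P.
  apply: (@squeeze_cvgr _ _ _ _ (fun=> 0) (fun n => normal_pdf 0 s n%:R * 2)).
  - near=> n; rewrite normr_ge0/= normrM (ger0_norm (x := 2))// ler_wpM2r// normrM.
    rewrite (ger0_norm (normal_pdf_ge0 _ _ _)) ler_piMl ?normal_pdf_ge0//.
    by rewrite ler_norml sin_geN1 sin_le1.
  - exact: cvg_cst.
  - by rewrite -[X in _ --> X](mul0r 2); apply: cvgM; [exact: normal_pdf_cvg0|exact: cvg_cst].
move/cvg_lim in H2.
by rewrite /Rintegral -[X in fine X]H1// H2.
Unshelve. all: by end_near. Qed.

End gaussian_law.

Lemma integrableZl_EFin {d} {T : measurableType d} {R : realType}
    (mu : {measure set T -> \bar R}) (D : set T) (k : R) (f : T -> R) :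
  measurable D -> mu.-integrable D (EFin \o f) ->
  mu.-integrable D (EFin \o (fun x => k * f x)).
Proof.
by move=> mD fi; rewrite /comp; under eq_fun do rewrite EFinM; exact: integrableZl.
Qed.

Section gaussian_cf.
Context {R : realType}.
Local Notation mu := (@lebesgue_measure R).
Implicit Types (s x th : R).
(** As a function [F] of the frequency, the integral satisfies [F' = - t s^2 F], by differentiation
    under the integral and [normal_stein]. Hence [F] times the inverse Gaussian is constant, equal
    to [F 0 = 1]. *)
Lemma normal_cf s th : 0 < s ->
  \int[mu]_x (cos (th * x) * normal_pdf 0 s x) = expR (- (th * s) ^+ 2 / 2).
Proof.
move=> s0.
pose f (t x : R) := cos (t * x) * normal_pdf 0 s x.
pose F t := \int[mu]_x f t x.
have cosn1 (y : R) : `|cos y| <= 1 by rewrite ler_norml cos_geN1 cos_le1.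
have sinn1 (y : R) : `|sin y| <= 1 by rewrite ler_norml sin_geN1 sin_le1.
have hx (x : R) : `|x| <= 1 + x ^+ 2.
  by rewrite -[x ^+ 2]real_normK ?num_real//; have := normr_ge0 x; nra.
have intf t : mu.-integrable setT (EFin \o f t).
  apply: (@integrable_mul_normal_pdf _ s (fun x => cos (t * x)) 1) => //.
    apply: continuous_measurable_fun; exact: continuous_cosM.
  by move=> x; rewrite mul1r (le_trans (cosn1 _))// lerDl sqr_ge0.
have df (t x : R) : is_derive t (1:R) (f ^~ x) (- (x * sin (t * x)) * normal_pdf 0 s x).
  have H : is_derive t (1:R) (fun y : R => y * x) x.
    have -> : (fun y : R => y * x) = (fun y : R => x *: (y : R)).
      by apply/funext => y; rewrite mulrC.
    by apply: is_derive_eq; rewrite /GRing.scale/= mulr1.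
  have H2 := @is_derive1_comp _ cos (fun y : R => y * x) t _ _ (is_derive_cos _) H.
  have -> : f ^~ x = (fun y => normal_pdf 0 s x *: (cos \o (fun y : R => y * x)) y).
    by apply/funext => y; rewrite /f mulrC.
  by apply: is_derive_eq; rewrite /GRing.scale/=; ring.
have intd t : mu.-integrable setT (fun x => (- (x * sin (t * x)) * normal_pdf 0 s x)%:E).
  apply: (@integrable_mul_normal_pdf _ s (fun x => - (x * sin (t * x))) 1) => //.
    apply: measurableT_comp => //; apply: measurable_funM => //.
    apply: continuous_measurable_fun; exact: continuous_sinM.
  move=> x; rewrite mul1r normrN normrM (le_trans _ (hx x))//.
  by rewrite ler_piMr.
have dF (t : R) : is_derive t (1:R) F (- (t * s ^+ 2) * F t).
  have tI : [set` `](t - 1), (t + 1)[] t by rewrite /= in_itv/=; apply/andP; split; lra.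
  have i1 (x : R) : [set` `](t - 1), (t + 1)[] x -> mu.-integrable setT (EFin \o f x) by [].
  have i2 (x y : R) : [set` `](t - 1), (t + 1)[] x -> setT y -> derivable (f ^~ y) x 1.
    by move=> _ _; have [] := df x y.
  have d1E (x y : R) : derive1 (f ^~ y) x = - (y * sin (x * y)) * normal_pdf 0 s y.
    by rewrite derive1E; have [_ ->] := df x y.
  have i3 (y : R) : 0 <= `|y| * normal_pdf 0 s y by rewrite mulr_ge0// normal_pdf_ge0.
  have i4 : mu.-integrable setT (EFin \o (fun y : R => `|y| * normal_pdf 0 s y)).
    apply: (@integrable_mul_normal_pdf _ s (fun x => `|x|) 1) => // x.
    by rewrite mul1r normr_id.
  have i5 (x y : R) : [set` `](t - 1), (t + 1)[] x -> setT y ->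
      `|partial1of2 f x y| <= `|y| * normal_pdf 0 s y.
    move=> _ _; rewrite /partial1of2 d1E normrM (ger0_norm (normal_pdf_ge0 _ _ _)).
    by rewrite ler_wpM2r ?normal_pdf_ge0// normrN normrM ler_piMr.
  have D1 := @derivable_under_integral _ _ _ mu f setT measurableT t _ _ tI i1 i2 _ i3 i4 i5.
  have D2 := @differentiation_under_integral _ _ _ mu f setT measurableT t _ _ tI i1 i2 _ i3 i4 i5.
  apply: DeriveDef; first exact: D1.
  rewrite -derive1E [LHS]D2 /partial1of2.
  under eq_Rintegral do rewrite d1E.
  have St := normal_stein s t s0.
  have : \int[mu]_x (t * f t x + (s ^+ 2)^-1 * (- (x * sin (t * x)) * normal_pdf 0 s x)) = 0.
    rewrite -[RHS]St; apply: eq_Rintegral => x _; rewrite /f; field.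
    by rewrite gt_eqF.
  rewrite RintegralD//; last 2 first.
  - exact: integrableZl_EFin (intf t).
  - exact: integrableZl_EFin (intd t).
  rewrite (@RintegralZl _ _ _ mu setT (f t) t measurableT (intf t)).
  rewrite (@RintegralZl _ _ _ mu setT _ (s ^- 2) measurableT (intd t)).
  rewrite -/(F t) => /eqP; rewrite addrC addr_eq0 => /eqP E.
  have s2 : s ^+ 2 != 0 by rewrite expf_neq0// gt_eqF.
  apply: (mulfI (invr_neq0 s2)); rewrite E; field.
  by rewrite gt_eqF.
pose G t := F t * expR ((t * s) ^+ 2 / 2).
have dG (t : R) : is_derive t (1:R) G 0.
  have H : is_derive t (1:R) (fun y : R => (y * s) ^+ 2 / 2) (t * s ^+ 2).
    have -> : (fun y : R => (y * s) ^+ 2 / 2) = (fun y : R => (s ^+ 2 / 2) *: (y ^+ 2 : R)).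
      by apply/funext => y; rewrite /GRing.scale/=; field.
    by apply: is_derive_eq; rewrite /GRing.scale/=; field.
  have H2 := @is_derive1_comp _ expR (fun y : R => (y * s) ^+ 2 / 2) t _ _ (is_derive_expR _) H.
  have H3 := is_deriveM (dF t) H2.
  by apply: is_derive_eq H3 _; rewrite /GRing.scale/=; ring.
have := @is_derive_0_is_cst _ G th 0 dG.
rewrite /G mul0r expr0n/= mul0r expR0 mulr1.
have -> : F 0 = 1.
  rewrite /F /f /Rintegral.
  under eq_integral do rewrite mul0r cos0 mul1r.
  by rewrite integral_normal_pdf.
have -> : \int[mu]_x (cos (th * x) * normal_pdf 0 s x) = F th by [].
move=> E; apply: (mulIf (lt0r_neq0 (expR_gt0 ((th * s) ^+ 2 / 2)))).
by rewrite E -expRD mulNr addNr expR0.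
Qed.

End gaussian_cf.

(** * Small balls from characteristic functions *)

Section fubini_bounded.
Context {R : realType} {d1 d2} {T1 : measurableType d1} {T2 : measurableType d2}.
Variables (m1 : probability T1 R) (m2 : {sigma_finite_measure set T2 -> \bar R}).
Variables (F : T1 -> T2 -> R) (g : T2 -> R).
Hypothesis mF : measurable_fun setT (fun p : T1 * T2 => F p.1 p.2).
Hypothesis ig : m2.-integrable setT (EFin \o g).
Hypothesis Fg : forall x y, `|F x y| <= g y.

Let mFx x : measurable_fun setT (F x).
Proof. exact: (measurableT_comp mF (measurable_pair1 x)). Qed.

Let mFy y : measurable_fun setT (F ^~ y).
Proof. exact: (measurableT_comp mF (measurable_pair2 y)). Qed.

Lemma dominated_integrable1 x : m2.-integrable setT (EFin \o F x).
Proof.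
apply: le_integrable ig => //; first by apply/measurable_EFinP.
by move=> y _ /=; rewrite lee_fin (le_trans (Fg x y))// ler_norm.
Qed.

Lemma dominated_integrable2 y : m1.-integrable setT (EFin \o F ^~ y).
Proof.
apply: (@le_integrable _ _ _ m1 _ measurableT _ (cst (g y)%:E)).
- by apply/measurable_EFinP.
- by move=> x _ /=; rewrite lee_fin (le_trans (Fg x y))// ler_norm.
- exact: finite_measure_integrable_cst.
Qed.

Let iF : (m1 \x m2)%E.-integrable setT (fun p => (F p.1 p.2)%:E).
Proof.
apply/integrable12ltyP; first by apply/measurable_EFinP.
apply: (@le_lt_trans _ _ (\int[m1]_x (\int[m2]_y `|(g y)%:E|))%E).
  apply: ge0_le_integral => //=.
  - by move=> x _; exact: integral_ge0.
  - apply: (@measurable_fun_fubini_tonelli_F _ _ _ _ _ m2 (fun p => `|(F p.1 p.2)%:E|%E)) => //=.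
    by apply/measurable_EFinP/measurableT_comp.
  - move=> x _; apply: ge0_le_integral => //=.
    + by apply/measurable_EFinP/measurableT_comp.
    + apply/measurable_EFinP/measurableT_comp => //.
      by apply/measurable_EFinP; exact: (measurable_int _ ig).
    + by move=> y _; rewrite lee_fin (le_trans (Fg x y))// ler_norm.
rewrite integral_cst//= probability_setT mule1.
by have /integrableP[] := ig.
Qed.

Lemma dominated_integrable_Rintegral :
  m2.-integrable setT (EFin \o (fun y => \int[m1]_x F x y)).
Proof.
have E : EFin \o (fun y => \int[m1]_x F x y) = fubini_G m1 (fun p => (F p.1 p.2)%:E).
  apply/funext => y; rewrite /= /fubini_G/= /Rintegral fineK//.
  exact: (integrable_fin_num measurableT (dominated_integrable2 y)).
apply: le_integrable ig => //; first by rewrite E; exact: measurable_fubini_G iF.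
move=> y _ /=; rewrite lee_fin.
apply: (le_trans (le_normr_Rintegral _ (dominated_integrable2 y))) => //.
apply: (@le_trans _ _ (\int[m1]_x g y)).
  apply: le_Rintegral => //.
  - exact: (integrable_norm (dominated_integrable2 y)).
  - exact: finite_measure_integrable_cst.
rewrite Rintegral_cst// [X in _ * fine X](_ : _ = 1%E); last exact: probability_setT.
by rewrite mulr1 ler_norm.
Qed.

(** A majorant depending on the second variable alone suffices because [m1] is a probability. It
    makes the inner integrals finite at every point, not just almost everywhere, so [fine] can be
    removed pointwise. *)
Lemma Rintegral_Fubini :
  \int[m1]_x \int[m2]_y F x y = \int[m2]_y \int[m1]_x F x y.
Proof.
rewrite /Rintegral; congr fine.
transitivity (\int[m1]_x \int[m2]_y (F x y)%:E)%E.
  apply: eq_integral => x _; rewrite fineK//.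
  exact: (integrable_fin_num measurableT (dominated_integrable1 x)).
rewrite (Fubini iF); apply: eq_integral => y _; rewrite fineK//.
exact: (integrable_fin_num measurableT (dominated_integrable2 y)).
Qed.

End fubini_bounded.

Section gaussian_kernel.
Context {R : realType}.
Local Notation mu := (@lebesgue_measure R).

Lemma integral_cos_normal_pdf (y : R) :
  \int[mu]_z (cos (z * y) * normal_pdf 0 1 z) = expR (- y ^+ 2 / 2).
Proof.
under eq_Rintegral do rewrite mulrC.
have := normal_cf 1 y ltr01; rewrite mulr1 => <-.
by apply: eq_Rintegral => z _; rewrite mulrC (mulrC z).
Qed.

Lemma integrable_expR_normal_pdf (s : R) : 0 <= s ->
  mu.-integrable setT (EFin \o (fun z : R => expR (- (s * z ^+ 2) / 2) * normal_pdf 0 1 z)).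
Proof.
move=> s0; apply: (integrable_mul_normal_pdf 1 (fun z => expR (- (s * z ^+ 2) / 2)) 1) => //.
  apply: measurableT_comp => //; apply: measurable_funM => //.
  apply: measurableT_comp => //; apply: measurable_funM => //.
move=> x; rewrite ger0_norm ?expR_ge0// mul1r.
apply: (@le_trans _ _ 1); last by rewrite lerDl sqr_ge0.
by rewrite -[leRHS]expR0 ler_expR mulNr oppr_le0 divr_ge0// mulr_ge0// sqr_ge0.
Qed.

(** The integrand is [q^-1] times the centered normal density of standard deviation [q^-1], where
    [q^2 = 1 + s]. *)
Lemma integral_expR_normal_pdf (s : R) : 0 <= s ->
  \int[mu]_z (expR (- (s * z ^+ 2) / 2) * normal_pdf 0 1 z) = (Num.sqrt (1 + s))^-1.
Proof.
move=> s0; set q := Num.sqrt (1 + s).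
have q0 : 0 < q by rewrite sqrtr_gt0; lra.
have qq : q ^+ 2 = 1 + s by rewrite sqr_sqrtr//; lra.
have E (z : R) : expR (- (s * z ^+ 2) / 2) * normal_pdf 0 1 z = q^-1 * normal_pdf 0 q^-1 z.
  rewrite !normal_pdf0E ?oner_eq0 ?gt_eqF ?invr_gt0//.
  have -> : normal_peak q^-1 = q * normal_peak 1.
    rewrite /normal_peak.
    have -> : q^-1 ^+ 2 * pi *+ 2 = q^-1 ^+ 2 * (1 ^+ 2 * pi *+ 2) by ring.
    rewrite sqrtrM ?sqr_ge0// sqrtr_sqr ger0_norm ?invr_ge0 ?ltW//.
    by rewrite invfM invrK.
  rewrite mulrCA -expRD [RHS]mulrA [q^-1 * _]mulrA mulVf ?gt_eqF// mul1r.
  congr (_ * expR _).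
  have -> : s = q ^+ 2 - 1 by rewrite qq addrC addKr.
  by field; rewrite gt_eqF.
under eq_Rintegral do rewrite E.
rewrite RintegralZl//; last exact: integrable_normal_pdf.
by rewrite /Rintegral integral_normal_pdf mulr1.
Qed.

End gaussian_kernel.

Section small_ball.
Context {R : realType} {d} {T : measurableType d} (P : probability T R).
Local Notation mu := (@lebesgue_measure R).
Variables (Y : nat -> T -> R) (n : nat) (s : R).
Hypothesis mY : forall j, measurable_fun setT (Y j).
Hypothesis s0 : 0 <= s.
Hypothesis cfY : forall b : nat -> R,
  \int[P]_w cos (\sum_(j < n) b j * Y j w) <= expR (- (s * \sum_(j < n) b j ^+ 2) / 2).

(** A smooth substitute for the indicator of the small ball: where the first [k] variables are at
    most 1 in modulus, it is at least [exp (- k / 2)]. *)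
Let W k w := \prod_(j < k) expR (- (Y j w) ^+ 2 / 2).

Let mW k : measurable_fun setT (W k).
Proof.
apply: measurable_prod => j _; apply: measurableT_comp => //.
apply: measurable_funM => //; apply: measurableT_comp => //.
exact: measurable_funX.
Qed.

Let W0 k w : 0 <= W k w.
Proof. by apply: prodr_ge0 => j _; exact: expR_ge0. Qed.

Let W1 k w : W k w <= 1.
Proof.
have [//] : 0 <= W k w /\ W k w <= 1.
apply: (big_ind (fun x => 0 <= x /\ x <= 1)) => [|x y [? ?] [? ?]|j _].
- by rewrite ler01 lexx.
- by split; [exact: mulr_ge0|exact: mulr_ile1].
split; first exact: expR_ge0.
rewrite -[leRHS]expR0 ler_expR.
by rewrite mulNr oppr_le0 divr_ge0// sqr_ge0.
Qed.

Let mL (b : nat -> R) : measurable_fun setT (fun w => \sum_(j < n) b j * Y j w).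
Proof. by apply: measurable_sum => j; exact: measurable_funM. Qed.

Let cosn1 (y : R) : `|cos y| <= 1.
Proof. by rewrite ler_norml cos_geN1 cos_le1. Qed.

Let mcos : measurable_fun setT (@cos R).
Proof. by apply: continuous_measurable_fun; exact: continuous_cos. Qed.

Let iWc k (b : nat -> R) :
  P.-integrable setT (EFin \o (fun w => W k w * cos (\sum_(j < n) b j * Y j w))).
Proof.
apply: (@le_integrable _ _ _ P _ measurableT _ (cst 1%:E)) => //.
- by apply/measurable_EFinP/measurable_funM => //; exact: measurableT_comp.
- move=> w _ /=; rewrite lee_fin normr1 normrM -[leRHS]mulr1 ler_pM//.
  by rewrite ger0_norm ?W0 ?W1.
- exact: finite_measure_integrable_cst.
Qed.

(* Each factor exp(-y^2/2) is written as the characteristic function of an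
   auxiliary standard normal variable z, which is integrated last. *)
Lemma gaussian_kernel_expectation k (b : nat -> R) : (k <= n)%N ->
  (forall j, (j < k)%N -> b j = 0) ->
  \int[P]_w (W k w * cos (\sum_(j < n) b j * Y j w)) <=
  (Num.sqrt (1 + s))^-1 ^+ k * expR (- (s * \sum_(j < n) b j ^+ 2) / 2).
Proof.
elim: k b => [|k IH] b kn bk.
  rewrite expr0 mul1r; under eq_Rintegral do rewrite /W big_ord0 mul1r.
  exact: cfY.
(* For [e] equal to 1 and -1, the cosines of the two shifted forms average to
   [cos (L b) * cos (z * Y k)]. Since [b k = 0], the shift adds exactly [z^2] to the sum of
   squares. *)
pose bz z e j := b j + (if j == k then e * z else 0) : R.
pose L (b : nat -> R) w := \sum_(j < n) b j * Y j w : R.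
have Lz z e w : L (bz z e) w = L b w + e * (z * Y k w).
  rewrite /L /bz; under eq_bigr do rewrite mulrDl.
  rewrite big_split/=; congr (_ + _).
  rewrite (bigD1 (Ordinal kn))//= eqxx big1 ?addr0 ?mulrA// => j /eqP jk.
  case: eqP => [E|]; last by rewrite mul0r.
  by case: jk; apply: val_inj.
have bk0 : b k = 0 by exact: bk.
have Sz z e : e ^+ 2 = 1 -> \sum_(j < n) bz z e j ^+ 2 = \sum_(j < n) b j ^+ 2 + z ^+ 2.
  move=> e1; rewrite (bigD1 (Ordinal kn))//= [in RHS](bigD1 (Ordinal kn))//=.
  rewrite {1}/bz eqxx bk0 add0r expr0n/= add0r exprMn e1 mul1r addrC; congr (_ + _).
  apply: eq_bigr => j /eqP jk; rewrite /bz; case: eqP => [E|]; last by rewrite addr0.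
  by case: jk; apply: val_inj.
have IHz z e : e ^+ 2 = 1 -> \int[P]_w (W k w * cos (L (bz z e) w)) <=
   (Num.sqrt (1 + s))^-1 ^+ k * (expR (- (s * \sum_(j < n) b j ^+ 2) / 2) * expR (- (s * z ^+ 2) / 2)).
  move=> e1; apply: (le_trans (IH _ (ltnW kn) _)) => [j jk|].
    by rewrite /bz ltn_eqF// addr0 bk// ltnW.
  by rewrite Sz// -expRD mulrDr opprD mulrDl.
pose F w z := W k w * cos (L b w) * (cos (z * Y k w) * normal_pdf 0 1 z).
have mF : measurable_fun setT (fun p : T * R => F p.1 p.2).
  apply: measurable_funM.
    apply: measurable_funM; first exact: measurableT_comp (mW k) measurable_fst.
    apply: measurableT_comp => //.
    exact: measurableT_comp (mL b) measurable_fst.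
  apply: measurable_funM.
    apply: measurableT_comp => //; apply: measurable_funM => //.
    exact: measurableT_comp (mY k) measurable_fst.
  by apply: measurableT_comp => //; exact: measurable_normal_pdf.
have Fg w z : `|F w z| <= normal_pdf 0 1 z.
  rewrite /F !normrM (ger0_norm (normal_pdf_ge0 _ _ _)) (ger0_norm (W0 _ _)).
  rewrite mulrA ler_piMl ?normal_pdf_ge0//.
  apply: mulr_ile1 => //; first by rewrite mulr_ge0 ?W0.
  by apply: mulr_ile1; rewrite ?W0 ?W1 ?cosn1.
have ip : mu.-integrable setT (EFin \o normal_pdf 0 1) by exact: integrable_normal_pdf.
have -> : \int[P]_w (W k.+1 w * cos (\sum_(j < n) b j * Y j w)) =
    \int[P]_w \int[mu]_z F w z.
  apply: eq_Rintegral => w _; rewrite /F RintegralZl//; last first.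
    apply: (@integrable_mul_normal_pdf _ 1 (fun z => cos (z * Y k w)) 1) => //.
      by apply: measurableT_comp => //; exact: measurable_funM.
    by move=> z; rewrite mul1r (le_trans (cosn1 _))// lerDl sqr_ge0.
  by rewrite integral_cos_normal_pdf /W big_ord_recr/= mulrAC.
rewrite (Rintegral_Fubini P mu F (normal_pdf 0 1))//.
set K := expR (- (s * \sum_(j < n) b j ^+ 2) / 2).
have -> : (Num.sqrt (1 + s))^-1 ^+ k.+1 * K =
   \int[mu]_z ((Num.sqrt (1 + s))^-1 ^+ k * K * (expR (- (s * z ^+ 2) / 2) * normal_pdf 0 1 z)).
  rewrite RintegralZl//; last exact: integrable_expR_normal_pdf.
  by rewrite integral_expR_normal_pdf// exprSr mulrAC.
apply: le_Rintegral => //.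
- exact: (dominated_integrable_Rintegral P mu F (normal_pdf 0 1)).
- by apply: integrableZl_EFin => //; exact: integrable_expR_normal_pdf.
move=> z _.
have -> : \int[P]_w F w z =
  \int[P]_w (normal_pdf 0 1 z / 2 * (W k w * cos (L (bz z 1) w) + W k w * cos (L (bz z (-1)) w))).
  apply: eq_Rintegral => w _; by rewrite /F !Lz mul1r mulN1r cosD cosB; field.
rewrite RintegralZl//; last first.
  have := integrableD measurableT (iWc k (bz z 1)) (iWc k (bz z (-1))).
  by apply: eq_integrable.
rewrite RintegralD//; [|exact: iWc|exact: iWc].
have H1 := IHz z 1 (expr1n _ _).
have H2 : _ := IHz z (-1) (etrans (sqrrN 1) (expr1n _ 2)).
apply: (le_trans (ler_wpM2l _ (lerD H1 H2))).
  by rewrite divr_ge0// normal_pdf_ge0.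
by rewrite le_eqVlt; apply/orP; left; apply/eqP; rewrite /K; field.
Qed.

Lemma measurable_small_ball : measurable [set w | forall j, (j < n)%N -> `|Y j w| <= 1].
Proof.
rewrite (_ : [set _ | _] = \bigcap_(j in [set j | (j < n)%N]) [set w | (`|Y j w| <= 1)%R]) //.
apply: bigcap_measurableType => j _.
rewrite (_ : [set _ | _] = Y j @^-1` `[-1, 1]%classic).
  by rewrite -[X in measurable X]setTI; exact: mY.
by apply/seteqP; split => w /=; rewrite in_itv/= ler_norml.
Qed.

(** The indicator of the event is at most [exp (n / 2) * W n], whose expectation is controlled by
    the kernel estimate with all coefficients zero. The base of the power is below 1 once [s] is
    large. *)
Lemma small_ball_probability :
  (P [set w | forall j, (j < n)%N -> (`|Y j w| <= 1)%R] <=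
   ((expR (2^-1) / Num.sqrt (1 + s)) ^+ n)%:E)%E.
Proof.
set A := [set w | _].
have mA : measurable A := measurable_small_ball.
have PAf : P A \is a fin_num by exact: fin_num_measure.
rewrite -(fineK PAf) lee_fin.
have -> : fine (P A) = \int[P]_w \1_A w by rewrite /Rintegral integral_indic// setIT.
have H := gaussian_kernel_expectation n (fun=> 0) (leqnn n) (fun _ _ => erefl).
have iW : P.-integrable setT (EFin \o W n).
  have := iWc n (fun=> 0); apply: eq_integrable => // w _ /=.
  by rewrite big1 ?cos0 ?mulr1// => j _; rewrite mul0r.
have {}H : \int[P]_w W n w <= (Num.sqrt (1 + s))^-1 ^+ n.
  apply: le_trans (le_trans H _).
    rewrite le_eqVlt; apply/orP; left; apply/eqP; apply: eq_Rintegral => w _.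
    by rewrite big1 ?cos0 ?mulr1// => j _; rewrite mul0r.
  by rewrite big1 ?mulr0 ?oppr0 ?mul0r ?expR0 ?mulr1// => j _; rewrite expr0n.
rewrite exprMn; apply: le_trans (ler_wpM2l (exprn_ge0 _ (expR_ge0 _)) H).
rewrite -RintegralZl//; apply: le_Rintegral => //.
- apply/integrableP; split; first by apply/measurable_EFinP; exact: measurable_indic.
  under eq_integral do rewrite /= ger0_norm//.
  by rewrite integral_indic// setIT ltey_eq PAf.
- exact: integrableZl_EFin.
move=> w _; rewrite indicE; case: (boolP (w \in A)) => [|_]; last first.
  by rewrite mulr_ge0 ?exprn_ge0 ?expR_ge0 ?W0.
rewrite inE => Aw.
have -> : expR (2^-1) ^+ n = \prod_(j < n) expR (2^-1) :> R by rewrite prodr_const card_ord.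
rewrite -big_split/=; apply: (@le_trans _ _ (\prod_(j < n) 1)); first by rewrite big1_eq.
apply: ler_prod => j _; rewrite ler01/= -expRD -[leLHS]expR0 ler_expR.
have : Y j w ^+ 2 <= 1 by rewrite -(real_normK (num_real _)) expr_le1//; exact: Aw.
lra.
Qed.

End small_ball.

(** * Iterated integrals *)

Section tuple_rows.
Context {R : realType}.

(** Measurability of functions of a row vector is tested along this map, tuples carrying the product
    sigma-algebra; the hypothesis on [h] has the same form. *)
Definition row_of_tuple n (v : n.-tuple R) : 'rV[R]_n := \row_(l < n) tnth v l.

Lemma row_cons0 n (a : R) (v : 'rV[R]_n) :
  (row_mx (a%:M : 'rV[R]_1) v : 'rV[R]_n.+1) 0 ord0 = a.
Proof.
have -> : (ord0 : 'I_n.+1) = lshift n (ord0 : 'I_1) by exact: val_inj.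
by rewrite [LHS](row_mxEl (a%:M : 'M[R]_(1, 1)) v) mxE eqxx.
Qed.

Lemma row_consS n (a : R) (v : 'rV[R]_n) i :
  (row_mx (a%:M : 'rV[R]_1) v : 'rV[R]_n.+1) 0 (lift ord0 i) = v 0 i.
Proof.
have -> : lift ord0 i = rshift 1 i :> 'I_n.+1 by exact: val_inj.
exact: row_mxEr.
Qed.

Lemma row_of_tuple_cons n (a : R) (v : n.-tuple R) :
  row_mx (a%:M : 'rV[R]_1) (row_of_tuple n v) = row_of_tuple n.+1 [tuple of a :: v].
Proof.
apply/rowP => i; rewrite !mxE; case: splitP => j ij; rewrite !mxE.
  have -> : i = ord0 by apply: val_inj; rewrite /= ij; case: j {ij} => -[].
  by rewrite tnth0 ord1 eqxx.
by have -> : i = lift ord0 j; [exact: val_inj|rewrite tnthS].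
Qed.

Lemma row_of_tuple0 (v : 0.-tuple R) : row_of_tuple 0 v = 0.
Proof. by apply/rowP => -[]. Qed.

End tuple_rows.

Section iterated_integrals.
Context {R : realType}.
Local Notation mu := (@lebesgue_measure R).
Local Notation rot := (@row_of_tuple R _).

(** Extended-real companion of [iint]: on non-negative functions it is monotone and obeys Tonelli
    without any integrability condition. [iint_eint] links the two. *)
Fixpoint eint (n : nat) : ('rV[R]_n -> \bar R) -> \bar R :=
  match n with
  | 0 => fun f => f 0
  | k.+1 => fun f => (\int[mu]_a eint k (fun v => f (row_mx (a%:M : 'rV[R]_1) v)))%E
  end.

(** Inductions on the dimension move the first coordinate into the parameter space, which is why the
    measurability lemmas below carry a parameter of arbitrary type [T]. *)
Lemma measurable_param_cons d (T : measurableType d) d' (E : measurableType d')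
    n (f : T -> 'rV[R]_n.+1 -> E) :
  measurable_fun setT (fun p : T * n.+1.-tuple R => f p.1 (rot p.2)) ->
  measurable_fun setT (fun p : (T * R) * n.-tuple R =>
    f p.1.1 (row_mx (p.1.2%:M : 'rV[R]_1) (rot p.2))).
Proof.
move=> mf; under eq_fun do rewrite row_of_tuple_cons.
pose g (p : (T * R) * n.-tuple R) := (p.1.1, [tuple of p.1.2 :: p.2]).
apply: (measurableT_comp mf (g := g)).
apply/measurable_fun_pairP; split.
  exact: measurableT_comp measurable_fst measurable_fst.
apply: (measurable_cons (f := fun p : (T * R) * n.-tuple R => p.1.2) (g := snd)).
  exact: measurableT_comp measurable_snd measurable_fst.
exact: measurable_snd.
Qed.

Lemma measurable_section d (T : measurableType d) d' (E : measurableType d')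
    n (f : T -> 'rV[R]_n -> E) t :
  measurable_fun setT (fun p : T * n.-tuple R => f p.1 (rot p.2)) ->
  measurable_fun setT (fun v => f t (rot v)).
Proof. by move=> mf; exact: (measurableT_comp mf (measurable_pair1 t)). Qed.

Lemma measurable_cons_section d' (E : measurableType d') n (f : 'rV[R]_n.+1 -> E) :
  measurable_fun setT (fun v => f (rot v)) ->
  measurable_fun setT (fun p : R * n.-tuple R =>
     f (row_mx (p.1%:M : 'rV[R]_1) (rot p.2))).
Proof.
move=> mf; under eq_fun do rewrite row_of_tuple_cons.
apply: (measurableT_comp mf (g := fun p : R * n.-tuple R => [tuple of p.1 :: p.2])).
exact: (measurable_cons (f := fst) (g := snd)).
Qed.

Lemma eint_ge0 n (f : 'rV[R]_n -> \bar R) : (forall v, 0 <= f v)%E -> (0 <= eint n f)%E.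
Proof.
elim: n f => [|n IH] f f0 /=; first exact: f0.
by apply: integral_ge0 => a _; apply: IH.
Qed.

Lemma measurable_eint n d (T : measurableType d) (f : T -> 'rV[R]_n -> \bar R) :
  measurable_fun setT (fun p : T * n.-tuple R => f p.1 (rot p.2)) ->
  (forall t v, 0 <= f t v)%E ->
  measurable_fun setT (fun t => eint n (f t)).
Proof.
elim: n d T f => [|n IH] d T f mf f0 /=.
  have := measurableT_comp mf (measurable_pair2 [tuple] : measurable_fun setT (fun t : T => (t, [tuple]))).
  by apply: eq_measurable_fun => t _; rewrite /= row_of_tuple0.
have := IH _ (T * R)%type (fun p v => f p.1 (row_mx (p.2%:M : 'rV[R]_1) v))
  (measurable_param_cons _ T _ _ n f mf) (fun p v => f0 _ _).
move=> mE; apply: (measurable_fun_fubini_tonelli_F (m2 := mu) _ mE).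
by move=> p; exact: eint_ge0.
Qed.

Lemma measurable_eint_section n (f : 'rV[R]_n.+1 -> \bar R) :
  measurable_fun setT (fun v => f (rot v)) -> (forall v, 0 <= f v)%E ->
  measurable_fun setT (fun a : R => eint n (fun v => f (row_mx (a%:M : 'rV[R]_1) v))).
Proof.
move=> mf f0; apply: (measurable_eint n _ R (fun (a : R) v => f (row_mx (a%:M : 'rV[R]_1) v))) => //.
exact: measurable_cons_section.
Qed.

Lemma le_eint n (f g : 'rV[R]_n -> \bar R) :
  measurable_fun setT (fun v => f (rot v)) -> measurable_fun setT (fun v => g (rot v)) ->
  (forall v, 0 <= f v)%E -> (forall v, f v <= g v)%E -> (eint n f <= eint n g)%E.
Proof.
elim: n f g => [|n IH] f g mf mg f0 fg /=; first exact: fg.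
have g0 v : (0 <= g v)%E by exact: le_trans (fg v).
apply: ge0_le_integral => //.
- by move=> a _; exact: eint_ge0.
- exact: measurable_eint_section.
- exact: measurable_eint_section.
- move=> a _; apply: IH => //.
  + exact: (measurable_section _ _ _ _ _ (fun (a : R) v => f (row_mx (a%:M : 'rV[R]_1) v)) a (measurable_cons_section _ _ _ _ mf)).
  + exact: (measurable_section _ _ _ _ _ (fun (a : R) v => g (row_mx (a%:M : 'rV[R]_1) v)) a (measurable_cons_section _ _ _ _ mg)).
Qed.

Lemma measurable_cons_slice d' (E : measurableType d') n (f : 'rV[R]_n.+1 -> E) a :
  measurable_fun setT (fun v => f (rot v)) ->
  measurable_fun setT (fun v => f (row_mx (a%:M : 'rV[R]_1) (rot v))).
Proof.
move=> mf; exact: (measurable_section _ _ _ _ _ (fun (a : R) v => f (row_mx (a%:M : 'rV[R]_1) v)) a (measurable_cons_section _ _ _ _ mf)).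
Qed.

Lemma eint_tonelli n d (T : measurableType d) (m : {sigma_finite_measure set T -> \bar R})
    (f : T -> 'rV[R]_n -> \bar R) :
  measurable_fun setT (fun p : T * n.-tuple R => f p.1 (rot p.2)) ->
  (forall t v, 0 <= f t v)%E ->
  (\int[m]_t eint n (f t) = eint n (fun v => \int[m]_t f t v))%E.
Proof.
elim: n f => [//|n IH] f mf f0 /=.
have mF := measurable_param_cons _ T _ _ n f mf.
have mE := measurable_eint n _ _ (fun p : T * R => fun v => f p.1 (row_mx (p.2%:M : 'rV[R]_1) v))
  mF (fun p v => f0 _ _).
rewrite (fubini_tonelli (m1 := m) (m2 := mu) _ mE); last by move=> p; exact: eint_ge0.
apply: eq_integral => a _; rewrite -IH//.
pose g (p : T * n.-tuple R) : (T * R) * n.-tuple R := ((p.1, a), p.2).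
apply: (measurableT_comp mF (g := g)).
apply/measurable_fun_pairP; split; last exact: measurable_snd.
exact: (measurable_fun_pair measurable_fst (measurable_cst a)).
Qed.

Lemma eintZl n (k : \bar R) (f : 'rV[R]_n -> \bar R) : (0 <= k)%E ->
  measurable_fun setT (fun v => f (rot v)) -> (forall v, 0 <= f v)%E ->
  (eint n (fun v => k * f v) = k * eint n f)%E.
Proof.
move=> k0; elim: n f => [//|n IH] f mf f0 /=.
rewrite -ge0_integralZl//; last 2 first.
- exact: measurable_eint_section.
- by move=> a _; exact: eint_ge0.
by apply: eq_integral => a _; rewrite IH//; exact: measurable_cons_slice.
Qed.

Lemma measurable_coord_prod n (K : nat -> R -> R) :
  (forall i, measurable_fun setT (K i)) ->
  measurable_fun setT (fun v : n.-tuple R => (\prod_(i < n) K i (rot v 0 i))%:E).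
Proof.
move=> mK; apply/measurable_EFinP/measurable_prod => i _.
apply: (measurableT_comp (mK i)).
by under eq_fun do rewrite mxE; exact: measurable_tnth.
Qed.

(** The factors are indexed by [nat] rather than by ['I_n] so that the shifted family
    [fun i => K i.+1] serves the induction. *)
Lemma eint_prod n (K : nat -> R -> R) :
  (forall i, measurable_fun setT (K i)) -> (forall i a, 0 <= K i a) ->
  (eint n (fun v => (\prod_(i < n) K i (v 0 i))%:E) = \prod_(i < n) \int[mu]_a (K i a)%:E)%E.
Proof.
elim: n K => [|n IH] K mK K0 /=; first by rewrite !big_ord0.
rewrite big_ord_recl.
have C0 : (0 <= \prod_(i < n) \int[mu]_a (K (bump 0 i) a)%:E)%E.
  by apply: prode_ge0 => i _; apply: integral_ge0 => a _; rewrite lee_fin.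
rewrite -ge0_integralZr//; last 2 first.
- by have /measurable_EFinP := mK 0%N.
- by move=> a _; rewrite lee_fin.
apply: eq_integral => a _.
rewrite -(IH (fun i => K i.+1))// -eintZl//; last 3 first.
- by rewrite lee_fin.
- exact: (measurable_coord_prod n (fun i => K i.+1)).
- by move=> v; rewrite lee_fin prodr_ge0.
congr (eint n _); apply/funext => v; rewrite big_ord_recl EFinM; congr ((K _ _)%:E * (_)%:E)%E.
- exact: row_cons0.
- by apply: eq_bigr => i _; rewrite row_consS.
Qed.

Local Notation "f ^row" := (fun v => f (rot v)) (at level 2).

(** No integrability is assumed: the extended integral is a difference of two Tonelli-measurable
    functions of the parameter, and [fine] is measurable, infinite values included. *)
Lemma measurable_fine_integral d (T : measurableType d) (g : T * R -> R) :
  measurable_fun setT g ->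
  measurable_fun setT (fun t => \int[mu]_a g (t, a)).
Proof.
move=> mg; apply: (measurableT_comp (fine_measurable measurableT)).
have mg' : measurable_fun setT (EFin \o g) by exact/measurable_EFinP.
under eq_fun do rewrite integralE.
apply: emeasurable_funB.
- have Hp := @measurable_fun_fubini_tonelli_F _ _ T _ R mu (EFin \o g)^\+%E
    (measurable_funepos mg') (fun=> funepos_ge0 _ _).
  by apply: eq_measurable_fun Hp => t _; rewrite /fubini_F; apply: eq_integral => y _; rewrite !funeposE.
- have Hn := @measurable_fun_fubini_tonelli_F _ _ T _ R mu (EFin \o g)^\-%E
    (measurable_funeneg mg') (fun=> funeneg_ge0 _ _).
  by apply: eq_measurable_fun Hn => t _; rewrite /fubini_F; apply: eq_integral => y _; rewrite !funenegE.
Qed.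

Lemma measurable_iint n d (T : measurableType d) (f : T -> 'rV[R]_n -> R) :
  measurable_fun setT (fun p : T * n.-tuple R => f p.1 (rot p.2)) ->
  measurable_fun setT (fun t => iint (f t)).
Proof.
elim: n d T f => [|n IH] d T f mf /=.
  have := measurableT_comp mf (measurable_pair2 [tuple] : measurable_fun setT (fun t : T => (t, [tuple]))).
  by apply: eq_measurable_fun => t _; rewrite /= row_of_tuple0.
have := IH _ (T * R)%type (fun p v => f p.1 (row_mx (p.2%:M : 'rV[R]_1) v))
  (measurable_param_cons _ T _ _ n f mf).
exact: measurable_fine_integral.
Qed.

Lemma measurable_iint_section n (f : 'rV[R]_n.+1 -> R) :
  measurable_fun setT (fun v => f (rot v)) ->
  measurable_fun setT (fun a : R => iint (fun v => f (row_mx (a%:M : 'rV[R]_1) v))).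
Proof.
move=> mf; apply: (measurable_iint n _ R (fun (a : R) v => f (row_mx (a%:M : 'rV[R]_1) v))) => //.
exact: measurable_cons_section.
Qed.

Let mabs n (f : 'rV[R]_n -> R) : measurable_fun setT (fun v => f (rot v)) ->
  measurable_fun setT (fun v => `|f (rot v)|%:E).
Proof. by move=> mf; apply/measurable_EFinP/measurableT_comp. Qed.

(** Divergent inner integrals do no harm, since [fine] then returns 0. *)
Lemma abs_iint_le n (f : 'rV[R]_n -> R) :
  measurable_fun setT (fun v => f (rot v)) ->
  (`|iint f|%:E <= eint n (fun v => `|f v|%:E))%E.
Proof.
elim: n f => [//|n IH] f mf /=.
have mi := measurable_iint_section n f mf.
apply: (@le_trans _ _ `|\int[mu]_a (iint (fun v => f (row_mx (a%:M : 'rV[R]_1) v)))%:E|%E).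
  by rewrite /Rintegral; case: (integral _ _ _) => [r| |] //=; rewrite ?normr0 ?leey.
have mi' : measurable_fun setT (fun a : R => (iint (fun v => f (row_mx (a%:M : 'rV[R]_1) v)))%:E).
  exact/measurable_EFinP.
apply: (le_trans (le_abse_integral mu measurableT mi')).
apply: ge0_le_integral => //.
- exact: measurableT_comp.
- apply: (measurable_eint_section n (fun v => `|f v|%:E)) => //; exact: mabs.
- by move=> a _; apply: IH; exact: measurable_cons_slice.
Qed.

Lemma integrable_iint_section n (f : 'rV[R]_n.+1 -> R) :
  measurable_fun setT (fun v => f (rot v)) ->
  (eint n.+1 (fun v => `|f v|%:E) < +oo)%E ->
  mu.-integrable setT (fun a : R => (iint (fun v => f (row_mx (a%:M : 'rV[R]_1) v)))%:E).
Proof.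
move=> mf foo; have mi := measurable_iint_section n f mf.
apply/integrableP; split; first exact/measurable_EFinP.
apply: le_lt_trans foo; apply: ge0_le_integral => //.
- by apply: measurableT_comp => //; exact/measurable_EFinP.
- apply: (measurable_eint_section n (fun v => `|f v|%:E)) => //; exact: mabs.
- by move=> a _; apply: abs_iint_le; exact: measurable_cons_slice.
Qed.

Lemma ae_eint_lty n (f : 'rV[R]_n.+1 -> R) :
  measurable_fun setT (fun v => f (rot v)) ->
  (eint n.+1 (fun v => `|f v|%:E) < +oo)%E ->
  {ae mu, forall a, (eint n (fun v => `|f (row_mx (a%:M : 'rV[R]_1) v)|%:E) < +oo)%E}.
Proof.
move=> mf foo.
have H : mu.-integrable setT (fun a : R => eint n (fun v => `|f (row_mx (a%:M : 'rV[R]_1) v)|%:E)).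
  apply/integrableP; split.
    by apply: (measurable_eint_section n (fun v => `|f v|%:E)) => //; exact: mabs.
  apply: le_lt_trans foo; rewrite le_eqVlt; apply/orP; left; apply/eqP.
  by apply: eq_integral => a _; rewrite gee0_abs//; exact: eint_ge0.
have := integrable_ae measurableT H.
apply: filterS => a /(_ I) fa.
by rewrite ltey; move: fa; rewrite fin_numE => /andP[].
Qed.

(** The induction hypothesis applies only to slices of finite absolute integral. By [ae_eint_lty]
    almost all slices are such, and the outer integral ignores the exceptional null set. *)
Lemma iintD n (f g : 'rV[R]_n -> R) :
  measurable_fun setT (fun v => f (rot v)) -> measurable_fun setT (fun v => g (rot v)) ->
  (eint n (fun v => `|f v|%:E) < +oo)%E -> (eint n (fun v => `|g v|%:E) < +oo)%E ->
  iint (fun v => f v + g v) = iint f + iint g.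
Proof.
elim: n f g => [//|n IH] f g mf mg foo goo /=.
rewrite -RintegralD//; [|exact: integrable_iint_section|exact: integrable_iint_section].
rewrite /Rintegral; congr fine; apply: ae_eq_integral => //.
- apply/measurable_EFinP; apply: (measurable_iint_section n (fun v => f v + g v)).
  exact: measurable_funD.
- by apply/measurable_EFinP/measurable_funD; exact: measurable_iint_section.
have [Z1 [mZ1 Z10 sZ1]] := ae_eint_lty n f mf foo.
have [Z2 [mZ2 Z20 sZ2]] := ae_eint_lty n g mg goo.
exists (Z1 `|` Z2); split; first exact: measurableU.
  by rewrite null_set_setU.
move=> a nE; apply: contrapT => nZ; apply: nE => _; congr EFin.
have fa : (eint n (fun v => `|f (row_mx (a%:M : 'rV[R]_1) v)|%:E) < +oo)%E.
  by apply: contrapT => na; apply: nZ; left; exact: sZ1.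
have ga : (eint n (fun v => `|g (row_mx (a%:M : 'rV[R]_1) v)|%:E) < +oo)%E.
  by apply: contrapT => na; apply: nZ; right; exact: sZ2.
by apply: IH => //; exact: measurable_cons_slice.
Qed.

Lemma iintZl n (k : R) (f : 'rV[R]_n -> R) :
  measurable_fun setT (fun v => f (rot v)) ->
  (eint n (fun v => `|f v|%:E) < +oo)%E ->
  iint (fun v => k * f v) = k * iint f.
Proof.
elim: n f => [//|n IH] f mf foo /=.
rewrite -RintegralZl//; last exact: integrable_iint_section.
rewrite /Rintegral; congr fine; apply: ae_eq_integral => //.
- apply/measurable_EFinP; apply: (measurable_iint_section n (fun v => k * f v)).
  exact: measurable_funM.
- by apply/measurable_EFinP/measurable_funM => //; exact: measurable_iint_section.
have := ae_eint_lty n f mf foo.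
move=> [Z [mZ Z0 sZ]]; exists Z; split => //.
apply: subset_trans sZ; apply: subsetC => a fa _; congr EFin.
by apply: IH => //; exact: measurable_cons_slice.
Qed.

Lemma iint_eint n (f : 'rV[R]_n -> R) :
  measurable_fun setT (fun v => f (rot v)) -> (forall v, 0 <= f v) ->
  (eint n (fun v => (f v)%:E) < +oo)%E ->
  (iint f)%:E = eint n (fun v => (f v)%:E).
Proof.
elim: n f => [//|n IH] f mf f0 foo /=.
have absf : (fun v => `|f v|%:E) = (fun v => (f v)%:E).
  by apply/funext => v; rewrite ger0_norm.
have foo' : (eint n.+1 (fun v => `|f v|%:E) < +oo)%E by rewrite absf.
have Hi := integrable_iint_section n f mf foo'.
rewrite /Rintegral fineK; last exact: integrable_fin_num Hi.
apply: ae_eq_integral => //.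
- exact: measurable_int Hi.
- apply: (measurable_eint_section n (fun v => (f v)%:E)) => //; exact/measurable_EFinP.
have := ae_eint_lty n f mf foo'.
move=> [Z [mZ Z0 sZ]]; exists Z; split => //.
apply: subset_trans sZ; apply: subsetC => a fa _; apply: IH => //; first exact: measurable_cons_slice.
apply: le_lt_trans fa; rewrite le_eqVlt; apply/orP; left; apply/eqP.
by congr (eint n _); apply/funext => v; rewrite ger0_norm.
Qed.

End iterated_integrals.

(** * The squared modulus of Fg *)

Section trigonometric_bounds.
Context {R : realType}.
Implicit Types x y t a r s : R.

Lemma sin_abs_le x : `|sin x| <= `|x|.
Proof.
wlog x0 : x / 0 <= x.
  move=> H; case: (leP 0 x) => [|/ltW x0]; first exact: H.
  by rewrite -(normrN (sin x)) -sinN -(normrN x); apply: H; rewrite oppr_ge0.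
have dsin z : z \in `]0, x[ -> is_derive z (1:R) sin (cos z) by move=> _; exact: is_derive_sin.
have csin : {within `[0, x], continuous (@sin R)}.
  by apply: continuous_subspaceT; exact: continuous_sin.
have [c _] := MVT_segment x0 dsin csin; rewrite sin0 !subr0 => ->.
by rewrite normrM ler_piMl// ler_norml cos_geN1 cos_le1.
Qed.

Lemma sin_sqr_le1 x : sin x ^+ 2 <= 1.
Proof. by have := cos2Dsin2 x; have := sqr_ge0 (cos x); lra. Qed.

Lemma cosB_cos x y : cos x - cos y = - (2 * sin ((x + y) / 2) * sin ((x - y) / 2)).
Proof.
have -> : cos x = cos ((x + y) / 2 + (x - y) / 2) by congr cos; field.
have -> : cos y = cos ((x + y) / 2 - (x - y) / 2) by congr cos; field.
rewrite cosD cosB; ring.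
Qed.

Lemma sinB_sin x y : sin x - sin y = 2 * cos ((x + y) / 2) * sin ((x - y) / 2).
Proof.
have -> : sin x = sin ((x + y) / 2 + (x - y) / 2) by congr sin; field.
have -> : sin y = sin ((x + y) / 2 - (x - y) / 2) by congr sin; field.
rewrite sinD sinB; ring.
Qed.

Lemma cosB_cos_le x y : `|cos x - cos y| <= `|x ^+ 2 - y ^+ 2| / 2.
Proof.
rewrite cosB_cos normrN !normrM (ger0_norm (x := 2))//.
have H1 := sin_abs_le ((x + y) / 2); have H2 := sin_abs_le ((x - y) / 2).
have -> : x ^+ 2 - y ^+ 2 = 4 * (((x + y) / 2) * ((x - y) / 2)) by field.
rewrite normrM (ger0_norm (x := 4))// normrM.
have -> : 4 * (`|(x + y) / 2| * `|(x - y) / 2|) / 2 = 2 * (`|(x + y) / 2| * `|(x - y) / 2|) by field.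
by rewrite -mulrA ler_wpM2l// ler_pM.
Qed.

(** Squared length of a chord of the unit circle. *)
Lemma chord_sqr x y :
  (cos x - cos y) ^+ 2 + (sin x - sin y) ^+ 2 = 4 * sin ((x - y) / 2) ^+ 2.
Proof.
rewrite cosB_cos sinB_sin sqrrN !exprMn.
have -> : cos ((x + y) / 2) ^+ 2 = 1 - sin ((x + y) / 2) ^+ 2.
  by have := cos2Dsin2 ((x + y) / 2); lra.
ring.
Qed.

Lemma sin_ge_half x : 0 <= x <= 1 -> x / 2 <= sin x.
Proof.
move=> /andP[x0 x1].
have dsin z : z \in `]0, x[ -> is_derive z (1:R) sin (cos z) by move=> _; exact: is_derive_sin.
have csin : {within `[0, x], continuous (@sin R)}.
  by apply: continuous_subspaceT; exact: continuous_sin.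
have [c] := MVT_segment x0 dsin csin; rewrite sin0 !subr0 in_itv/= => /andP[c0 cx] ->.
have := cosB_cos_le c 0; rewrite cos0 expr0n/= subr0 (ger0_norm (sqr_ge0 c)).
rewrite ler_norml => /andP[H _].
have : c ^+ 2 <= 1 by rewrite expr_le1// (le_trans cx).
by move=> c2; rewrite mulrC ler_wpM2r//; lra.
Qed.

End trigonometric_bounds.

Section amplitude.
Context {R : realType}.
Implicit Types t a r s tau : R.

(* |Fg t x tau xi|^2 as a function of a = |xi|, with the junk values of the
   divisions at a = 0 and at tau = a, - a. *)
Definition amp t tau a : R :=
  ((2 * a)^-1) ^+ 2 *
  (((cos (t * tau) - cos (t * a)) / (tau + a) - (cos (t * tau) - cos (t * a)) / (tau - a)) ^+ 2
  + ((- sin (t * tau) - sin (t * a)) / (tau + a) - (- sin (t * tau) + sin (t * a)) / (tau - a)) ^+ 2).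

(** Numerator of [amp] over the common denominator [(r^2 - a^2)^2] at [r = |tau|], the prefactor
    having cancelled. Both squared terms vanish at [r = a], which compensates the double pole
    there. *)
Definition amp_num t r a : R :=
  (cos (t * a) - cos (t * r)) ^+ 2 + (r * sin (t * a) / a - sin (t * r)) ^+ 2.

Lemma amp_ge0 t tau a : 0 <= amp t tau a.
Proof. by rewrite mulr_ge0 ?sqr_ge0// addr_ge0 ?sqr_ge0. Qed.

Lemma amp_num_ge0 t r a : 0 <= amp_num t r a.
Proof. by rewrite addr_ge0 ?sqr_ge0. Qed.

Lemma ampE t tau a : 0 < a -> `|tau| != a ->
  amp t tau a = amp_num t `|tau| a / (`|tau| ^+ 2 - a ^+ 2) ^+ 2.
Proof.
move=> a0 ta.
have na : a != 0 by rewrite gt_eqF.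
have n1 : tau + a != 0.
  apply/eqP => E; move/eqP: ta; apply.
  have -> : tau = - a by lra.
  by rewrite normrN gtr0_norm.
have n2 : tau - a != 0.
  apply/eqP => E; move/eqP: ta; apply.
  have -> : tau = a by lra.
  by rewrite gtr0_norm.
have n3 : tau ^+ 2 - a ^+ 2 != 0.
  have -> : tau ^+ 2 - a ^+ 2 = (tau - a) * (tau + a) by ring.
  by rewrite mulf_neq0.
have -> : amp t tau a = amp_num t tau a / (tau ^+ 2 - a ^+ 2) ^+ 2.
  by rewrite /amp /amp_num; field; rewrite n3 n1 n2 na.
rewrite real_normK ?num_real//; congr (_ / _).
case: (leP 0 tau) => [t0|t0]; first by rewrite ger0_norm.
rewrite ltr0_norm// /amp_num !mulrN cosN sinN; congr (_ + _); field.
by rewrite na.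
Qed.

(** Mean value theorem in the time variable: the derivative [r (cos (s a) - cos (s r))] no longer
    contains [1 / a], so the bound is uniform as [a] tends to 0. *)
Lemma sin_ratio_le t r a : 0 < t -> 0 < a -> 0 <= r ->
  `|r * sin (t * a) / a - sin (t * r)| <= r * t ^+ 3 * `|r ^+ 2 - a ^+ 2| / 2.
Proof.
move=> t0 a0 r0.
pose D s := r * sin (s * a) / a - sin (s * r).
have dD s : is_derive s (1:R) D (r * (cos (s * a) - cos (s * r))).
  have H1 : is_derive s (1:R) (fun y : R => y * a) a.
    have -> : (fun y : R => y * a) = (fun y : R => a *: (y : R)).
      by apply/funext => y; rewrite mulrC.
    by apply: is_derive_eq; rewrite /GRing.scale/= mulr1.
  have H2 : is_derive s (1:R) (fun y : R => y * r) r.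
    have -> : (fun y : R => y * r) = (fun y : R => r *: (y : R)).
      by apply/funext => y; rewrite mulrC.
    by apply: is_derive_eq; rewrite /GRing.scale/= mulr1.
  have H3 := @is_derive1_comp _ sin (fun y : R => y * a) s _ _ (is_derive_sin _) H1.
  have H4 := @is_derive1_comp _ sin (fun y : R => y * r) s _ _ (is_derive_sin _) H2.
  have -> : D = (fun y => (r / a) *: ((sin \o (fun y : R => y * a)) y : R) - (sin \o (fun y : R => y * r)) y).
    by apply/funext => y; rewrite /D/= /GRing.scale/= mulrAC.
  by apply: is_derive_eq; rewrite /GRing.scale/=; field; rewrite gt_eqF.
have cD : {within `[0, t], continuous D}.
  apply: continuous_subspaceT => s.
  by apply/differentiable_continuous/derivable1_diffP; have [] := dD s.
have [c] := MVT_segment (ltW t0) (fun s _ => dD s) cD.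
rewrite in_itv/= => /andP[c0 ct].
have -> : D 0 = 0 by rewrite /D !mul0r sin0 mulr0 mul0r subrr.
rewrite !subr0 => E; rewrite -/(D t) E !normrM (ger0_norm r0) (gtr0_norm t0).
have H := cosB_cos_le (c * a) (c * r).
have E2 : `|(c * a) ^+ 2 - (c * r) ^+ 2| = c ^+ 2 * `|r ^+ 2 - a ^+ 2|.
  have -> : (c * a) ^+ 2 - (c * r) ^+ 2 = - (c ^+ 2 * (r ^+ 2 - a ^+ 2)) by ring.
  by rewrite normrN normrM ger0_norm ?sqr_ge0.
rewrite E2 in H.
have c2 : c ^+ 2 <= t ^+ 2 by rewrite ler_sqr ?nnegrE// ltW.
have -> : r * t ^+ 3 * `|r ^+ 2 - a ^+ 2| / 2 = r * (t ^+ 2 * `|r ^+ 2 - a ^+ 2| / 2) * t by field.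
rewrite ler_wpM2r ?(ltW t0)// ler_wpM2l//; apply: (le_trans H).
by rewrite ler_wpM2r ?invr_ge0// ler_wpM2r.
Qed.

Lemma amp_num_le1 t r a : 0 < t -> 0 < a -> 0 <= r ->
  amp_num t r a <= (t ^+ 4 + r ^+ 2 * t ^+ 6) * (r ^+ 2 - a ^+ 2) ^+ 2.
Proof.
move=> t0 a0 r0.
have H1 := cosB_cos_le (t * a) (t * r).
have E1 : `|(t * a) ^+ 2 - (t * r) ^+ 2| = t ^+ 2 * `|r ^+ 2 - a ^+ 2|.
  have -> : (t * a) ^+ 2 - (t * r) ^+ 2 = - (t ^+ 2 * (r ^+ 2 - a ^+ 2)) by ring.
  by rewrite normrN normrM ger0_norm ?sqr_ge0.
rewrite E1 in H1; have H2 := sin_ratio_le t r a t0 a0 r0.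
set q := `|r ^+ 2 - a ^+ 2| in H1 H2.
have q2 : q ^+ 2 = (r ^+ 2 - a ^+ 2) ^+ 2 by rewrite real_normK ?num_real.
have q0 : 0 <= q by exact: normr_ge0.
rewrite /amp_num -q2 mulrDl; apply: lerD.
  rewrite -[leLHS]real_normK ?num_real//.
  apply: (@le_trans _ _ ((t ^+ 2 * q / 2) ^+ 2)).
    by rewrite ler_sqr ?nnegrE// divr_ge0// mulr_ge0// sqr_ge0.
  have -> : (t ^+ 2 * q / 2) ^+ 2 = t ^+ 4 * q ^+ 2 / 4 by field.
  have : 0 <= t ^+ 4 * q ^+ 2 by rewrite mulr_ge0 ?sqr_ge0// exprn_ge0// ltW.
  lra.
rewrite -[leLHS]real_normK ?num_real//.
apply: (@le_trans _ _ ((r * t ^+ 3 * q / 2) ^+ 2)).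
  by rewrite ler_sqr ?nnegrE// divr_ge0// mulr_ge0// mulr_ge0// exprn_ge0// ltW.
have -> : (r * t ^+ 3 * q / 2) ^+ 2 = r ^+ 2 * t ^+ 6 * q ^+ 2 / 4 by field.
have : 0 <= r ^+ 2 * t ^+ 6 * q ^+ 2 by rewrite !mulr_ge0 ?sqr_ge0 ?exprn_ge0 ?(ltW t0).
lra.
Qed.

Lemma amp_num_le2 t r a : 0 < t -> 0 < a -> 0 <= r ->
  amp_num t r a <= 6 + 2 * r ^+ 2 * t ^+ 2.
Proof.
move=> t0 a0 r0; rewrite /amp_num.
have hs : `|sin (t * a)| <= t * a.
  by rewrite (le_trans (sin_abs_le _))// ger0_norm// mulr_ge0// ltW.
have h1 : `|r * sin (t * a) / a| <= r * t.
  rewrite !normrM normfV (ger0_norm r0) (gtr0_norm a0) -mulrA ler_wpM2l//.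
  by rewrite ler_pdivrMr.
have sq (x b : R) : `|x| <= b -> x ^+ 2 <= b ^+ 2.
  by move=> xb; rewrite -[leLHS]real_normK ?num_real// ler_sqr ?nnegrE ?(le_trans _ xb).
have h2 := sq _ _ h1.
have h3 := sq _ _ (sin_max (t * r)).
have h4 := sq _ _ (cos_max (t * r)).
have h5 := sq _ _ (cos_max (t * a)).
set x := r * _ / a in h2 *; set y := sin _ in h3 *.
set z := cos _ in h5 *; set w := cos _ in h4 *.
have : 0 <= (x + y) ^+ 2 by exact: sqr_ge0.
have : 0 <= (z + w) ^+ 2 by exact: sqr_ge0.
have -> : 2 * r ^+ 2 * t ^+ 2 = 2 * (r * t) ^+ 2 by ring.
nra.
Qed.

(** For [|tau| <= 2] the numerator contains the whole denominator ([amp_num_le1]). For larger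
    [|tau|] the denominator is at least [r^4 / 2] because [a <= 1], while the numerator grows only
    like [r^2] ([amp_num_le2]). *)
Lemma amp_low_frequency t tau a : 0 < t -> 0 < a -> a <= 1 -> `|tau| != a ->
  amp t tau a <= 9 * (1 + t ^+ 2 + t ^+ 4 + 4 * t ^+ 6) / (1 + `|tau|) ^+ 2.
Proof.
move=> t0 a0 a1 ta; rewrite ampE//.
have r0 := normr_ge0 tau; set r := `|tau| in r0 ta *.
have r1 : 0 < (1 + r) ^+ 2 by rewrite exprn_gt0//; lra.
have d0 : 0 < (r ^+ 2 - a ^+ 2) ^+ 2.
  rewrite exprn_even_gt0//= subr_eq0; apply/eqP => /eqP.
  by rewrite eqrXn2// ?ltW// => /eqP E; move/eqP: ta.
have t2 : 0 <= t ^+ 2 by exact: sqr_ge0.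
have t4 : 0 <= t ^+ 4 by rewrite exprn_ge0// ltW.
have t6 : 0 <= t ^+ 6 by rewrite exprn_ge0// ltW.
rewrite ler_pdivrMr// mulrAC ler_pdivlMr//.
case: (leP r 2) => r2.
  have H := amp_num_le1 t r a t0 a0 r0.
  have r4 : r ^+ 2 <= 4.
    have -> : 4 = 2 ^+ 2 :> R by ring.
    by rewrite ler_sqr ?nnegrE.
  have r9 : (1 + r) ^+ 2 <= 9 by nra.
  apply: (@le_trans _ _ ((t ^+ 4 + r ^+ 2 * t ^+ 6) * (r ^+ 2 - a ^+ 2) ^+ 2 * 9)).
    by rewrite ler_pM// ?amp_num_ge0 ?ltW.
  rewrite mulrAC ler_wpM2r ?ltW//.
  have : r ^+ 2 * t ^+ 6 <= 4 * t ^+ 6 by rewrite ler_wpM2r.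
  lra.
have H := amp_num_le2 t r a t0 a0 r0.
have a2 : a ^+ 2 <= 1 by rewrite expr_le1// ltW.
have a20 : 0 <= a ^+ 2 by exact: sqr_ge0.
have r4 : 4 <= r ^+ 2 by nra.
have d1 : r ^+ 2 * r ^+ 2 / 2 <= (r ^+ 2 - a ^+ 2) ^+ 2 by nra.
have r9 : (1 + r) ^+ 2 <= 9 / 4 * r ^+ 2 by nra.
apply: (@le_trans _ _ ((6 + 2 * r ^+ 2 * t ^+ 2) * (9 / 4 * r ^+ 2))).
  by rewrite ler_pM// ?amp_num_ge0 ?ltW.
apply: (@le_trans _ _ (9 * (1 + t ^+ 2 + t ^+ 4 + 4 * t ^+ 6) * (r ^+ 2 * r ^+ 2 / 2))).
  2: by rewrite ler_wpM2l// mulr_ge0// !addr_ge0// mulr_ge0.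
apply: (@le_trans _ _ (9 * (1 + t ^+ 2) * (r ^+ 2 * r ^+ 2 / 2))); first nra.
by rewrite ler_wpM2r ?divr_ge0 ?mulr_ge0 ?sqr_ge0// ler_wpM2l//; lra.
Qed.

(** Separates the effect of [r / a] differing from 1 from a coordinate of the chord between the
    angles [t a] and [t r]. *)
Lemma sin_difference_split t r a : 0 < a ->
  r * sin (t * a) / a - sin (t * r) =
  (r - a) / a * sin (t * a) + (sin (t * a) - sin (t * r)).
Proof. by move=> a0; field; rewrite gt_eqF. Qed.

(** With [s = |tau| - a] the numerator is at most twice the squared chord plus [2 s^2 / a^2]. The
    chord bound [t^2 s^2] removes the zero of the denominator [s^2 (r + a)^2], and the bound 4 gives
    the decay away from resonance. *)
Lemma amp_high_frequency t tau a : 0 < t -> 1 <= a -> `|tau| != a ->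
  amp t tau a <= (4 * t ^+ 2 + 24) / (a ^+ 2 * (1 + `| `|tau| - a |) ^+ 2).
Proof.
move=> t0 a1 ta; have a0 : 0 < a by exact: lt_le_trans a1.
rewrite ampE//.
have r0 := normr_ge0 tau; set r := `|tau| in r0 ta *.
set s := r - a; have s0 : s != 0 by rewrite subr_eq0.
have ns0 : 0 < `|s| by rewrite normr_gt0.
have s2 : 0 < s ^+ 2 by rewrite exprn_even_gt0.
have dE : (r ^+ 2 - a ^+ 2) ^+ 2 = s ^+ 2 * (r + a) ^+ 2 by rewrite /s; ring.
have ra0 : 0 < r + a by lra.
have ra2 : 0 < (r + a) ^+ 2 by rewrite exprn_gt0.
have a20 : 0 < a ^+ 2 by rewrite exprn_gt0.
have w0 : 0 < (1 + `|s|) ^+ 2 by rewrite exprn_gt0//; lra.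
rewrite dE (ler_pdivrMr _ _ (mulr_gt0 s2 ra2)) mulrAC (ler_pdivlMr _ _ (mulr_gt0 a20 w0)).
set m := 4 * sin ((t * a - t * r) / 2) ^+ 2.
have m4 : m <= 4.
  by have := sin_sqr_le1 ((t * a - t * r) / 2); rewrite /m; lra.
have mt : m <= t ^+ 2 * s ^+ 2.
  have -> : t ^+ 2 * s ^+ 2 = 4 * ((t * a - t * r) / 2) ^+ 2 by rewrite /s; field.
  rewrite /m ler_wpM2l// -[leLHS]real_normK ?num_real// -[leRHS]real_normK ?num_real//.
  by rewrite ler_sqr ?nnegrE// sin_abs_le.
have num : amp_num t r a <= 2 * m + 2 * (s ^+ 2 / a ^+ 2).
  rewrite /amp_num sin_difference_split// -/s.
  have := chord_sqr (t * a) (t * r); rewrite -/m.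
  set p1 := cos _ - cos _; set p2 := sin (t * a) - sin (t * r) => pm.
  have q2 : (s / a * sin (t * a)) ^+ 2 <= s ^+ 2 / a ^+ 2.
    by rewrite exprMn expr_div_n ler_piMr ?divr_ge0 ?sqr_ge0 ?sin_sqr_le1.
  set q := s / a * _ in q2 *.
  have : 0 <= (q - p2) ^+ 2 by exact: sqr_ge0.
  have : 0 <= p1 ^+ 2 by exact: sqr_ge0.
  nra.
apply: (le_trans (ler_wpM2r _ num)); first by rewrite mulr_ge0 ?ltW.
have sa : `|s| <= r + a.
  by rewrite /s ler_norml; apply/andP; split; lra.
have s2E : `|s| ^+ 2 = s ^+ 2 by rewrite real_normK ?num_real.
have w1 : (1 + `|s|) ^+ 2 <= 2 + 2 * s ^+ 2 by rewrite -s2E; have := sqr_ge0 (1 - `|s|); set q := `|s|; nra.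
have w2 : (1 + `|s|) ^+ 2 <= 4 * (r + a) ^+ 2.
  have -> : 4 * (r + a) ^+ 2 = (2 * (r + a)) ^+ 2 by ring.
  by rewrite ler_sqr ?nnegrE; lra.
have a2r : a ^+ 2 <= (r + a) ^+ 2 by rewrite ler_sqr ?nnegrE; lra.
have m0 : 0 <= m by rewrite mulr_ge0// sqr_ge0.
have P1 : 2 * m * (a ^+ 2 * (1 + `|s|) ^+ 2) <= (4 * t ^+ 2 + 16) * (s ^+ 2 * (r + a) ^+ 2).
  have Q1 : m * (1 + `|s|) ^+ 2 <= (2 * t ^+ 2 + 8) * s ^+ 2.
    apply: (le_trans (ler_wpM2l m0 w1)).
    have : m * s ^+ 2 <= 4 * s ^+ 2 by rewrite ler_wpM2r// ltW.
    lra.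
  have -> : 2 * m * (a ^+ 2 * (1 + `|s|) ^+ 2) = 2 * (m * (1 + `|s|) ^+ 2 * a ^+ 2) by ring.
  have -> : (4 * t ^+ 2 + 16) * (s ^+ 2 * (r + a) ^+ 2) =
     2 * ((2 * t ^+ 2 + 8) * s ^+ 2 * (r + a) ^+ 2) by ring.
  apply: ler_wpM2l => //; apply: ler_pM => //; [exact: mulr_ge0 m0 (ltW w0)|exact: ltW].
have P2 : 2 * (s ^+ 2 / a ^+ 2) * (a ^+ 2 * (1 + `|s|) ^+ 2) <= 8 * (s ^+ 2 * (r + a) ^+ 2).
  have -> : 2 * (s ^+ 2 / a ^+ 2) * (a ^+ 2 * (1 + `|s|) ^+ 2) = 2 * (s ^+ 2 * (1 + `|s|) ^+ 2).
    by field; rewrite gt_eqF.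
  have -> : 8 * (s ^+ 2 * (r + a) ^+ 2) = 2 * (s ^+ 2 * (4 * (r + a) ^+ 2)) by ring.
  by rewrite ler_wpM2l// ler_wpM2l// ltW.
rewrite mulrDl; lra.
Qed.

(** The squared chord is at least [t^2 s^2 / 4], the correction [(s / a)^2] at most [t^2 s^2 / 16]
    since [a t >= 4], and [(q + p)^2 >= p^2 / 2 - q^2] leaves [t^2 s^2 / 16] in the numerator. The
    denominator is at most [9 a^2 s^2], whence 144 = 16 * 9. *)
Lemma amp_resonance t a s : 0 < t -> 4 / t <= a -> 0 < s -> s <= a -> t * s <= 2 ->
  t ^+ 2 / (144 * a ^+ 2) <= amp t (a + s) a.
Proof.
move=> t0 ta s0 sa ts.
have a0 : 0 < a by apply: lt_le_trans ta; rewrite divr_gt0.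
have as0 : 0 < a + s by lra.
have abs : `|a + s| = a + s by rewrite gtr0_norm.
rewrite ampE// abs; last by rewrite gt_eqF//; lra.
have dE : ((a + s) ^+ 2 - a ^+ 2) ^+ 2 = s ^+ 2 * (2 * a + s) ^+ 2 by ring.
have s2 : 0 < s ^+ 2 by rewrite exprn_gt0.
have a2 : 0 < a ^+ 2 by rewrite exprn_gt0.
have d0 : 0 < s ^+ 2 * (2 * a + s) ^+ 2.
  by rewrite mulr_gt0// exprn_gt0//; lra.
rewrite dE ler_pdivlMr//.
have num : s ^+ 2 * t ^+ 2 / 16 <= amp_num t (a + s) a.
  rewrite /amp_num sin_difference_split//.
  have -> : a + s - a = s by ring.
  have := chord_sqr (t * a) (t * (a + s)).
  have -> : (t * a - t * (a + s)) / 2 = - (t * s / 2) by field.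
  rewrite sinN sqrrN.
  have ss : t * s / 2 / 2 <= sin (t * s / 2).
    have ts0 : 0 < t * s by rewrite mulr_gt0.
    by apply: sin_ge_half; apply/andP; split; lra.
  have ss2 : (t * s / 2 / 2) ^+ 2 <= sin (t * s / 2) ^+ 2.
    rewrite ler_sqr ?nnegrE// ?(le_trans _ ss)// !divr_ge0// mulr_ge0// ltW//.
  set p1 := cos _ - cos _; set p2 := sin (t * a) - sin (t * (a + s)) => pm.
  have q2 : (s / a * sin (t * a)) ^+ 2 <= s ^+ 2 * t ^+ 2 / 16.
    rewrite exprMn expr_div_n.
    apply: (@le_trans _ _ (s ^+ 2 / a ^+ 2)).
      by rewrite ler_piMr ?divr_ge0 ?sqr_ge0 ?sin_sqr_le1.
    rewrite -mulrA; apply: (ler_wpM2l (ltW s2)).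
    have ta4 : 4 <= a * t by rewrite -ler_pdivrMr.
    rewrite -[leLHS]mul1r ler_pdivrMr//; nra.
  set q := s / a * _ in q2 *.
  have : 0 <= (2 * q + p2) ^+ 2 by exact: sqr_ge0.
  have : 0 <= p1 ^+ 2 by exact: sqr_ge0.
  have : (t * s / 2 / 2) ^+ 2 = s ^+ 2 * t ^+ 2 / 16 by field.
  nra.
apply: le_trans num.
have -> : t ^+ 2 / (144 * a ^+ 2) * (s ^+ 2 * (2 * a + s) ^+ 2) =
   s ^+ 2 * t ^+ 2 / 16 * ((2 * a + s) ^+ 2 / (9 * a ^+ 2)).
  by field; rewrite gt_eqF.
apply: ler_piMr; first by rewrite divr_ge0// mulr_ge0// sqr_ge0.
have a9 : 0 < 9 * a ^+ 2 by rewrite mulr_gt0.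
rewrite (ler_pdivrMr _ _ a9) mul1r.
have -> : 9 * a ^+ 2 = (3 * a) ^+ 2 by ring.
by rewrite ler_sqr ?nnegrE; lra.
Qed.

End amplitude.

Section covariance_integrand.
Context {R : realType}.

(** At equal times the two transforms differ only by their spatial phase, so their Hermitian product
    is a squared modulus times [exp (- i (x - y) . xi)]. *)
Lemma cov_integrand_re N (H : R) (h : 'rV[R]_N -> R) t (x y : 'rV[R]_N) tau xi :
  complex.Re (cov_integrand H h t x t y tau xi) =
  cos (dotv x xi - dotv y xi) *
  (amp t tau (enorm xi) * (powR `|tau| (1 - 2 * H) * h xi)).
Proof.
have Cdiv (u v r : R) : ((u +i* v) / (r%:C))%C = ((u / r) +i* (v / r))%C.
  rewrite -(fmorphV (real_complex R)); apply/eqP; rewrite eq_complex/=.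
  by rewrite !mulr0 subr0 add0r; apply/andP; split; apply/eqP; ring.
rewrite /cov_integrand /Fg /expi /amp.
rewrite !Cdiv; rewrite /=.
rewrite !cosN !sinN cosB mulrN; ring.
Qed.

End covariance_integrand.

(** * Power-type majorants on the real line *)

Section real_line_integrals.
Context {R : realType}.
Local Notation mu := (@lebesgue_measure R).
Implicit Types (p q c u v s : R).

Lemma ge0_integral_translation c (f : R -> \bar R) :
  measurable_fun setT f -> (forall x, 0 <= f x)%E ->
  (\int[mu]_x f (x - c)%R = \int[mu]_x f x)%E.
Proof.
move=> mf f0.
pose phi (x : measurableTypeR R) : measurableTypeR R := x - c.
have mphi : measurable_fun setT phi by exact: measurable_funB.
have -> : (\int[mu]_x f (x - c)%R = \int[pushforward mu phi]_x f x)%E.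
  by rewrite ge0_integral_pushforward.
apply: eq_measure_integral => //= A mA _; apply/esym/lebesgue_measure_unique => //= _ [[a b]] _ <-.
rewrite /pushforward /=.
have -> : phi @^-1` `]a, b]%classic = `](a + c), (b + c)]%classic.
  by apply/seteqP; split => x /=; rewrite /phi !in_itv/= ltrBrDr lerBlDr.
by rewrite !lebesgue_measure_itv/= !lte_fin ltrD2r -!EFinD; case: ifP => // _; congr EFin; ring.
Qed.

Lemma integral_powR u v c : 0 < u -> u < v -> c != 0 ->
  (\int[mu]_(s in `[u%R, v%R]) (powR s (c - 1))%:E = ((powR v c - powR u c) / c)%:E)%E.
Proof.
move=> u0 uv c0.
have dF (s : R) : 0 < s -> is_derive s (1:R) (fun s => c^-1 *: (powR s c : R)) (powR s (c - 1)).
  move=> s0; have H := is_deriveZ c^-1 (is_derive1_powR c s0).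
  by apply: is_derive_eq H _; rewrite /GRing.scale/= mulrA mulVf ?mul1r.
have cf (e : R) (s : R) : 0 < s -> {for s, continuous (fun s : R => powR s e)}.
  move=> s0; apply/differentiable_continuous/derivable1_diffP.
  by apply: derivable_powR; rewrite in_itv/= andbT.
rewrite (@continuous_FTC2 _ _ (fun s => c^-1 *: (powR s c : R))) //.
- by rewrite -EFinB /GRing.scale/= mulrBl mulrC (mulrC (powR v c)) (mulrC (powR u c)).
- apply: continuous_in_subspaceT => s; rewrite inE/= in_itv/= => /andP[us _].
  by apply: cf; exact: lt_le_trans us.
- have cF s : 0 < s -> {for s, continuous (fun s => c^-1 *: (powR s c : R))}.
    move=> s0; apply/differentiable_continuous/derivable1_diffP.
    by have [] := dF s s0.
  split => [s||].
  + by rewrite in_itv/= => /andP[us _]; have [] := dF s (lt_trans u0 us).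
  + by apply: cvg_at_right_filter; exact: cF.
  + by apply: cvg_at_left_filter; apply: cF; exact: lt_trans uv.
- move=> s; rewrite in_itv/= => /andP[us _].
  by rewrite derive1E; have [_ ->] := dF s (lt_trans u0 us).
Qed.

(** Model majorant with independent exponents at the origin and at infinity, integrable when
    [p < 1 < q]. *)
Definition kfun p q s : R := if `|s| <= 1 then powR `|s| (- p) else powR `|s| (- q).

Lemma kfun_ge0 p q s : 0 <= kfun p q s.
Proof. by rewrite /kfun; case: ifP => _; exact: powR_ge0. Qed.

Lemma measurable_kfun p q : measurable_fun setT (kfun p q).
Proof.
apply: measurable_fun_ifT.
- apply: measurable_fun_ler => //.
- by apply: (measurableT_comp (measurable_powR (- p))).
- by apply: (measurableT_comp (measurable_powR (- q))).
Qed.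

Lemma integral_kfun_itv p q v : p < 1 -> 1 < q -> 1 < v ->
  (\int[mu]_(s in `[(v^-1)%R, v%R]) (kfun p q s)%:E <= ((1 - p)^-1 + (q - 1)^-1)%:E)%E.
Proof.
move=> p1 q1 v1; have v0 : 0 < v by exact: lt_trans v1.
have vi0 : 0 < v^-1 by rewrite invr_gt0.
have vi1 : v^-1 < 1 by rewrite invf_lt1.
have mk D : measurable_fun D (fun s => (kfun p q s)%:E).
  by apply/measurable_funTS/measurable_EFinP; exact: measurable_kfun.
have mp e D : measurable_fun D (fun s : R => (powR s e)%:E).
  by apply/measurable_funTS/measurable_EFinP; exact: measurable_powR.
have k0 s : (0 <= (kfun p q s)%:E)%E by rewrite lee_fin kfun_ge0.
have -> : `[v^-1, v]%classic = `[v^-1, 1]%classic `|` `]1, v]%classic.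
  apply/seteqP; split => s /=; rewrite !in_itv/=.
    by move=> /andP[-> ->]; case: (leP s 1) => _; [left|right].
  by move=> [/andP[-> s1]|/andP[s1 ->]]; rewrite ?andbT ?(le_trans s1 (ltW v1)) ?(le_trans (ltW vi1) (ltW s1)).
rewrite ge0_integral_setU//=; last 2 first.
- exact: mk.
- rewrite disj_set2E; apply/eqP/seteqP; split => s //=; rewrite !in_itv/=.
  by move=> [/andP[_ s1] /andP[s2 _]]; move: (le_lt_trans s1 s2); rewrite ltxx.
rewrite EFinD; apply: leeD.
  have -> : (\int[mu]_(s in `[(v^-1)%R, 1%R]) (kfun p q s)%:E =
      \int[mu]_(s in `[(v^-1)%R, 1%R]) (powR s ((1 - p) - 1))%:E)%E.
    apply: eq_integral => s; rewrite inE/= in_itv/= => /andP[s0 s1].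
    have s00 : 0 <= s by exact: le_trans (ltW vi0) s0.
    by rewrite /kfun ger0_norm// s1; congr ((powR _ _)%:E); ring.
  rewrite integral_powR//; last by rewrite subr_eq0 gt_eqF.
  rewrite lee_fin powR1 -[leRHS]mul1r ler_wpM2r ?invr_ge0 ?subr_ge0 ?(ltW p1)//.
  by rewrite lerBlDr lerDl powR_ge0.
have -> : (\int[mu]_(s in `]1%R, v%R]) (kfun p q s)%:E =
    \int[mu]_(s in `]1%R, v%R]) (powR s ((1 - q) - 1))%:E)%E.
  apply: eq_integral => s; rewrite inE/= in_itv/= => /andP[s1 sv].
  have s00 : 0 <= s by exact: le_trans ler01 (ltW s1).
  by rewrite /kfun ger0_norm// leNgt s1/=; congr ((powR _ _)%:E); ring.
apply: (@le_trans _ _ (\int[mu]_(s in `[1%R, v%R]) (powR s ((1 - q) - 1))%:E)%E).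
  apply: ge0_subset_integral => //=.
  - exact: mp.
  - by move=> s _; rewrite lee_fin powR_ge0.
  - by move=> s /=; rewrite !in_itv/= => /andP[/ltW -> ->].
rewrite integral_powR//; last by rewrite subr_eq0 lt_eqF.
rewrite lee_fin powR1.
have -> : (powR v (1 - q) - 1) / (1 - q) = (1 - powR v (1 - q)) / (q - 1).
  by field; rewrite !subr_eq0 gt_eqF// lt_eqF.
rewrite -[leRHS]mul1r ler_wpM2r ?invr_ge0 ?subr_ge0 ?(ltW q1)//.
by rewrite lerBlDr lerDl powR_ge0.
Qed.

Lemma integral_kfun_lty p q : p < 1 -> 1 < q ->
  (\int[mu]_s (kfun p q s)%:E < +oo)%E.
Proof.
move=> p1 q1.
have mk D : measurable_fun D (fun s => (kfun p q s)%:E).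
  by apply/measurable_funTS/measurable_EFinP; exact: measurable_kfun.
have k0 s : (0 <= (kfun p q s)%:E)%E by rewrite lee_fin kfun_ge0.
have pos : (\int[mu]_(s in `[0%R, +oo[) (kfun p q s)%:E <= ((1 - p)^-1 + (q - 1)^-1)%:E)%E.
  rewrite -integral_itv_obnd_cbnd; last exact: mk.
  pose I0 : set R := `]0%R, +oo[%classic.
  (* Starting at 2 keeps the right endpoint above 1, as [integral_kfun_itv] requires; its bound does
     not depend on the interval. *)
  pose S n : set R := `[(n.+2%:R)^-1, n.+2%:R]%classic.
  pose g n := (fun s => (kfun p q s)%:E) \_ (S n).
  have mS n : measurable (S n) by exact: measurable_itv.
  have mg n : measurable_fun I0 (g n).
    by apply/measurable_funTS; apply/(measurable_restrictT _ _).1.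
  have g0 n s : I0 s -> (0 <= g n s)%E.
    by move=> _; rewrite /g patchE; case: ifP.
  have ndg s : I0 s -> {homo g^~ s : a b / (a <= b)%N >-> (a <= b)%E}.
    move=> _ a b ab; rewrite /g !patchE; case: ifPn => [|_]; last by case: ifP.
    move/set_mem; rewrite /S/= in_itv/= => /andP[s1 s2]; rewrite mem_set// /S/= in_itv/=.
    have ab2 : a.+2%:R <= b.+2%:R :> R by rewrite ler_nat !ltnS.
    rewrite (le_trans s2 ab2) andbT (le_trans _ s1)// lef_pV2 ?posrE ?ltr0n//.
  have := @cvg_monotone_convergence _ _ _ mu _ (measurable_itv `]0%R, +oo[) g mg g0 ndg.
  have -> : (\int[mu]_(s in `]0%R, +oo[) (kfun p q s)%:E =
     \int[mu]_(x in `]0%R, +oo[) limn (g^~ x))%E.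
    apply: eq_integral => s; rewrite inE/= in_itv/= andbT => s0.
    apply/esym/cvg_lim => //; apply: cvg_near_cst.
    have [n Hn] : exists n : nat, Num.max s s^-1 <= n%:R.
      exists (Num.bound (Num.max s s^-1)); apply: ltW; apply: archi_boundP.
      by rewrite le_max ltW.
    move: Hn; rewrite ge_max => /andP[n1 n2].
    exists n => // m /= nm; rewrite /g patchE mem_set// /S/= in_itv/=.
    have nm2 : n%:R <= m.+2%:R :> R by rewrite ler_nat (leq_trans nm)// -addn2 leq_addr.
    rewrite (le_trans n1 nm2) andbT invf_ple ?posrE ?ltr0n//.
    exact: le_trans nm2.
  move=> cv.
  have icv : cvgn (fun n => \int[mu]_(x in `]0%R, +oo[) g n x)%E by apply/cvg_ex; eexists; exact: cv.
  rewrite -(cvg_lim _ cv)//; apply: lime_le => //.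
  apply: nearW => n.
  apply: le_trans (integral_kfun_itv p q n.+2%:R p1 q1 _); last by rewrite ltr1n.
  rewrite /g -integral_mkcondr; apply: ge0_subset_integral => //=.
  - by apply: measurableI; [exact: measurable_itv|exact: mS].
  - exact: mk.
have neg : (\int[mu]_(s in `]-oo, 0%R]) (kfun p q s)%:E <= ((1 - p)^-1 + (q - 1)^-1)%:E)%E.
  apply: le_trans pos; rewrite (@ge0_integration_by_substitution0 R (fun s => (kfun p q s)%:E))//.
  rewrite le_eqVlt; apply/orP; left; apply/eqP; apply: eq_integral => s _.
  by rewrite /kfun normrN.
apply: (@le_lt_trans _ _ (\int[mu]_(s in `]-oo, 0%R] `|` `[0%R, +oo[) (kfun p q s)%:E)%E).
  apply: ge0_subset_integral => //=.
  - by apply: measurableU; exact: measurable_itv.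
  - exact: mk.
  move=> s _ /=; rewrite !in_itv/= andbT.
  by case: (leP s 0) => [|/ltW]; [left|right].
apply: (@le_lt_trans _ _ (((1 - p)^-1 + (q - 1)^-1)%:E + ((1 - p)^-1 + (q - 1)^-1)%:E)%E).
  apply: (@le_trans _ _ (\int[mu]_(s in `]-oo, 0%R]) (kfun p q s)%:E + \int[mu]_(s in `[0%R, +oo[) (kfun p q s)%:E)%E).
    have -> : `]-oo, 0%R] `|` `[0%R, +oo[ = `]-oo, 0%R] `|` `]0%R, +oo[ :> set R.
      apply/seteqP; split => s /=; rewrite !in_itv/= !andbT.
        by move=> _; case: (leP s 0) => _; [left|right].
      by move=> [->|/ltW ->]; [left|right].
    rewrite ge0_integral_setU//=; last 2 first.
    - exact: mk.
    - rewrite disj_set2E; apply/eqP/seteqP; split => s //=; rewrite !in_itv/= andbT.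
    by move=> [s1 s2]; move: (le_lt_trans s1 s2); rewrite ltxx.
    by rewrite integral_itv_obnd_cbnd.
  exact: leeD.
by rewrite -EFinD ltry.
Qed.

Lemma ler_powRN (x y e : R) : 0 <= e -> 0 < x -> x <= y -> powR y (- e) <= powR x (- e).
Proof.
move=> e0 x0 xy; rewrite !powRN lef_pV2 ?posrE ?powR_gt0//.
  by apply: ge0_ler_powR; rewrite ?nnegrE// ?ltW// (lt_le_trans x0).
exact: lt_le_trans xy.
Qed.

Lemma powRN_le1 (x e : R) : 0 <= e -> 1 <= x -> powR x (- e) <= 1.
Proof.
by move=> e0 x1; have := ler_powRN 1 x e e0 ltr01 x1; rewrite powR1.
Qed.

(** Monotonicity of the majorant in the modulus; [y] is meant to be the Euclidean norm and [x] one
    coordinate. *)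
Lemma kfun_ge p q x y : 0 <= p -> 0 <= q -> 0 < `|x| -> `|x| <= y ->
  (if y <= 1 then powR y (- p) else powR y (- q)) <= kfun p q x.
Proof.
move=> p0 q0 x0 xy; rewrite /kfun; case: (leP y 1) => y1.
  by rewrite (le_trans xy y1) ler_powRN.
case: (leP `|x| 1) => x1; last by rewrite ler_powRN.
apply: (@le_trans _ _ 1); first by rewrite powRN_le1// ltW.
by have := ler_powRN `|x| 1 p p0 x0 x1; rewrite powR1.
Qed.

Lemma kfun0_ge q x : 0 <= q -> powR (1 + `|x|) (- q) <= kfun 0 q x.
Proof.
move=> q0; rewrite /kfun; case: (leP `|x| 1) => x1.
  by rewrite oppr0 powRr0 powRN_le1// lerDl.
by rewrite ler_powRN// ?(lt_trans ltr01)// lerDr.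
Qed.

End real_line_integrals.

Section measurability_amp.
Context {R : realType}.

Lemma measurable_invr : measurable_fun setT (@GRing.inv R).
Proof.
(* The square makes the base of the power non-negative, and both sides are 0 at [x = 0]. *)
have -> : @GRing.inv R = (fun x => x * powR (x ^+ 2) (-1)).
  apply/funext => x; rewrite powR_inv1 ?sqr_ge0//.
  by case: (eqVneq x 0) => [->|x0]; [rewrite invr0 mul0r|field].
apply: measurable_funM => //; apply: (measurableT_comp (measurable_powR (-1))).
exact: measurable_funX.
Qed.

Lemma measurable_sqrtr : measurable_fun setT (@Num.sqrt R).
Proof.
have -> : @Num.sqrt R = (fun x => powR (Num.max x 0) 2^-1).
  apply/funext => x; case: (leP x 0) => x0.
    rewrite ler0_sqrtr// powR0// invr_eq0 pnatr_eq0 //.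
  by rewrite powR12_sqrt// ltW.
apply: (measurableT_comp (measurable_powR 2^-1)).
exact: measurable_maxr.
Qed.

Lemma measurable_enorm n : measurable_fun setT (fun v : n.-tuple R => enorm (row_of_tuple n v)).
Proof.
apply: (measurableT_comp measurable_sqrtr); apply: measurable_sum => i.
by apply: measurable_funX; under eq_fun do rewrite mxE; exact: measurable_tnth.
Qed.

Lemma measurable_amp t d (T : measurableType d) (f g : T -> R) :
  measurable_fun setT f -> measurable_fun setT g ->
  measurable_fun setT (fun x => amp t (f x) (g x)).
Proof.
move=> mf mg.
have mcos : measurable_fun setT (@cos R).
  by apply: continuous_measurable_fun; exact: continuous_cos.
have msin : measurable_fun setT (@sin R).
  by apply: continuous_measurable_fun; exact: continuous_sin.
have mc (k : T -> R) : measurable_fun setT k -> measurable_fun setT (fun x => cos (t * k x)).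
  by move=> mk; apply: (measurableT_comp mcos); exact: measurable_funM.
have ms (k : T -> R) : measurable_fun setT k -> measurable_fun setT (fun x => sin (t * k x)).
  by move=> mk; apply: (measurableT_comp msin); exact: measurable_funM.
have mi (k : T -> R) : measurable_fun setT k -> measurable_fun setT (fun x => (k x)^-1).
  by move=> mk; exact: (measurableT_comp measurable_invr).
have mN (k : T -> R) : measurable_fun setT k -> measurable_fun setT (fun x => - (k x)).
  by move=> mk; exact: measurableT_comp.
rewrite /amp; apply: measurable_funM.
  by apply: measurable_funX; apply: mi; exact: measurable_funM.
apply: measurable_funD; apply: measurable_funX; apply: measurable_funB;
  apply: measurable_funM.
- by apply: measurable_funB; exact: mc.
- by apply: mi; exact: measurable_funD.
- by apply: measurable_funB; exact: mc.
- by apply: mi; exact: measurable_funB.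
- by apply: measurable_funB; [apply: mN|]; exact: ms.
- by apply: mi; exact: measurable_funD.
- by apply: measurable_funD; [apply: mN|]; exact: ms.
- by apply: mi; exact: measurable_funB.
Qed.

End measurability_amp.

(** * Integration over the temporal frequency *)

Section time_integral.
Context {R : realType}.
Local Notation mu := (@lebesgue_measure R).
Variables (H : R).
Hypothesis H1 : 1 / 2 <= H.
Hypothesis H2 : H < 1.
Local Notation theta := (2 * H - 1).

Let th0 : 0 <= theta. Proof. by move: H1; lra. Qed.
Let th1 : theta < 1. Proof. by move: H2; lra. Qed.

Definition time_density t tau a : R := amp t tau a * powR `|tau| (1 - 2 * H).

Lemma time_density_ge0 t tau a : 0 <= time_density t tau a.
Proof. by rewrite mulr_ge0 ?amp_ge0 ?powR_ge0. Qed.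

Lemma measurable_time_density t d (T : measurableType d) (f g : T -> R) :
  measurable_fun setT f -> measurable_fun setT g ->
  measurable_fun setT (fun x => time_density t (f x) (g x)).
Proof.
move=> mf mg; apply: measurable_funM; first exact: measurable_amp.
by apply: (measurableT_comp (measurable_powR (1 - 2 * H))); exact: measurableT_comp.
Qed.

Let wE (r : R) : powR r (1 - 2 * H) = powR r (- theta).
Proof. by congr powR; ring. Qed.

(** Near the origin only the weight [|tau|^(-theta)] is singular, integrably since [theta < 1].
    Beyond 1 the weight is at most 1 and the amplitude supplies the decay [tau^(-2)]. *)
Lemma time_density_low t tau a : 0 < t -> 0 < a -> a <= 1 -> `|tau| != a ->
  time_density t tau a <=
  9 * (1 + t ^+ 2 + t ^+ 4 + 4 * t ^+ 6) * kfun theta 2 tau.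
Proof.
move=> t0 a0 a1 ta; rewrite /time_density wE.
have c0 : 0 <= 9 * (1 + t ^+ 2 + t ^+ 4 + 4 * t ^+ 6).
  have tn n : 0 <= t ^+ n by rewrite exprn_ge0// ltW.
  by rewrite mulr_ge0// !addr_ge0// mulr_ge0.
apply: (le_trans (ler_wpM2r (powR_ge0 _ _) (amp_low_frequency t tau a t0 a0 a1 ta))).
move: c0; set c := 9 * _ => c0; rewrite -[leLHS]mulrA; apply: (ler_wpM2l c0).
have r0 := normr_ge0 tau; rewrite /kfun; set r := `|tau| in r0 *.
have d1 : 1 <= (1 + r) ^+ 2 by rewrite -[leLHS](expr1n _ 2) lerXn2r ?nnegrE ?addr_ge0// lerDl.
have d0 : 0 < (1 + r) ^+ 2 by exact: lt_le_trans d1.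
case: (leP r 1) => r1.
  by rewrite ler_piMl ?powR_ge0// invf_le1.
have rp : 0 < r by exact: lt_trans r1.
have rp1 : 0 < 1 + r by rewrite addr_gt0.
rewrite -[leRHS]mulr1; apply: ler_pM; rewrite ?invr_ge0 ?(ltW d0) ?powR_ge0//.
  rewrite powRN (powR_mulrn 2 r0) lef_pV2 ?posrE ?exprn_gt0//.
  by rewrite lerXn2r ?nnegrE ?addr_ge0// lerDr.
by apply: powRN_le1 => //; exact: ltW.
Qed.

(* Away from the origin |tau| (1 + ||tau| - a|) >= a, which trades the weight
   |tau|^(-theta) for a^(-theta). *)
Lemma time_density_high t tau a : 0 < t -> 1 < a -> `|tau| != a ->
  time_density t tau a <= (4 * t ^+ 2 + 24) * powR a (- (2 + theta)) *
  (kfun theta 2 tau + kfun 0 (2 - theta) (tau - a) + kfun 0 (2 - theta) (tau + a)).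
Proof.
move=> t0 a1 ta; have a0 : 0 < a by exact: lt_trans a1.
rewrite /time_density wE.
have c0 : 0 <= 4 * t ^+ 2 + 24 by rewrite addr_ge0// mulr_ge0// sqr_ge0.
apply: (le_trans (ler_wpM2r (powR_ge0 _ _) (amp_high_frequency t tau a t0 (ltW a1) ta))).
have r0 := normr_ge0 tau.
set D := `| `|tau| - a |; have D0 : 0 <= D by exact: normr_ge0.
have Dp : 0 < 1 + D by rewrite ltr_wpDr.
have powE : powR a (- (2 + theta)) = (a ^+ 2)^-1 * powR a (- theta).
  rewrite opprD powRD; last by apply/implyP => _; rewrite gt_eqF.
  by rewrite (powRN a 2) (powR_mulrn 2 (ltW a0)).
have A0 : 0 <= (a ^+ 2)^-1 by rewrite invr_ge0 sqr_ge0.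
rewrite invfM powE -!mulrA; apply: (ler_wpM2l c0); apply: (ler_wpM2l A0).
have k1 := kfun_ge0 theta 2 tau.
have k2 := kfun_ge0 0 (2 - theta) (tau - a).
have k3 := kfun_ge0 0 (2 - theta) (tau + a).
have th2 : 0 <= 2 - theta by move: th1; lra.
case: (ltP `|tau| 1) => r1.
  apply: (@le_trans _ _ (powR a (- theta) * kfun theta 2 tau)); last first.
    by rewrite ler_wpM2l ?powR_ge0// -addrA lerDl addr_ge0.
  rewrite /kfun (ltW r1) ler_wpM2r ?powR_ge0//.
  apply: (@le_trans _ _ (powR a (- 2))); last by rewrite ler_powR ?(ltW a1)// lerN2; move: th1; lra.
  rewrite powRN (powR_mulrn 2 (ltW a0)) lef_pV2 ?posrE ?exprn_gt0//.
  rewrite lerXn2r ?nnegrE ?(ltW a0) ?(ltW Dp)//.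
  by rewrite /D distrC ger0_norm ?subr_ge0; lra.
have Da : a <= (1 + D) * `|tau|.
  rewrite /D; case: (leP a `|tau|) => ar.
    by apply: (le_trans ar); rewrite ler_peMl// lerDl.
  by rewrite distrC gtr0_norm ?subr_gt0//; move: r1 ar; set r := `|tau|; nra.
have rp : 0 < `|tau| by exact: lt_le_trans r1.
(* A power [theta] of [1 + D] is spent on the weight; the remaining exponent [2 - theta] still
   exceeds 1, hence is integrable. *)
have Hd : ((1 + D) ^+ 2)^-1 * powR `|tau| (- theta) <= powR a (- theta) * powR (1 + D) (- (2 - theta)).
  have -> : ((1 + D) ^+ 2)^-1 = powR (1 + D) (- theta) * powR (1 + D) (- (2 - theta)).
    rewrite -powRD; last by apply/implyP => _; rewrite gt_eqF.
    rewrite (_ : - theta + - (2 - theta) = - 2); last by ring.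
    by rewrite powRN (powR_mulrn 2 (ltW Dp)).
  rewrite mulrAC ler_wpM2r ?powR_ge0// -powRM ?(ltW Dp)//.
  exact: ler_powRN.
apply: (le_trans Hd); apply: (ler_wpM2l (powR_ge0 _ _)).
case: (leP 0 tau) => t00.
  apply: (@le_trans _ _ (kfun 0 (2 - theta) (tau - a))); last by lra.
  by rewrite /D (ger0_norm t00); exact: kfun0_ge.
apply: (@le_trans _ _ (kfun 0 (2 - theta) (tau + a))); last by lra.
by rewrite /D (ltr0_norm t00) -opprD normrN; exact: kfun0_ge.
Qed.

Lemma ae_norm_neq (a : R) : {ae mu, forall tau : R, `|tau| != a}.
Proof.
exists [set a; - a]; split.
- by apply: measurableU; exact: measurable_set1.
- apply: countable_lebesgue_measure0; apply: finite_set_countable.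
  by rewrite finite_setU; split; exact: finite_set1.
- move=> tau /= /negP; rewrite negbK => /eqP <-.
  by case: (leP 0 tau) => t0; [left; rewrite ger0_norm|right; rewrite ltr0_norm// opprK].
Qed.

(** The majorant has bumps centered at 0, [a] and [- a]; by translation invariance their integrals
    do not depend on [a], so the prefactor alone carries the decay. *)
Lemma time_integral_le t : 0 < t -> exists C : R, 0 <= C /\ forall a, 0 < a ->
  (\int[mu]_tau (time_density t tau a)%:E <=
   (C * (if a <= 1 then 1 else powR a (- (2 + theta))))%:E)%E.
Proof.
move=> t0.
have mk p q : measurable_fun setT (fun s : R => (kfun p q s)%:E).
  by apply/measurable_EFinP; exact: measurable_kfun.
have k0 (p q s : R) : (0 <= (kfun p q s)%:E)%E by rewrite lee_fin kfun_ge0.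
pose K p q := fine (\int[mu]_s (kfun p q s)%:E).
have KE p q : p < 1 -> 1 < q -> (\int[mu]_s (kfun p q s)%:E = (K p q)%:E)%E.
  move=> p1 q1; rewrite fineK// ge0_fin_numE; first exact: integral_kfun_lty.
  by apply: integral_ge0 => s _.
have K0 p q : 0 <= K p q by apply: fine_ge0; apply: integral_ge0 => s _.
have q2 : 1 < 2 - theta by move: th1; lra.
have td0 a (s : R) : setT s -> (0 <= (time_density t s a)%:E)%E.
  by move=> _; rewrite lee_fin time_density_ge0.
have md a : measurable_fun setT (fun tau : R => (time_density t tau a)%:E).
  by apply/measurable_EFinP; exact: measurable_time_density.
pose C1 := 9 * (1 + t ^+ 2 + t ^+ 4 + 4 * t ^+ 6); pose C2 := 4 * t ^+ 2 + 24.
have C10 : 0 <= C1.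
  have tn n : 0 <= t ^+ n by rewrite exprn_ge0// ltW.
  by rewrite mulr_ge0// !addr_ge0// mulr_ge0.
have C20 : 0 <= C2 by rewrite addr_ge0// mulr_ge0// sqr_ge0.
pose A := K theta 2; pose B := K 0 (2 - theta).
have A0 : 0 <= A by exact: K0.
have B0 : 0 <= B by exact: K0.
have CA : 0 <= C1 * A by exact: mulr_ge0.
have CB : 0 <= C2 * (A + B + B) by rewrite mulr_ge0// !addr_ge0.
exists (C1 * A + C2 * (A + B + B)); split; first exact: addr_ge0.
move=> a a0; have [Z [mZ Z0 sZ]] := ae_norm_neq a.
case: (leP a 1) => a1.
  apply: (@le_trans _ _ (C1 * A)%:E); last by rewrite lee_fin mulr1 lerDl.
  rewrite EFinM -(KE theta 2)// ?ltr1n// -ge0_integralZl_EFin//; last exact: mk.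
  apply: ae_ge0_le_integral => //.
  - exact: td0.
  - exact: md.
  - by move=> s _; rewrite -EFinM lee_fin mulr_ge0// kfun_ge0.
  - by apply: measurable_funeM; exact: mk.
  - exists Z; split => //; apply: subset_trans sZ; apply: subsetC => s /= sa _.
    by rewrite -EFinM lee_fin; exact: time_density_low.
set pa := powR a _; have pa0 : 0 <= pa by exact: powR_ge0.
apply: (@le_trans _ _ ((C2 * pa) * (A + B + B))%:E); last first.
  by rewrite lee_fin mulrAC ler_wpM2r// lerDr.
have mkt c : measurable_fun setT (fun s : R => (kfun 0 (2 - theta) (s - c))%:E).
  apply/measurable_EFinP; apply: (measurableT_comp (measurable_kfun 0 (2 - theta))).
  exact: measurable_funB.
have kt c : (\int[mu]_s (kfun 0 (2 - theta) (s - c))%:E = B%:E)%E.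
  by rewrite -(KE 0 (2 - theta))//; exact: (ge0_integral_translation c (fun s => (kfun 0 (2 - theta) s)%:E)).
have mS : measurable_fun setT (fun s : R => ((kfun theta 2 s)%:E +
    (kfun 0 (2 - theta) (s - a))%:E + (kfun 0 (2 - theta) (s - - a))%:E)%E).
  by apply: emeasurable_funD => //; exact: emeasurable_funD.
have -> : (((C2 * pa) * (A + B + B))%:E = \int[mu]_s ((C2 * pa)%:E *
    ((kfun theta 2 s)%:E + (kfun 0 (2 - theta) (s - a))%:E + (kfun 0 (2 - theta) (s - - a))%:E)))%E.
  rewrite ge0_integralZl_EFin//; last 2 first.
  - by move=> s _; rewrite !adde_ge0.
  - exact: mulr_ge0.
  rewrite EFinM !EFinD; congr (_ * _)%E.
  have n1 (s : R) : setT s -> (0 <= (kfun theta 2 s)%:E)%E by [].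
  have n2 c (s : R) : setT s -> (0 <= (kfun 0 (2 - theta) (s - c))%:E)%E by [].
  have n12 (s : R) : setT s -> (0 <= (kfun theta 2 s)%:E + (kfun 0 (2 - theta) (s - a))%:E)%E.
    by move=> _; rewrite adde_ge0.
  have m12 := emeasurable_funD (mk theta 2) (mkt a).
  rewrite (ge0_integralD mu measurableT n12 m12 (n2 (- a)) (mkt (- a))).
  rewrite (ge0_integralD mu measurableT n1 (mk theta 2) (n2 a) (mkt a)).
  by rewrite !kt KE// ltr1n.
apply: ae_ge0_le_integral => //.
- exact: td0.
- exact: md.
- move=> s _; apply: mule_ge0; first by rewrite lee_fin mulr_ge0.
  by rewrite !adde_ge0.
- by apply: measurable_funeM; exact: mS.
- exists Z; split => //; apply: subset_trans sZ; apply: subsetC => s /= sa _.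
  rewrite opprK -!EFinD -EFinM lee_fin.
  exact: time_density_high.
Qed.

(** Only the resonance window []a, a + s0]] is kept, where [|tau| <= 2 a] bounds the weight from
    below. Its left endpoint is excluded, being a zero of the denominator. *)
Lemma time_integral_ge t a s0 : 0 < t -> 4 / t <= a -> 0 < s0 -> s0 <= a -> t * s0 <= 2 ->
  ((s0 * (t ^+ 2 / (144 * a ^+ 2) * powR (2 * a) (- theta)))%:E <=
   \int[mu]_tau (time_density t tau a)%:E)%E.
Proof.
move=> t0 ta s00 sa ts.
have a0 : 0 < a by apply: lt_le_trans ta; rewrite divr_gt0.
set c := t ^+ 2 / _ * _.
have c0 : 0 <= c by rewrite mulr_ge0 ?powR_ge0// divr_ge0 ?sqr_ge0// mulr_ge0// sqr_ge0.
have mD D : measurable_fun D (fun tau : R => (time_density t tau a)%:E).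
  by apply/measurable_funTS/measurable_EFinP; apply: measurable_time_density.
apply: (@le_trans _ _ (\int[mu]_(tau in `]a, (a + s0)%R]) (time_density t tau a)%:E)%E); last first.
  apply: ge0_subset_integral => //=.
  - exact: mD.
  - by move=> s _; rewrite lee_fin time_density_ge0.
apply: (@le_trans _ _ (\int[mu]_(tau in `]a, (a + s0)%R]) (cst c%:E) tau)%E).
  rewrite integral_cst//= lebesgue_measure_itv/= lte_fin ltrDl s00.
  by rewrite -EFinB -EFinM lee_fin mulrC; rewrite addrAC subrr add0r.
apply: ge0_le_integral => //=.
- exact: mD.
move=> tau; rewrite in_itv/= => /andP[t1 t2]; rewrite lee_fin.
have -> : tau = a + (tau - a) by ring.
have s1 : 0 < tau - a by lra.
have s2 : tau - a <= s0 by lra.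
rewrite /time_density wE /c ler_pM//.
- by rewrite divr_ge0 ?sqr_ge0// mulr_ge0// sqr_ge0.
- exact: powR_ge0.
- apply: amp_resonance => //; first exact: le_trans sa.
  by apply: le_trans ts; rewrite ler_wpM2l// ltW.
- have r0 : 0 < a + (tau - a) by lra.
  rewrite (gtr0_norm r0); apply: ler_powRN => //.
  by rewrite mulr_natl mulr2n lerD2l (le_trans s2).
Qed.

End time_integral.

(** * The joint spectral density *)

Section iterated_integral_ae.
Context {R : realType}.
Local Notation mu := (@lebesgue_measure R).
Local Notation rot := (@row_of_tuple R _).

(** Needed because the coordinatewise majorants fail on the axes: [kfun] with a non-zero exponent
    takes the default value 0 at the origin. *)
Lemma le_eint_off_axes n (f g : 'rV[R]_n -> \bar R) :
  measurable_fun setT (fun v => f (rot v)) -> measurable_fun setT (fun v => g (rot v)) ->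
  (forall v, 0 <= f v)%E -> (forall v, 0 <= g v)%E ->
  (forall v : 'rV[R]_n, (forall i, (v 0 i != 0)%R) -> f v <= g v)%E -> (eint n f <= eint n g)%E.
Proof.
elim: n f g => [|n IH] f g mf mg f0 g0 fg /=; first by apply: fg; case.
apply: ae_ge0_le_integral => //.
- by move=> a _; exact: eint_ge0.
- exact: measurable_eint_section.
- by move=> a _; exact: eint_ge0.
- exact: measurable_eint_section.
exists [set 0]; split; [exact: measurable_set1|exact: lebesgue_measure_set1|].
move=> a nE /=; apply: contrapT => /eqP a0; apply: nE => _.
apply: IH => //; [exact: measurable_cons_slice|exact: measurable_cons_slice|].
move=> v v0; apply: fg => i; case: (unliftP ord0 i) => [j|] ->.
  by rewrite row_consS.
by rewrite row_cons0.
Qed.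

Lemma coord_le_enorm n (v : 'rV[R]_n) i : `|v 0 i| <= enorm v.
Proof.
rewrite -sqrtr_sqr; apply: ler_wsqrtr.
by rewrite (bigD1 i)//= lerDl sumr_ge0// => j _; exact: sqr_ge0.
Qed.

Lemma enorm_gt0 n (v : 'rV[R]_n) i : v 0 i != 0 -> 0 < enorm v.
Proof. by move=> vi; apply: lt_le_trans (coord_le_enorm n v i); rewrite normr_gt0. Qed.

End iterated_integral_ae.

(** For [x = N], the quantity [beta + 2 H + 1] is the decay exponent of the spectral density
    integrated over [tau]. Its excess over [N] is [2 alpha]. *)
Lemma spectral_exponent {R : realType} {x H beta : R} :
  1 / 2 <= H -> 0 < beta -> x - 2 * H - 1 < beta ->
  0 < beta + (2 + (2 * H - 1)) /\ x < beta + (2 + (2 * H - 1)).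
Proof. by move=> ? ? ?; split; lra. Qed.

Section spectral_measure.
Context {R : realType}.
Local Notation mu := (@lebesgue_measure R).
Local Notation rot := (@row_of_tuple R _).
Variables (N : nat) (H beta c1 c2 : R) (h : 'rV[R]_N -> R).
Hypothesis N0 : (0 < N)%N.
Hypothesis H1 : 1 / 2 <= H.
Hypothesis H2 : H < 1.
Hypothesis b0 : 0 < beta.
Hypothesis bN : beta < N%:R.
Hypothesis bH : N%:R - 2 * H - 1 < beta.
Hypothesis c20 : 0 < c2.
Hypothesis mh : measurable_fun setT (fun v : N.-tuple R => h (rot v)).
Hypothesis h0 : forall xi, 0 <= h xi.
Hypothesis hle : forall xi, xi != 0 -> h xi <= c2 * powR (enorm xi) (- beta).

Definition spectral_density t tau (xi : 'rV[R]_N) : R :=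
  time_density H t tau (enorm xi) * h xi.

Lemma spectral_density_ge0 t tau xi : 0 <= spectral_density t tau xi.
Proof. by rewrite mulr_ge0// time_density_ge0. Qed.

Lemma measurable_spectral_density t :
  measurable_fun setT (fun p : R * N.-tuple R => spectral_density t p.1 (rot p.2)).
Proof.
apply: measurable_funM; last exact: (measurableT_comp mh).
apply: measurable_time_density => //.
exact: (measurableT_comp (measurable_enorm N)).
Qed.

Lemma integral_spectral_density t xi :
  (\int[mu]_tau (spectral_density t tau xi)%:E =
   (h xi)%:E * \int[mu]_tau (time_density H t tau (enorm xi))%:E)%E.
Proof.
rewrite -ge0_integralZl//.
- by apply: eq_integral => tau _; rewrite -EFinM mulrC.
- by apply/measurable_EFinP; apply: measurable_time_density.
- by move=> tau _; rewrite lee_fin time_density_ge0.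
- by rewrite lee_fin.
Qed.

Let gam := beta + (2 + (2 * H - 1)).
Let gam0 : 0 < gam. Proof. exact: (spectral_exponent H1 b0 bH).1. Qed.
Let gamN : N%:R < gam. Proof. exact: (spectral_exponent H1 b0 bH).2. Qed.
Let Nr0 : 0 < N%:R :> R. Proof. by rewrite ltr0n. Qed.

(* The radial bound is dominated by a product over the coordinates, since
   |xi| >= |xi_i| for each of the N coordinates. *)
Lemma radial_le_prod (v : 'rV[R]_N) : (forall i, v 0 i != 0) ->
  powR (enorm v) (- beta) * (if enorm v <= 1 then 1 else powR (enorm v) (- (2 + (2 * H - 1))))
  <= \prod_(i < N) kfun (beta / N%:R) (gam / N%:R) (v 0 i).
Proof.
move=> v0; have e0 : 0 < enorm v by exact: (enorm_gt0 N v (Ordinal N0)).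
have -> : powR (enorm v) (- beta) * (if enorm v <= 1 then 1 else powR (enorm v) (- (2 + (2 * H - 1)))) =
  \prod_(i < N) (if enorm v <= 1 then powR (enorm v) (- (beta / N%:R)) else powR (enorm v) (- (gam / N%:R))).
  rewrite prodr_const card_ord; case: (leP (enorm v) 1) => _.
    rewrite mulr1 -powR_mulrn ?powR_ge0// -powRrM; congr powR.
    by rewrite mulNr divfK// gt_eqF.
  rewrite -powRD; last by apply/implyP => _; rewrite gt_eqF.
  rewrite -powR_mulrn ?powR_ge0// -powRrM; congr powR.
  by rewrite /gam; field; rewrite gt_eqF.
apply: ler_prod => i _; apply/andP; split; first by case: ifP => _; exact: powR_ge0.
apply: kfun_ge; last exact: coord_le_enorm.
- by rewrite divr_ge0// ltW.
- by rewrite divr_ge0// ltW.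
- by rewrite normr_gt0.
Qed.

(** Temporal and spatial frequencies share one row vector, [tau] first, so that the covariance
    becomes a single [iint] in dimension [N.+1]. *)
Definition joint_density t (w : 'rV[R]_N.+1) : R :=
  spectral_density t (w 0 0) (rsubmx (w : 'rV[R]_(1 + N))).

Lemma joint_densityE t a (v : 'rV[R]_N) :
  joint_density t (row_mx (a%:M : 'rV[R]_1) v) = spectral_density t a v.
Proof. by rewrite /joint_density row_cons0 row_mxKr. Qed.

(** Tonelli moves the integral over [tau] from the outside, where [iint] has it, to the inside,
    where the estimates of the time integral apply. *)
Lemma eint_joint_density t (Q : 'rV[R]_N -> R) : (forall v, 0 <= Q v) ->
  measurable_fun setT (fun v => Q (rot v)) ->
  (eint N.+1 (fun w => (Q (rsubmx (w : 'rV[R]_(1 + N))) * joint_density t w)%:E) =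
   eint N (fun v => (Q v * h v)%:E * \int[mu]_tau (time_density H t tau (enorm v))%:E))%E.
Proof.
move=> Q0 mQ /=.
transitivity (\int[mu]_a eint N (fun v => (Q v * spectral_density t a v)%:E))%E.
  apply: eq_integral => a _; congr (eint N _); apply/funext => v.
  by rewrite joint_densityE row_mxKr.
rewrite (eint_tonelli N _ _ mu (fun a v => (Q v * spectral_density t a v)%:E)).
- congr (eint N _); apply/funext => v.
  under eq_integral do rewrite EFinM.
  rewrite ge0_integralZl//; first by rewrite integral_spectral_density muleA.
  + apply/measurable_EFinP; apply: measurable_funM => //.
    by apply: measurable_time_density.
  + by move=> a _; rewrite lee_fin spectral_density_ge0.
  + by rewrite lee_fin.
- apply/measurable_EFinP; apply: measurable_funM; last exact: measurable_spectral_density.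
  exact: (measurableT_comp mQ).
- by move=> a v; rewrite lee_fin mulr_ge0// spectral_density_ge0.
Qed.

Lemma measurable_time_integral t :
  measurable_fun setT (fun v : N.-tuple R =>
    \int[mu]_tau (time_density H t tau (enorm (rot v)))%:E)%E.
Proof.
have := @measurable_fun_fubini_tonelli_F _ _ _ _ R mu
  (fun p : N.-tuple R * R => (time_density H t p.2 (enorm (rot p.1)))%:E).
apply.
- apply/measurable_EFinP; apply: measurable_time_density => //.
  exact: (measurableT_comp (measurable_enorm N)).
- by move=> p; rewrite lee_fin time_density_ge0.
Qed.

Lemma time_integral_ge0 t a : (0 <= \int[mu]_tau (time_density H t tau a)%:E)%E.
Proof. by apply: integral_ge0 => tau _; rewrite lee_fin time_density_ge0. Qed.

(** The product majorant of [radial_le_prod] has exponents [beta / N < 1] at the origin and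
    [gam / N > 1] at infinity in every coordinate, so each one-dimensional factor is finite. *)
Lemma joint_density_lty t : 0 < t -> (eint N.+1 (fun w => (joint_density t w)%:E) < +oo)%E.
Proof.
move=> t0.
have -> : (fun w => (joint_density t w)%:E) = (fun w => (1 * joint_density t w)%:E).
  by apply/funext => w; rewrite mul1r.
rewrite (eint_joint_density t (fun=> 1))//.
have [C [C0 HC]] := time_integral_le H H1 H2 t t0.
pose K (i : nat) := kfun (beta / N%:R) (gam / N%:R).
have mK i : measurable_fun setT (K i) by exact: measurable_kfun.
have K0 i a : 0 <= K i a by exact: kfun_ge0.
apply: (@le_lt_trans _ _ (eint N (fun v => (c2 * C)%:E * (\prod_(i < N) K i (v 0 i))%:E))%E).
  apply: le_eint_off_axes.
  - apply: emeasurable_funM; last exact: measurable_time_integral.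
    by apply/measurable_EFinP; exact: measurable_funM.
  - by apply: measurable_funeM; exact: measurable_coord_prod.
  - by move=> v; rewrite mule_ge0// ?lee_fin ?mulr_ge0// time_integral_ge0.
  - by move=> v; rewrite -EFinM lee_fin !mulr_ge0 ?(ltW c20)// prodr_ge0.
  move=> v v0; have e0 : 0 < enorm v by exact: (enorm_gt0 N v (Ordinal N0)).
  rewrite mul1r; apply: (le_trans (lee_wpmul2l _ (HC _ e0))); first by rewrite lee_fin.
  rewrite -!EFinM lee_fin.
  have vn : v != 0.
    by apply/eqP => E; have := v0 (Ordinal N0); rewrite E mxE eqxx.
  apply: (@le_trans _ _ (c2 * C * (powR (enorm v) (- beta) *
     (if enorm v <= 1 then 1 else powR (enorm v) (- (2 + (2 * H - 1))))))).
    set q := if _ then _ else _.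
    have q0 : 0 <= q by rewrite /q; case: ifP => _ //; exact: powR_ge0.
    have -> : c2 * C * (powR (enorm v) (- beta) * q) =
      c2 * powR (enorm v) (- beta) * (C * q) by ring.
    by rewrite ler_wpM2r ?mulr_ge0// hle.
  by rewrite ler_wpM2l ?mulr_ge0 ?(ltW c20)//; exact: radial_le_prod.
rewrite eintZl; last 3 first.
- by rewrite lee_fin mulr_ge0// ltW.
- exact: measurable_coord_prod.
- by move=> v; rewrite lee_fin prodr_ge0.
rewrite eint_prod//.
have kl : (\int[mu]_a (kfun (beta / N%:R) (gam / N%:R) a)%:E < +oo)%E.
  apply: integral_kfun_lty.
    by rewrite ltr_pdivrMr// mul1r.
  by rewrite ltr_pdivlMr// mul1r.
have k0 : (0 <= \int[mu]_a (kfun (beta / N%:R) (gam / N%:R) a)%:E)%E.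
  by apply: integral_ge0 => a _; rewrite lee_fin kfun_ge0.
have kE : (\int[mu]_a (kfun (beta / N%:R) (gam / N%:R) a)%:E =
   (fine (\int[mu]_a (kfun (beta / N%:R) (gam / N%:R) a)%:E))%:E)%E.
  by rewrite fineK// ge0_fin_numE.
under eq_bigr do rewrite /K kE.
by rewrite prodEFin -EFinM ltry.
Qed.

End spectral_measure.

(** * Trigonometric polynomials *)

Section trigonometric_polynomials.
Context {R : realType}.
Local Notation mu := (@lebesgue_measure R).
Implicit Types (a : nat -> R) (n : nat).

(** Squared modulus of the trigonometric polynomial [sum_k a_k exp (i k s)]. *)
Definition trig_energy n a (s : R) : R :=
  (\sum_(i < n) a i * cos (i%:R * s)) ^+ 2 + (\sum_(i < n) a i * sin (i%:R * s)) ^+ 2.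

Lemma trig_energy_ge0 n a s : 0 <= trig_energy n a s.
Proof. by rewrite addr_ge0 ?sqr_ge0. Qed.

Lemma trig_energyE n a s :
  trig_energy n a s = \sum_(i < n) \sum_(j < n) a i * a j * cos ((i%:R - j%:R) * s).
Proof.
rewrite /trig_energy !expr2 !big_distrlr/= -big_split/=; apply: eq_bigr => i _.
rewrite -big_split/=; apply: eq_bigr => j _.
by rewrite mulrBl cosB; ring.
Qed.

Lemma continuous_trig_energy n a (dl : R) : continuous (fun s => trig_energy n a (dl * s)).
Proof.
have sq (f : R -> R) : continuous f -> continuous (fun x => f x ^+ 2).
  move=> cf x; have -> : (fun x => f x ^+ 2) = (fun x => f x * f x).
    by apply/funext => y; rewrite expr2.
  exact: (cvgM (cf x) (cf x)).
have cs (F : 'I_n -> R -> R) : (forall i, continuous (F i)) ->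
    continuous (fun s => \sum_(i < n) F i s).
  move=> cF s; elim: (index_enum _) => [|i r IH].
    by rewrite /continuous_at big_nil; under eq_fun do rewrite big_nil; exact: cvg_cst.
  rewrite /continuous_at big_cons; under eq_fun do rewrite big_cons.
  exact: (cvgD (cF i s) IH).
have cc : continuous (fun s : R => \sum_(i < n) a i * cos (i%:R * (dl * s))).
  apply: cs => i s; apply: cvgM; first exact: cvg_cst.
  by under eq_fun do rewrite mulrA; rewrite mulrA; exact: continuous_cosM.
have ss : continuous (fun s : R => \sum_(i < n) a i * sin (i%:R * (dl * s))).
  apply: cs => i s; apply: cvgM; first exact: cvg_cst.
  by under eq_fun do rewrite mulrA; rewrite mulrA; exact: continuous_sinM.
by move=> s; exact: (cvgD (sq _ cc s) (sq _ ss s)).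
Qed.

Lemma sin_cos_nat2pi n : sin (n%:R * (2 * pi)) = 0 :> R /\ cos (n%:R * (2 * pi)) = 1 :> R.
Proof.
have s2 : sin (2 * pi) = 0 :> R by rewrite mulr_natl sin2pi.
have c2 : cos (2 * pi) = 1 :> R by rewrite mulr_natl cos2pi.
elim: n => [|n [IHs IHc]]; first by rewrite mul0r sin0 cos0.
by rewrite -natr1 mulrDl mul1r sinD cosD IHs IHc s2 c2; split; ring.
Qed.

Lemma sin_natB2pi i j : sin ((i%:R - j%:R) * (2 * pi)) = 0 :> R.
Proof.
by rewrite mulrBl sinB (sin_cos_nat2pi i).1 (sin_cos_nat2pi j).1; ring.
Qed.

(* Parseval's identity on the second period of the polynomial. *)
Lemma integral_trig_energy n a (dl : R) : 0 < dl ->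
  (\int[mu]_(s in `[(2 * pi / dl)%R, (4 * pi / dl)%R]) (trig_energy n a (dl * s)%R)%:E =
   (2 * pi / dl * \sum_(i < n) a i ^+ 2)%:E)%E.
Proof.
move=> d0; have p0 : 0 < pi :> R by exact: pi_gt0.
have nd : dl != 0 by rewrite gt_eqF.
pose f i j (s : R) : R := if i == j then s else sin ((i%:R - j%:R) * dl * s) / ((i%:R - j%:R) * dl).
have df i j (s : R) : is_derive s (1:R) (f i j) (cos ((i%:R - j%:R) * (dl * s))).
  rewrite /f; case: eqVneq => [->|ij].
    by rewrite subrr mul0r cos0; exact: is_derive_id.
  set k := (i%:R - j%:R) * dl.
  have k0 : k != 0 by rewrite mulf_neq0// subr_eq0 eqr_nat.
  have Hk : is_derive s (1:R) (fun y : R => k * y) k.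
    have -> : (fun y : R => k * y) = (fun y : R => k *: (y : R)) by [].
    by apply: is_derive_eq; rewrite /GRing.scale/= mulr1.
  have Hs := @is_derive1_comp _ sin (fun y : R => k * y) s _ _ (is_derive_sin _) Hk.
  have -> : (fun s => sin (k * s) / k) = (fun s => k^-1 *: ((sin \o (fun y : R => k * y)) s : R)).
    by apply/funext => y; rewrite mulrC.
  have HZ := is_deriveZ k^-1 Hs.
  apply: is_derive_eq HZ _; rewrite /GRing.scale/= mulrCA mulVf// mulr1.
  by rewrite /k mulrA.
pose F := \sum_(i < n) \sum_(j < n) ((a i * a j) *: (f i j : R -> R)).
have dF (s : R) : is_derive s (1:R) F (trig_energy n a (dl * s)).
  rewrite trig_energyE /F.
  pose D i := is_derive_sum (fun j : 'I_n => is_deriveZ (a i * a j) (df i j s)).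
  exact: (is_derive_sum (fun i : 'I_n => D i)).
have FE s : F s = \sum_(i < n) \sum_(j < n) a i * a j * f i j s.
  rewrite /F fct_sumE; apply: eq_bigr => i _; rewrite fct_sumE; apply: eq_bigr => j _.
  by [].
have cF : continuous F.
  by move=> s; apply/differentiable_continuous/derivable1_diffP; have [] := dF s.
rewrite (@continuous_FTC2 _ _ F).
- rewrite -EFinB; congr EFin; rewrite !FE -sumrB mulr_sumr; apply: eq_bigr => i _.
  rewrite -sumrB (bigD1 i)//= big1 ?addr0 => [|j ji].
    by rewrite /f eqxx; field.
  have ij : (i == j :> nat) = false by apply/negbTE; rewrite eq_sym.
  rewrite /f !ij.
  have -> : (i%:R - j%:R) * dl * (4 * pi / dl) = ((2 * i)%:R - (2 * j)%:R) * (2 * pi) :> R.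
    by rewrite !natrM; field.
  have -> : (i%:R - j%:R) * dl * (2 * pi / dl) = (i%:R - j%:R) * (2 * pi) :> R by field.
  by rewrite !sin_natB2pi; ring.
- by rewrite ltr_pM2r ?invr_gt0// ltr_pM2r// ltr_nat.
- by apply: continuous_subspaceT; exact: continuous_trig_energy.
- split => [s _||]; first by have [] := dF s.
  + by apply: cvg_at_right_filter; exact: cF.
  + by apply: cvg_at_left_filter; exact: cF.
- by move=> s _; rewrite derive1E; have [_ ->] := dF s.
Qed.

End trigonometric_polynomials.

Section iterated_sums.
Context {R : realType}.
Local Notation rot := (@row_of_tuple R _).

Lemma eint_dominated_lty n (f g : 'rV[R]_n -> R) (M : R) : 0 <= M ->
  measurable_fun setT (fun v => f (rot v)) -> measurable_fun setT (fun v => g (rot v)) ->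
  (forall v, 0 <= g v) -> (forall v, `|f v| <= M * g v) ->
  (eint n (fun v => (g v)%:E) < +oo)%E -> (eint n (fun v => `|f v|%:E) < +oo)%E.
Proof.
move=> M0 mf mg g0 fg goo.
have G0 : (0 <= eint n (fun v => (g v)%:E))%E by apply: eint_ge0 => v; rewrite lee_fin.
apply: (@le_lt_trans _ _ (eint n (fun v => M%:E * (g v)%:E)%E)).
  apply: le_eint.
  - by apply/measurable_EFinP/measurableT_comp.
  - by apply: measurable_funeM; exact/measurable_EFinP.
  - by move=> v; rewrite lee_fin.
  - by move=> v; rewrite -EFinM lee_fin.
rewrite eintZl; [|by rewrite lee_fin|exact/measurable_EFinP|by move=> v; rewrite lee_fin].
have gf : eint n (fun v => (g v)%:E) \is a fin_num by rewrite ge0_fin_numE.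
by rewrite -(fineK gf) -EFinM ltry.
Qed.

(** One integrable majorant for the whole family guarantees the finite absolute integrals on which
    linearity of [iint] depends. *)
Lemma iint_linear_combination n (I : Type) (s : seq I) (c : I -> R)
    (f : I -> 'rV[R]_n -> R) (g : 'rV[R]_n -> R) :
  (forall i, measurable_fun setT (fun v => f i (rot v))) ->
  measurable_fun setT (fun v => g (rot v)) ->
  (forall v, 0 <= g v) -> (forall i v, `|f i v| <= g v) ->
  (eint n (fun v => (g v)%:E) < +oo)%E ->
  iint (fun v => \sum_(i <- s) c i * f i v) = \sum_(i <- s) c i * iint (f i).
Proof.
move=> mf mg g0 fg goo.
have foo i : (eint n (fun v => `|f i v|%:E) < +oo)%E.
  by apply: (eint_dominated_lty n _ g 1) => // v; rewrite mul1r.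
elim: s => [|i s IH].
  rewrite big_nil; under eq_fun do rewrite big_nil.
  have -> : (fun=> 0) = (fun=> 0 * 0) :> ('rV[R]_n -> R) by apply/funext => v; rewrite mul0r.
  rewrite iintZl ?mul0r//.
  by apply: (eint_dominated_lty n _ g 0) => // v; rewrite normr0 mul0r.
rewrite big_cons -IH -iintZl// -iintD//.
- by congr iint; apply/funext => v; rewrite big_cons.
- exact: measurable_funM.
- by apply: measurable_sum => j; exact: measurable_funM.
- apply: (eint_dominated_lty n _ g `|c i|) => //; first exact: measurable_funM.
  by move=> v; rewrite normrM ler_wpM2l.
- apply: (eint_dominated_lty n _ g (\sum_(i <- s) `|c i|)) => //.
  + exact: sumr_ge0.
  + by apply: measurable_sum => j; exact: measurable_funM.
  + move=> v; apply: (le_trans (ler_norm_sum _ _ _)).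
    rewrite mulr_suml; apply: ler_sum => j _.
    by rewrite normrM ler_wpM2l.
Qed.

End iterated_sums.

(** * Lower bound for the variance of lattice increments *)

Section variance_lower_bound.
Context {R : realType}.
Local Notation mu := (@lebesgue_measure R).
Local Notation rot := (@row_of_tuple R _).

Lemma enorm_le_sum n (v : 'rV[R]_n) : enorm v <= \sum_(i < n) `|v 0 i|.
Proof.
have S0 : 0 <= \sum_(i < n) `|v 0 i| by apply: sumr_ge0.
rewrite -[leRHS](ger0_norm S0) -sqrtr_sqr; apply: ler_wsqrtr.
elim: n v {S0} => [|n IH] v; first by rewrite !big_ord0 expr0n.
rewrite !big_ord_recl.
have := IH (\row_(i < n) v 0 (lift ord0 i)).
under eq_bigr do rewrite mxE; under [in X in _ <= X -> _]eq_bigr do rewrite mxE.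
set A := \sum_(i < n) _; set B := \sum_(i < n) _ => AB.
have B0 : 0 <= B by apply: sumr_ge0.
rewrite sqrrD real_normK ?num_real//.
have : 0 <= `|v 0 ord0| * B by rewrite mulr_ge0.
by rewrite mulr2n; lra.
Qed.

Variables (N : nat) (H beta c1 c2 : R) (h : 'rV[R]_N -> R).
Hypothesis N0 : (0 < N)%N.
Hypothesis H1 : 1 / 2 <= H.
Hypothesis H2 : H < 1.
Hypothesis b0 : 0 < beta.
Hypothesis bN : beta < N%:R.
Hypothesis bH : N%:R - 2 * H - 1 < beta.
Hypothesis c10 : 0 < c1.
Hypothesis c20 : 0 < c2.
Hypothesis mh : measurable_fun setT (fun v : N.-tuple R => h (rot v)).
Hypothesis h0 : forall xi, 0 <= h xi.
Hypothesis hge : forall xi, xi != 0 -> c1 * powR (enorm xi) (- beta) <= h xi.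
Hypothesis hle : forall xi, xi != 0 -> h xi <= c2 * powR (enorm xi) (- beta).

Let i0 : 'I_N := Ordinal N0.
Let gam := beta + (2 + (2 * H - 1)).
Let gam0 : 0 < gam. Proof. exact: (spectral_exponent H1 b0 bH).1. Qed.

Let jd := joint_density N H h.

Lemma measurable_joint_density t :
  measurable_fun setT (fun w : N.+1.-tuple R => jd t (rot w)).
Proof.
pose g (w : N.+1.-tuple R) : R * N.-tuple R := (tnth w ord0, [tuple of behead w]).
have mg : measurable_fun setT g.
  apply: measurable_fun_pair; first exact: measurable_tnth.
  exact: measurable_behead.
have := measurableT_comp (measurable_spectral_density N H h mh t) mg.
apply: eq_measurable_fun => w _.
rewrite /= /jd /joint_density mxE; congr (spectral_density _ _ _ _ _ _).
apply/rowP => i; rewrite !mxE tnth_behead; congr (tnth _ _).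
by apply: val_inj; rewrite /= inordK ?ltnS ?ltn_ord// add1n.
Qed.

Lemma measurable_freq (f : R -> R) (j : 'I_N) : measurable_fun setT f ->
  measurable_fun setT (fun w : N.+1.-tuple R =>
    f (rsubmx (rot w : 'rV[R]_(1 + N)) 0 j)).
Proof.
move=> mf; apply: (measurableT_comp mf).
by under eq_fun do rewrite !mxE; exact: measurable_tnth.
Qed.

Lemma high_frequency_density t0 t1 : 0 < t0 -> t0 <= t1 ->
  exists kap e0 : R, 0 < kap /\ 0 < e0 /\ forall t v, t0 <= t <= t1 -> e0 <= enorm v ->
  ((kap * powR (enorm v) (- gam))%:E <=
   (h v)%:E * \int[mu]_tau (time_density H t tau (enorm v))%:E)%E.
Proof.
move=> t00 t01; have t10 : 0 < t1 by exact: lt_le_trans t01.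
(* The largest window length with [t * s0 <= 2] for all [t <= t1]. The threshold [4 / t0 + s0] below
   secures both [4 / t <= |xi|] and [s0 <= |xi|]. *)
pose s0 := 2 / t1; have s00 : 0 < s0 by rewrite divr_gt0.
pose q := powR 2 (- (2 * H - 1)); have q0 : 0 < q by exact: powR_gt0.
exists (c1 * s0 * (t0 ^+ 2 / 144) * q), (4 / t0 + s0); split.
  by rewrite !mulr_gt0// ?exprn_gt0// invr_gt0.
have z40 : 0 < 4 / t0 by rewrite divr_gt0.
split; first by rewrite addr_gt0.
move=> t v /andP[tt0 tt1] ev; set e := enorm v in ev *.
have e0 : 0 < e by apply: lt_le_trans ev; rewrite addr_gt0.
have tp : 0 < t by exact: lt_le_trans tt0.
have v0 : v != 0.
  apply/eqP => v0; move: e0; rewrite /e v0 /enorm big1 ?sqrtr0 ?ltxx// => i _.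
  by rewrite mxE expr0n.
have te : 4 / t <= e.
  apply: (@le_trans _ _ (4 / t0)); last by apply: le_trans ev; rewrite lerDl ltW.
  by rewrite ler_pM2l// lef_pV2.
have se : s0 <= e by apply: le_trans ev; rewrite lerDr ltW.
have ts : t * s0 <= 2.
  by rewrite /s0 mulrCA -[leRHS]mulr1 ler_pM2l// ler_pdivrMr// mul1r.
have J := time_integral_ge H H1 t e s0 tp te s00 se ts.
apply: (@le_trans _ _ ((c1 * powR e (- beta))%:E * (s0 * (t ^+ 2 / (144 * e ^+ 2) * powR (2 * e) (- (2 * H - 1))))%:E)%E); last first.
  apply: lee_pmul => //.
  - by rewrite lee_fin mulr_ge0 ?powR_ge0// ltW.
  - rewrite lee_fin mulr_ge0 ?(ltW s00)// mulr_ge0 ?powR_ge0// divr_ge0 ?sqr_ge0//.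
    by apply: mulr_ge0 => //; exact: sqr_ge0.
  - by rewrite lee_fin hge.
rewrite -EFinM lee_fin.
have -> : powR e (- gam) = powR e (- beta) * (e ^+ 2)^-1 * powR e (- (2 * H - 1)).
  have -> : - gam = - beta + (- 2 + - (2 * H - 1)) by rewrite /gam; ring.
  rewrite powRD; last by apply/implyP => _; rewrite gt_eqF.
  rewrite powRD; last by apply/implyP => _; rewrite gt_eqF.
  by rewrite -mulrA; congr (_ * (_ * _)); rewrite powRN -(powR_mulrn 2 (ltW e0)).
rewrite powRM// ?(ltW e0)// -/q.
set A := powR e _; set B := powR e _.
have -> : c1 * A * (s0 * (t ^+ 2 / (144 * e ^+ 2) * (q * B))) =
  c1 * s0 * (t ^+ 2 / 144) * q * (A * (e ^+ 2)^-1 * B).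
  by field; rewrite gt_eqF.
have A0 : 0 <= A by exact: powR_ge0.
have B0 : 0 <= B by exact: powR_ge0.
rewrite ler_wpM2r//; first by rewrite mulr_ge0// mulr_ge0// invr_ge0 sqr_ge0.
have cs : 0 <= c1 * s0 by rewrite ltW// mulr_gt0.
apply: ler_wpM2r; first exact: ltW.
apply: (ler_wpM2l cs).
have i144 : 0 < 144%:R^-1 :> R by rewrite invr_gt0 ltr0n.
by rewrite (ler_pM2r i144) ler_sqr ?nnegrE ?(ltW t00) ?(ltW tp).
Qed.

(* Covariance integrals are restricted to one period in the first frequency
   coordinate and to a cube in the others, where Parseval applies. *)
Lemma eint_trig_energy_ge t0 t1 : 0 < t0 -> t0 <= t1 ->
  exists kap d0 : R, 0 < kap /\ 0 < d0 /\ forall t dl n (a : nat -> R),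
  t0 <= t <= t1 -> 0 < dl -> dl <= d0 ->
  ((kap * powR dl (gam - N%:R) * \sum_(i < n) a i ^+ 2)%:E <=
   eint N.+1 (fun w => (trig_energy n a (dl * rsubmx (w : 'rV[R]_(1 + N)) 0 i0) * jd t w)%:E))%E.
Proof.
move=> t00 t01; have [kap [e0 [kap0 [e00 HK]]]] := high_frequency_density t0 t1 t00 t01.
have p0 : 0 < pi :> R by exact: pi_gt0.
have p1 : 1 <= 2 * pi :> R by have := pi_ge2 R; lra.
(* On the box used below [|xi| <= D / dl]: at most [4 pi / dl] comes from the first coordinate and
   [1 / dl] from each other one. *)
pose D := 4 * pi + N%:R : R.
have D0 : 0 < D by rewrite ltr_wpDr ?ler0n// mulr_gt0.
exists (kap * powR D (- gam) * (2 * pi)), (e0^-1); split.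
  by rewrite !mulr_gt0// powR_gt0.
split; first by rewrite invr_gt0.
move=> t dl n a tt dl0 dle.
have dli0 : 0 < dl^-1 by rewrite invr_gt0.
have e0d : e0 <= dl^-1 by rewrite -[leLHS]invrK lef_pV2 ?posrE ?invr_gt0.
(* The second period rather than the first: there [|xi| >= 2 pi / dl >= 1 / dl >= e0], so the
   high-frequency bound holds on the whole box. *)
pose u0 := 2 * pi / dl; pose u1 := 4 * pi / dl.
pose K (i : nat) (s : R) : R := if i == 0 then trig_energy n a (dl * s) * \1_`[u0, u1] s
  else \1_`[0, dl^-1] s.
have mQ : measurable_fun setT (fun s : R => trig_energy n a (dl * s)).
  by apply: continuous_measurable_fun; exact: continuous_trig_energy.
have mK i : measurable_fun setT (K i).
  rewrite /K; case: eqP => _; last by apply: measurable_indic; exact: measurable_itv.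
  by apply: measurable_funM => //; apply: measurable_indic; exact: measurable_itv.
have K0 i s : 0 <= K i s.
  by rewrite /K; case: eqP => _; rewrite ?mulr_ge0 ?trig_energy_ge0 ?indicE.
pose kd := kap * powR (D / dl) (- gam).
have kd0 : 0 < kd by rewrite mulr_gt0// powR_gt0// divr_gt0.
have mq : measurable_fun setT (fun v : N.-tuple R => trig_energy n a (dl * rot v 0 i0)).
  apply: (measurableT_comp mQ); under eq_fun do rewrite mxE; exact: measurable_tnth.
rewrite (eint_joint_density N H h mh h0 t (fun v => trig_energy n a (dl * v 0 i0)))//; last first.
  by move=> v; exact: trig_energy_ge0.
apply: (@le_trans _ _ (eint N (fun v => kd%:E * (\prod_(i < N) K i (v 0 i))%:E)%E)).
  rewrite eintZl; last 3 first.
  - by rewrite lee_fin ltW.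
  - exact: measurable_coord_prod.
  - by move=> v; rewrite lee_fin prodr_ge0.
  rewrite eint_prod// (bigD1 i0)//=.
  have -> : (\int[mu]_s (K 0 s)%:E = (2 * pi / dl * \sum_(i < n) a i ^+ 2)%:E)%E.
    rewrite -(integral_trig_energy n a dl dl0) [RHS]integral_mkcond.
    apply: eq_integral => s _; rewrite /K/= patchE indicE.
    by case: ifP => _; rewrite ?mulr1 ?mulr0.
  have -> : (\prod_(i < N | i != i0) \int[mu]_s (K i s)%:E = ((dl^-1) ^+ N.-1)%:E)%E.
    rewrite (eq_bigr (fun=> (dl^-1)%:E)) => [|i ii0].
      rewrite prodEFin prodr_const; congr ((_ ^+ _)%:E).
      by rewrite -[in RHS](card_ord N) -(cardC1 i0); exact: eq_card.
    have -> : K i = \1_`[0, dl^-1].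
      apply/funext => s; rewrite /K ifF//.
      by apply/negbTE; move: ii0; apply: contra => /eqP E; apply/eqP; exact: val_inj.
    rewrite integral_indic//= setIT.
    by rewrite lebesgue_measure_itv/= lte_fin dli0 oppr0 adde0.
  rewrite -!EFinM lee_fin le_eqVlt; apply/orP; left; apply/eqP.
  have -> : kd = kap * powR D (- gam) * powR dl gam.
    rewrite /kd powRM ?(ltW D0) ?(ltW dli0)// mulrA; congr (_ * _).
    by rewrite -powR_inv1 ?(ltW dl0)// -powRrM mulN1r opprK.
  (* Power count, up to constants: [dl^gam] is the density on the box and [dl^(-N)] its volume, one
     factor from the period and [N.-1] from the cube. *)
  have -> : powR dl (gam - N%:R) = powR dl gam * (dl^-1) ^+ N.
    rewrite powRB; last by apply/implyP => _; rewrite gt_eqF.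
    by rewrite powR_mulrn ?(ltW dl0)// exprVn.
  have -> : (dl^-1) ^+ N = dl^-1 * (dl^-1) ^+ N.-1 by rewrite -exprS prednK.
  ring.
apply: le_eint.
- by apply: measurable_funeM; exact: measurable_coord_prod.
- apply: emeasurable_funM; last exact: measurable_time_integral.
  by apply/measurable_EFinP; exact: measurable_funM.
- by move=> v; rewrite -EFinM lee_fin mulr_ge0 ?(ltW kd0)// prodr_ge0.
move=> v.
have Q0 := trig_energy_ge0 n a (dl * v 0 i0).
have J0 := time_integral_ge0 H t (enorm v).
have K01 i s : (0 < i)%N -> K i s <= 1.
  by case: i => // i _; rewrite /K/= indicE; case: (_ \in _).
have prod_le : \prod_(i < N) K i (v 0 i) <= K 0 (v 0 i0).
  rewrite (bigD1 i0)//= ler_piMr//.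
  have /andP[_ //] : 0 <= \prod_(i < N | i != i0) K i (v 0 i) <= 1.
  apply: (big_ind (fun x => 0 <= x <= 1)) => [|x y /andP[? ?] /andP[? ?]|i ii0].
  - by rewrite ler01 lexx.
  - by rewrite mulr_ge0//= mulr_ile1.
  - rewrite K0 K01// lt0n; move: ii0; apply: contra => /eqP E; apply/eqP; exact: val_inj.
(* If no factor vanishes then all indicators are 1 and [v] lies in the box; otherwise the left side
   is 0. *)
case: (boolP [exists i : 'I_N, K i (v 0 i) == 0]) => [/existsP[i /eqP Ki]|].
  by rewrite (bigD1 i)//= Ki mul0r mule0 mule_ge0 ?lee_fin ?mulr_ge0.
rewrite negb_exists => /forallP Kn.
have v0I : u0 <= v 0 i0 <= u1.
  have := Kn i0; rewrite /K/= indicE; case: (boolP (_ \in _)); rewrite ?mulr0 ?eqxx//.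
  by rewrite inE/= in_itv.
have vI i : i != i0 -> `|v 0 i| <= dl^-1.
  move=> ii0; have := Kn i; rewrite /K ifF; last first.
    by apply/negbTE; move: ii0; apply: contra => /eqP E; apply/eqP; exact: val_inj.
  rewrite indicE; case: (boolP (_ \in _)); rewrite ?eqxx//.
  by rewrite inE/= in_itv/= => /andP[z0 z1] _; rewrite ger0_norm.
have /andP[v01 v02] := v0I.
have u00 : 0 <= u0 by rewrite divr_ge0 ?mulr_ge0 ?(ltW p0) ?(ltW dl0).
have v00 : 0 <= v 0 i0 by exact: le_trans v01.
have ev1 : dl^-1 <= enorm v.
  apply: le_trans (coord_le_enorm N v i0); rewrite ger0_norm//.
  by apply: le_trans v01; rewrite /u0 -[leLHS]mul1r ler_pM2r.
have ev2 : enorm v <= D / dl.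
  apply: (le_trans (enorm_le_sum _ v)).
  rewrite (bigD1 i0)//= ger0_norm// /D mulrDl; apply: lerD => //.
  apply: (@le_trans _ _ (\sum_(i < N | i != i0) dl^-1)); first by apply: ler_sum => i; exact: vI.
  apply: (@le_trans _ _ (\sum_(i < N) dl^-1)).
    by rewrite [leRHS](bigD1 i0)//= lerDr ltW.
  by rewrite sumr_const card_ord -[leLHS]mulr_natl.
have evp : 0 < enorm v by exact: lt_le_trans ev1.
apply: (@le_trans _ _ ((trig_energy n a (dl * v 0 i0))%:E * (kap * powR (enorm v) (- gam))%:E)%E); last first.
  rewrite [X in (_ <= X * _)%E]EFinM -muleA; apply: lee_wpmul2l; first by rewrite lee_fin.
  by apply: HK => //; exact: le_trans e0d ev1.
rewrite -!EFinM lee_fin mulrC ler_pM//.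
- by rewrite prodr_ge0.
- exact: ltW.
- apply: (le_trans prod_le); rewrite /K/= ler_piMr// indicE.
- by rewrite ler_wpM2l ?(ltW kap0)//; apply: ler_powRN => //; exact: ltW.
Qed.

Lemma cov_integral_re t x y :
  complex.Re (cov_integral H h t x t y) =
  iint (fun w : 'rV[R]_N.+1 => cos (dotv x (rsubmx (w : 'rV[R]_(1 + N))) -
    dotv y (rsubmx (w : 'rV[R]_(1 + N)))) * jd t w).
Proof.
transitivity (\int[mu]_tau iint (fun xi => complex.Re (cov_integrand H h t x t y tau xi))).
  by [].
apply: eq_Rintegral => tau _; congr iint; apply/funext => v.
rewrite cov_integrand_re row_mxKr /jd joint_densityE; congr (_ * _).
by rewrite /spectral_density /time_density mulrA.
Qed.

Definition lattice_point (x : 'rV[R]_N) (dl : R) (k : nat) : 'rV[R]_N :=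
  x + (k%:R * dl) *: delta_mx 0 i0.

Lemma dotv_lattice_point x dl k xi :
  dotv (lattice_point x dl k) xi = dotv x xi + k%:R * (dl * xi 0 i0).
Proof.
rewrite /dotv /lattice_point.
under eq_bigr do rewrite !mxE mulrDl.
rewrite big_split/=; congr (_ + _); rewrite (bigD1 i0)//= big1 ?addr0.
  by rewrite ?eqxx mulr1 mulrA.
by move=> j ji; rewrite (negbTE ji) mulr0 mul0r.
Qed.

(** Spectral form of the variance of a linear combination along the lattice. The base point [x]
    cancels in the phase differences, so later constants are uniform in [x]. *)
Lemma quadratic_form_iint t x dl n (a : nat -> R) : 0 < t ->
  \sum_(i < n) \sum_(j < n) a i * a j *
    complex.Re (cov_integral H h t (lattice_point x dl i) t (lattice_point x dl j)) =
  iint (fun w : 'rV[R]_N.+1 =>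
    trig_energy n a (dl * rsubmx (w : 'rV[R]_(1 + N)) 0 i0) * jd t w).
Proof.
move=> t0; under eq_bigr do under eq_bigr do rewrite cov_integral_re.
pose f (p : 'I_n * 'I_n) (w : 'rV[R]_N.+1) : R :=
  cos ((p.1%:R - p.2%:R) * (dl * rsubmx (w : 'rV[R]_(1 + N)) 0 i0)) * jd t w.
have mjd := measurable_joint_density t.
have jd0 w : 0 <= jd t w by exact: spectral_density_ge0.
have mf p : measurable_fun setT (fun w => f p (rot w)).
  apply: measurable_funM => //.
  apply: (measurable_freq (fun s => cos ((p.1%:R - p.2%:R) * (dl * s)))).
  apply: continuous_measurable_fun; under eq_fun do rewrite mulrA.
  exact: continuous_cosM.
have -> : (fun w : 'rV[R]_N.+1 => trig_energy n a (dl * rsubmx (w : 'rV[R]_(1 + N)) 0 i0) * jd t w)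
    = (fun w => \sum_(p : 'I_n * 'I_n) (a p.1 * a p.2) * f p w).
  apply/funext => w; rewrite trig_energyE pair_bigA/= mulr_suml.
  by apply: eq_bigr => p _; rewrite /f mulrA.
rewrite (iint_linear_combination N.+1 _ _ (fun p : 'I_n * 'I_n => a p.1 * a p.2) f (jd t))//.
- rewrite pair_bigA; apply: eq_bigr => p _; cbv beta; congr (_ * _).
  congr iint; apply/funext => w.
  by rewrite !dotv_lattice_point /f; congr (cos _ * _); ring.
- by move=> p w; rewrite /f normrM (ger0_norm (jd0 w)) ler_piMl// cos_max.
- exact: (joint_density_lty N H beta c2 h N0 H1 H2 b0 bN bH c20 mh h0 hle t t0).
Qed.

(** A form of strong local nondeterminism: the smallest eigenvalue of the lattice covariance matrix
    is at least of order [dl^(2 alpha)], whatever the number of points. *)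
Lemma variance_lower_bound t0 t1 : 0 < t0 -> t0 <= t1 ->
  exists kap d0 : R, 0 < kap /\ 0 < d0 /\ forall t x dl n (a : nat -> R),
  t0 <= t <= t1 -> 0 < dl -> dl <= d0 ->
  kap * powR dl (2 * H + 1 - N%:R + beta) * \sum_(i < n) a i ^+ 2 <=
  \sum_(i < n) \sum_(j < n) a i * a j *
    complex.Re (cov_integral H h t (lattice_point x dl i) t (lattice_point x dl j)).
Proof.
move=> t00 t01; have [kap [d0 [kap0 [d00 HK]]]] := eint_trig_energy_ge t0 t1 t00 t01.
exists kap, d0; split => //; split => // t x dl n a tt dl0 dld.
have tp : 0 < t by case/andP: tt => tt _; exact: lt_le_trans tt.
rewrite quadratic_form_iint//.
have jd0 w : 0 <= jd t w by exact: spectral_density_ge0.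
have mjd := measurable_joint_density t.
pose S := \sum_(i < n) `|a i|.
(* A crude bound, needed only for finiteness, which permits replacing [iint] by [eint]. *)
have te_le s : trig_energy n a s <= S ^+ 2 + S ^+ 2.
  have b (f : R -> R) : (forall x, `|f x| <= 1) -> (\sum_(i < n) a i * f (i%:R * s)) ^+ 2 <= S ^+ 2.
    move=> f1; rewrite -[leLHS]real_normK ?num_real// ler_sqr ?nnegrE ?sumr_ge0//.
    apply: (le_trans (ler_norm_sum _ _ _)); apply: ler_sum => i _.
    by rewrite normrM ler_piMr.
  by apply: lerD; apply: b => y; [exact: cos_max|exact: sin_max].
have mQ : measurable_fun setT (fun w : N.+1.-tuple R =>
    trig_energy n a (dl * rsubmx (rot w : 'rV[R]_(1 + N)) 0 i0) * jd t (rot w)).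
  apply: measurable_funM => //.
  apply: (measurable_freq (fun s => trig_energy n a (dl * s))).
  by apply: continuous_measurable_fun; exact: continuous_trig_energy.
have Qoo : (eint N.+1 (fun w : 'rV[R]_N.+1 =>
    (trig_energy n a (dl * rsubmx (w : 'rV[R]_(1 + N)) 0 i0) * jd t w)%:E) < +oo)%E.
  have := eint_dominated_lty N.+1 (fun w : 'rV[R]_N.+1 =>
    trig_energy n a (dl * rsubmx (w : 'rV[R]_(1 + N)) 0 i0) * jd t w) (jd t) (S ^+ 2 + S ^+ 2).
  have absE : (fun w : 'rV[R]_N.+1 =>
    `|trig_energy n a (dl * rsubmx (w : 'rV[R]_(1 + N)) 0 i0) * jd t w|%:E) =
    (fun w : 'rV[R]_N.+1 =>
    (trig_energy n a (dl * rsubmx (w : 'rV[R]_(1 + N)) 0 i0) * jd t w)%:E).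
    by apply/funext => w; rewrite ger0_norm// mulr_ge0// trig_energy_ge0.
  rewrite absE; apply => //.
  - by rewrite addr_ge0 ?sqr_ge0.
  - by move=> w; rewrite ger0_norm; [exact: ler_wpM2r|rewrite mulr_ge0// trig_energy_ge0].
  - exact: (joint_density_lty N H beta c2 h N0 H1 H2 b0 bN bH c20 mh h0 hle t tp).
rewrite -lee_fin iint_eint//; last by move=> w; rewrite mulr_ge0 ?trig_energy_ge0.
have -> : 2 * H + 1 - N%:R + beta = gam - N%:R by rewrite /gam; ring.
exact: HK.
Qed.

End variance_lower_bound.

(** * Gaussian variables *)

Section gaussian_variable.
Context {R : realType}.
Local Notation mu := (@lebesgue_measure R).

(** The Radon-Nikodym derivative of the law agrees almost everywhere with [normal_pdf], both having
    the same integral over every measurable set. *)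
Lemma ge0_integral_normal_prob s (f : R -> \bar R) :
  measurable_fun setT f -> (forall x, 0 <= f x)%E ->
  (\int[normal_prob 0%R s]_x f x = \int[mu]_x (f x * (normal_pdf 0 s x)%:E))%E.
Proof.
move=> mf f0.
have dom := @normal_prob_dominates R 0 s.
rewrite -(Radon_Nikodym_SigmaFinite.change_of_variables dom f0 measurableT mf).
have iRN := Radon_Nikodym_SigmaFinite.f_integrable dom.
apply: ae_eq_integral => //.
- by apply: emeasurable_funM => //; exact: (measurable_int mu).
- apply: emeasurable_funM => //; apply/measurable_EFinP; exact: measurable_normal_pdf.
- apply: ae_eqe_mul2l; apply: integral_ae_eq => //.
  + by apply/measurable_EFinP; exact: measurable_normal_pdf.
  + by move=> E _ mE; rewrite -Radon_Nikodym_SigmaFinite.f_integral.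
Qed.

Lemma maxe0_EFinM (y p : R) : 0 <= p -> (maxe y%:E 0 * p%:E = maxe (y * p)%:E 0)%E.
Proof.
by move=> p0; rewrite -!EFin_max -EFinM maxr_pMl// mul0r.
Qed.

Context {d0 : measure_display} {Omega : measurableType d0} (P : probability Omega R).

Lemma ge0_integral_gaussian (X : Omega -> R) s (f : R -> \bar R) :
  measurable_fun setT X ->
  (forall A : set R, measurable A -> P (X @^-1` A) = normal_prob 0 s A) ->
  measurable_fun setT f -> (forall x, 0 <= f x)%E ->
  (\int[P]_w f (X w) = \int[mu]_x (f x * (normal_pdf 0 s x)%:E))%E.
Proof.
move=> mX XE mf f0; rewrite -ge0_integral_normal_prob//.
have mX' : @measurable_fun _ _ Omega (measurableTypeR R) setT X := mX.
pose RX : {RV P >-> measurableTypeR R} :=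
  @mfun_Sub _ _ Omega (measurableTypeR R) X (mem_set mX').
have mf' : @measurable_fun _ _ (measurableTypeR R) _ setT f := mf.
rewrite -[LHS](ge0_integral_distribution RX mf' f0).
apply: eq_measure_integral => A mA _.
exact: XE.
Qed.

Lemma gaussian_transfer (X : Omega -> R) s (f : R -> R) (C : R) : 0 < s ->
  measurable_fun setT X ->
  (forall A : set R, measurable A -> P (X @^-1` A) = normal_prob 0 s A) ->
  measurable_fun setT f -> (forall x, `|f x| <= C * (1 + x ^+ 2)) ->
  P.-integrable setT (EFin \o (f \o X)) /\
  \int[P]_w f (X w) = \int[mu]_x (f x * normal_pdf 0 s x).
Proof.
move=> s0 mX XE mf fC.
have iF := integrable_mul_normal_pdf s f C s0 mf fC.
have mfX : measurable_fun setT (EFin \o (f \o X)).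
  by apply/measurable_EFinP; exact: measurableT_comp.
split.
  apply/integrableP; split => //.
  rewrite (ge0_integral_gaussian X s (fun x => `|f x|%:E))//; last first.
    by apply/measurable_EFinP; exact: measurableT_comp.
  have /integrableP[_] := iF; apply: le_lt_trans.
  rewrite le_eqVlt; apply/orP; left; apply/eqP; apply: eq_integral => x _.
  by rewrite -EFinM /= normrM (ger0_norm (normal_pdf_ge0 _ _ _)).
rewrite /Rintegral; congr fine; rewrite integralE [RHS]integralE; congr (_ - _)%E.
- have -> : (fun w => (f (X w))%:E)^\+%E = (fun w => ((fun x => (f x)%:E)^\+%E (X w))).
    by apply/funext => w; rewrite !funeposE.
  rewrite (ge0_integral_gaussian X s)//.
  + apply: eq_integral => x _; rewrite !funeposE maxe0_EFinM//.
    exact: normal_pdf_ge0.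
  + by apply: measurable_funepos; exact/measurable_EFinP.
- have -> : (fun w => (f (X w))%:E)^\-%E = (fun w => ((fun x => (f x)%:E)^\-%E (X w))).
    by apply/funext => w; rewrite !funenegE.
  rewrite (ge0_integral_gaussian X s)//.
  + apply: eq_integral => x _; rewrite !funenegE -!EFinN maxe0_EFinM ?mulNr//.
    exact: normal_pdf_ge0.
  + by apply: measurable_funeneg; exact/measurable_EFinP.
Qed.

(* The constant 16 is not optimal: it comes from x^2 g_s(x) <= 8 s^2 g_{2s}(x). *)
Lemma gaussian_cos_le (X : Omega -> R) : centered_gaussian P X ->
  P.-integrable setT (EFin \o (fun w => X w ^+ 2)) /\
  \int[P]_w cos (X w) <= expR (- (\int[P]_w X w ^+ 2 / 16)).
Proof.
move=> [mX [X0|[s [s0 XE]]]].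
  have mX2 : measurable_fun setT (fun w => X w ^+ 2) by exact: measurable_funX.
  have mc : measurable_fun setT (fun w => cos (X w)).
    apply: measurableT_comp => //; apply: continuous_measurable_fun; exact: continuous_cos.
  have X0' : {ae P, forall w, X w = 0}.
    exists [set w | X w != 0]; split => //.
    - rewrite (_ : [set w | X w != 0] = X @^-1` (~` [set 0])).
        by rewrite -[X in measurable X]setTI; apply: mX => //; exact: measurableC.
      by apply/seteqP; split => w /= /eqP.
    - by move=> w /= /eqP.
  have I2 : (\int[P]_w `|(X w ^+ 2)%:E| = 0)%E.
    apply/ae_eq_integral_abs => //; first exact/measurable_EFinP.
    have [Z [mZ Z0 sZ]] := X0'; exists Z; split => //; apply: subset_trans sZ.
    by apply: subsetC => w /= -> _; rewrite expr0n.
  split.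
    by apply/integrableP; split; [exact/measurable_EFinP|rewrite I2].
  have -> : \int[P]_w X w ^+ 2 = 0.
    rewrite /Rintegral -[RHS]/(fine 0%E) -I2; congr fine; apply: eq_integral => w _.
    by rewrite gee0_abs// lee_fin sqr_ge0.
  rewrite mul0r oppr0 expR0.
  have <- : \int[P]_w (1 : R) = 1.
    by rewrite Rintegral_cst// [X in _ * fine X](_ : _ = 1%E) ?mulr1//; exact: probability_setT.
  apply: le_Rintegral => //.
  - apply: (@le_integrable _ _ _ P _ measurableT _ (cst 1%:E)).
    + exact/measurable_EFinP.
    + by move=> w _ /=; rewrite lee_fin normr1 cos_max.
    + exact: finite_measure_integrable_cst.
  - exact: finite_measure_integrable_cst.
have mcos : measurable_fun setT (@cos R).
  by apply: continuous_measurable_fun; exact: continuous_cos.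
have b2 (x : R) : `|x ^+ 2| <= 1 * (1 + x ^+ 2).
  by rewrite mul1r ger0_norm ?sqr_ge0// lerDr.
have bc (x : R) : `|cos x| <= 1 * (1 + x ^+ 2).
  by rewrite mul1r (le_trans (cos_max _))// lerDl sqr_ge0.
have [i2 E2] := gaussian_transfer X s (fun x => x ^+ 2) 1 s0 mX XE (measurable_funX 2 (@measurable_id _ _ _)) b2.
split; first exact: i2.
have [_ ->] := gaussian_transfer X s cos 1 s0 mX XE mcos bc.
have -> : \int[mu]_x (cos x * normal_pdf 0 s x) = expR (- s ^+ 2 / 2).
  rewrite -[s in RHS]mul1r -(normal_cf s 1 s0).
  by apply: eq_Rintegral => x _; rewrite mul1r.
rewrite ler_expR E2.
have : \int[mu]_x (x ^+ 2 * normal_pdf 0 s x) <= \int[mu]_x (8 * s ^+ 2 * normal_pdf 0 (2 * s) x).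
  apply: le_Rintegral => //; last by move=> x _; exact: sqr_normal_pdf_le.
    exact: (integrable_mul_normal_pdf s (fun x => x ^+ 2) 1 s0 (measurable_funX 2 (@measurable_id _ _ _)) b2).
  by apply: integrableZl_EFin => //; exact: integrable_normal_pdf.
rewrite RintegralZl//; last exact: integrable_normal_pdf.
rewrite /Rintegral integral_normal_pdf mulr1.
set I := fine _; lra.
Qed.

End gaussian_variable.

(** * Small-ball estimate for lattice increments *)

Section small_increments.
Context {R : realType} {d0 : measure_display} {Omega : measurableType d0} (P : probability Omega R).

Lemma Rintegral_sum (I : finType) (f : I -> Omega -> R) :
  (forall i, P.-integrable setT (EFin \o f i)) ->
  \int[P]_w (\sum_i f i w) = \sum_i \int[P]_w f i w.
Proof.
move=> fi; have H (r : seq I) : P.-integrable setT (EFin \o (fun w => \sum_(i <- r) f i w)) /\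
    \int[P]_w (\sum_(i <- r) f i w) = \sum_(i <- r) \int[P]_w f i w.
  elim: r => [|i r [IH1 IH2]].
    split.
      by under [X in EFin \o X]eq_fun do rewrite big_nil; exact: finite_measure_integrable_cst.
    by under eq_Rintegral do rewrite big_nil; rewrite big_nil Rintegral_cst// mul0r.
  split.
    rewrite (_ : _ \o _ = (fun w => (f i w)%:E + (\sum_(k <- r) f k w)%R%:E)%E).
      exact: (integrableD measurableT (fi i) IH1).
    by apply/funext => w; rewrite /= big_cons EFinD.
  under eq_Rintegral do rewrite big_cons.
  by rewrite RintegralD// IH2 big_cons.
exact: (H _).2.
Qed.

Lemma second_moment_sum n (X : nat -> Omega -> R) (a : nat -> R) :
  (forall k, measurable_fun setT (X k)) ->
  (forall k, P.-integrable setT (EFin \o (fun w => X k w ^+ 2))) ->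
  \int[P]_w (\sum_(k < n) a k * X k w) ^+ 2 =
  \sum_(i < n) \sum_(j < n) a i * a j * \int[P]_w (X i w * X j w).
Proof.
move=> mX iX.
have iXX i j : P.-integrable setT (EFin \o (fun w => X i w * X j w)).
  apply: (@le_integrable _ _ _ P _ measurableT _
      (EFin \o (fun w => X i w ^+ 2 + X j w ^+ 2))).
  - by apply/measurable_EFinP; exact: measurable_funM.
  - move=> w _ /=; rewrite lee_fin [leRHS]ger0_norm ?addr_ge0 ?sqr_ge0//.
    by rewrite ler_norml; apply/andP; split; nra.
  - exact: (integrableD measurableT (iX i) (iX j)).
rewrite pair_bigA/=.
transitivity (\int[P]_w (\sum_(p : 'I_n * 'I_n) a p.1 * a p.2 * (X p.1 w * X p.2 w))).
  apply: eq_Rintegral => w _; rewrite expr2 big_distrlr/= pair_bigA/=.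
  by apply: eq_bigr => p _; rewrite mulrACA.
rewrite Rintegral_sum => [|p]; last exact: integrableZl_EFin.
by apply: eq_bigr => p _; exact: RintegralZl.
Qed.

(** The threshold [ep] satisfies [K / ep^2 = 8 e^3]. Divided by the 16 of [gaussian_cos_le], this is
    the characteristic function bound with [s = e^3], and [e^(1/2) / sqrt (1 + e^3) <= e^(-1)]. *)
Lemma increments_small_ball (X : nat -> Omega -> R) (K : R) n :
  (forall k, measurable_fun setT (X k)) ->
  (forall m (a : nat -> R), centered_gaussian P (fun w => \sum_(k < m) a k * X k w)) ->
  0 < K ->
  (forall m (a : nat -> R),
    K * \sum_(k < m) a k ^+ 2 <= \int[P]_w (\sum_(k < m) a k * X k w) ^+ 2) ->
  (P [set w | forall j, (j < n)%N ->
     (`|X j.+1 w - X 0%N w| <= Num.sqrt (K / (8 * expR 3)))%R] <= (expR (- n%:R))%:E)%E.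
Proof.
move=> mX gX K0 KX.
have e30 : 0 < expR 3 :> R by exact: expR_gt0.
set ep := Num.sqrt _.
have ep0 : 0 < ep by rewrite sqrtr_gt0 divr_gt0// mulr_gt0.
have epE : ep ^+ 2 = K / (8 * expR 3) by rewrite sqr_sqrtr// ltW// divr_gt0// mulr_gt0.
pose Y j w := (X j.+1 w - X 0%N w) / ep.
have := small_ball_probability P Y n (expR 3).
rewrite (_ : [set w | _] = [set w | forall j, (j < n)%N -> `|X j.+1 w - X 0%N w| <= ep]); last first.
  apply/seteqP; split => w /= Hw j jn; have := Hw j jn;
    by rewrite /Y normrM (@gtr0_norm _ ep^-1) ?invr_gt0// ler_pdivrMr// mul1r.
move=> SB; apply: le_trans (SB _ (ltW e30) _) _.
- by move=> j; apply: measurable_funM => //; exact: measurable_funB.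
(* A combination of increments as a combination of the [X k]. The coefficient of [X 0] collects
   minus the sum of the others, and its square is simply dropped from the lower bound. *)
- move=> b; pose a k := if k is k'.+1 then b k' / ep else - \sum_(j < n) b j / ep.
  have LE w : \sum_(j < n) b j * Y j w = \sum_(k < n.+1) a k * X k w.
    rewrite big_ord_recl/= mulNr mulr_suml -sumrN -big_split/=.
    by apply: eq_bigr => j _; rewrite /Y; ring.
  under eq_Rintegral do rewrite LE.
  have [_ gle] := gaussian_cos_le P _ (gX n.+1 a).
  apply: (le_trans gle); rewrite ler_expR mulNr lerN2.
  have KXa := KX n.+1 a.
  have : \sum_(k < n.+1) a k ^+ 2 >= \sum_(j < n) b j ^+ 2 / ep ^+ 2.
    rewrite big_ord_recl/=; apply: ler_wpDl; first exact: sqr_ge0.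
    by apply: ler_sum => j _; rewrite expr_div_n.
  rewrite -mulr_suml epE invf_div; set B := \sum_(j < n) _; move=> AB.
  have : K * (B * (8 * expR 3 / K)) <= K * \sum_(k < n.+1) a k ^+ 2 by rewrite ler_pM2l.
  rewrite (_ : K * (B * (8 * expR 3 / K)) = 8 * (expR 3 * B)); last by field; rewrite gt_eqF.
  move: KXa; set I := \int[P]_w _; set A := K * \sum_(k < n.+1) _; set E := expR 3 * B.
  by move=> ? ?; lra.
- rewrite lee_fin (_ : - n%:R = n%:R * (-1)); last by rewrite mulrN1.
  rewrite expRM_natl.
  apply: lerXn2r; rewrite ?nnegrE ?divr_ge0 ?sqrtr_ge0 ?expR_ge0//.
  rewrite ler_pdivrMr ?sqrtr_gt0 ?addr_gt0//.
  have -> : expR 2^-1 = expR (-1) * expR (3 / 2) :> R by rewrite -expRD; congr expR; lra.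
  rewrite ler_pM2l ?expR_gt0//.
  rewrite -[leLHS](@ger0_norm R) ?expR_ge0// -sqrtr_sqr ler_sqrt ?addr_ge0 ?expR_ge0//.
  rewrite -expRM_natl (_ : 2%:R * (3 / 2) = 3 :> R); last lra.
  by rewrite lerDr.
Qed.

Lemma field_small_ball (N : nat) (H beta c1 c2 cH : R) (h : 'rV[R]_N -> R)
  (v : R -> 'rV[R]_N -> Omega -> R) (N0 : (0 < N)%N) (t0 t1 : R) :
  1 / 2 <= H -> H < 1 -> 0 < beta -> beta < N%:R -> N%:R - 2 * H - 1 < beta ->
  0 < c1 -> 0 < c2 ->
  measurable_fun [set: N.-tuple R] (fun v => h (\row_(l < N) tnth v l)) ->
  (forall xi, 0 <= h xi) ->
  (forall xi, xi != 0 -> c1 * powR (enorm xi) (- beta) <= h xi) ->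
  (forall xi, xi != 0 -> h xi <= c2 * powR (enorm xi) (- beta)) ->
  0 < cH ->
  centered_gaussian_field P v ->
  (forall (t : R) (x : 'rV[R]_N) (s : R) (y : 'rV[R]_N), 0 <= t -> 0 <= s ->
     'E_P[fun w => (v t x w * v s y w)%R]%E
       = (cH * complex.Re (cov_integral H h t x s y))%:E) ->
  0 < t0 -> t0 <= t1 ->
  exists eps d1 : R, 0 < eps /\ 0 < d1 /\ forall t x dl n,
    t0 <= t <= t1 -> 0 < dl -> dl <= d1 ->
    (P [set w | forall j, (j < n)%N ->
       (`|v t (lattice_point N N0 x dl j.+1) w - v t x w| <=
          eps * powR dl ((2 * H + 1 - N%:R + beta) / 2))%R] <= (expR (- n%:R))%:E)%E.
Proof.
move=> H1 H2 b0 bN bH c10 c20 mh h0 hge hle cH0 gv cov t00 t01.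
have [kap [d1 [kap0 [d10 var]]]] := variance_lower_bound N H beta c1 c2 h N0
  H1 H2 b0 bN bH c10 c20 mh h0 hge hle t0 t1 t00 t01.
exists (Num.sqrt (cH * kap / (8 * expR 3))), d1; split.
  by rewrite sqrtr_gt0 divr_gt0 ?mulr_gt0 ?expR_gt0.
split => // t x dl n tt dl0 dld.
have tp : 0 <= t by case/andP: tt => tt _; apply: le_trans tt; exact: ltW.
set al := _ / 2.
pose X k := v t (lattice_point N N0 x dl k).
have X0 : X 0%N = v t x by rewrite /X /lattice_point mul0r scale0r addr0.
have gX m (a : nat -> R) : centered_gaussian P (fun w => \sum_(k < m) a k * X k w).
  have := gv [seq (a k, (t, lattice_point N N0 x dl k)) | k <- iota 0 m].
  rewrite (_ : (fun w => \sum_(q <- _) _) = (fun w => \sum_(k < m) a k * X k w)).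
    by apply => q /mapP[k _ ->].
  by apply/funext => w; rewrite big_map -[X in iota 0 X]subn0 -/(index_iota 0 m) big_mkord.
have gX1 k : centered_gaussian P (X k).
  have := gX k.+1 (fun i => (i == k)%:R).
  rewrite (_ : (fun w => _) = X k)//; apply/funext => w.
  rewrite (bigD1 ord_max)//= eqxx mul1r big1 ?addr0// => i.
  by rewrite -val_eqE/= => /negbTE ->; rewrite mul0r.
have mX k : measurable_fun setT (X k) by case: (gX1 k).
have iX k := (gaussian_cos_le P _ (gX1 k)).1.
have EX i j : \int[P]_w (X i w * X j w) = cH * complex.Re (cov_integral H h t
    (lattice_point N N0 x dl i) t (lattice_point N N0 x dl j)).
  by have := cov t (lattice_point N N0 x dl i) t (lattice_point N N0 x dl j) tp tp; rewrite unlock /Rintegral => ->.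
pose K := cH * kap * powR dl (2 * H + 1 - N%:R + beta).
have K0 : 0 < K by rewrite !mulr_gt0// powR_gt0.
have := increments_small_ball X K n mX gX K0.
have -> : Num.sqrt (K / (8 * expR 3)) = Num.sqrt (cH * kap / (8 * expR 3)) * powR dl al.
  rewrite /K (_ : _ / _ = cH * kap / (8 * expR 3) * powR dl al ^+ 2); last first.
    rewrite mulrAC; congr (_ * _); rewrite -powR_mulrn ?powR_ge0// -powRrM /al.
    by congr powR; field.
  rewrite sqrtrM ?sqrtr_sqr ?ger0_norm ?powR_ge0//.
  by rewrite divr_ge0 ?mulr_ge0 ?expR_ge0 ?ltW.
rewrite X0; apply => m a; rewrite second_moment_sum//.
have := var t x dl m a tt dl0 dld; rewrite -(ler_pM2l cH0).
set S := \sum_(i < m) \sum_(j < m) _.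
rewrite (_ : cH * S = \sum_(i < m) \sum_(j < m) a i * a j * \int[P]_w (X i w * X j w)).
  by rewrite /K !mulrA.
rewrite /S mulr_sumr; apply: eq_bigr => i _; rewrite mulr_sumr; apply: eq_bigr => j _.
by rewrite EX mulrCA.
Qed.

End small_increments.

(** * Borel-Cantelli and the choice of scales *)

Section borel_cantelli.
Context {R : realType} {d0 : measure_display} {Omega : measurableType d0} (P : probability Omega R).

Lemma inv_sqr_nneseries_lty (C : R) : 0 <= C ->
  (\sum_(0 <= m <oo) (C / m.+1%:R ^+ 2)%:E < +oo)%E.
Proof.
move=> C0; apply: (@le_lt_trans _ _ (2 * C)%:E); last exact: ltry.
apply: lime_le.
  by apply: is_cvg_nneseries => m _ _; rewrite lee_fin divr_ge0 ?sqr_ge0.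
apply: nearW => n; rewrite sumEFin lee_fin.
(* Telescoping majorant: [1 / x^2 <= 2 (1 / x - 1 / (x + 1))] for [x >= 1]. *)
have H : \sum_(0 <= m < n) C / m.+1%:R ^+ 2 <= \sum_(0 <= m < n) ((- (2 * C / m.+2%:R)) - (- (2 * C / m.+1%:R))).
  apply: ler_sum => m _; rewrite opprK addrC -mulrBr.
  have m0 : 0 < m.+1%:R :> R by rewrite ltr0n.
  have m1 : 1 <= m.+1%:R :> R by rewrite ler1n.
  rewrite -[m.+2%:R]natr1; set x := m.+1%:R in m0 m1 *.
  have x1 : 0 < x + 1 by rewrite addr_gt0.
  have -> : 2 * C * (x^-1 - (x + 1)^-1) = C * (2 / (x * (x + 1))) by field; rewrite !gt_eqF.
  rewrite ler_wpM2l// ler_pdivlMr ?mulr_gt0// mulrC ler_pdivrMr ?exprn_gt0//.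
  by nra.
apply: (le_trans H); rewrite (telescope_sumr (fun m => - (2 * C / m.+1%:R)))//.
by rewrite divr1 opprK addrC gerBl divr_ge0// mulr_ge0.
Qed.

Lemma ae_eventually_not (F : nat -> set Omega) (C : R) (M0 : nat) : 0 <= C ->
  (forall m, measurable (F m)) ->
  (forall m, (M0 <= m)%N -> (P (F m) <= (C / m.+1%:R ^+ 2)%:E)%E) ->
  {ae P, forall w, exists M, forall m, (M <= m)%N -> ~ F m w}.
Proof.
move=> C0 mF PF.
(* The added term covers the first [M0] events, whose probability is only known to be at most 1. *)
pose C' := C + M0%:R ^+ 2.
have C'0 : 0 <= C' by rewrite addr_ge0 ?sqr_ge0.
have F0 : P (lim_sup_set F) = 0%E.
  apply: lim_sup_set_cvg0 => //; apply: le_lt_trans (inv_sqr_nneseries_lty C' C'0).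
  apply: lee_nneseries => [m _ _|m _]; first exact: measure_ge0.
  have [M0m|mM0] := leqP M0 m.
    apply: (le_trans (PF _ M0m)); rewrite lee_fin ler_wpM2r ?invr_ge0 ?sqr_ge0//.
    by rewrite lerDl sqr_ge0.
  apply: (le_trans (probability_le1 P (mF m))); rewrite lee_fin.
  rewrite ler_pdivlMr ?exprn_gt0 ?ltr0n// mul1r.
  apply: (@le_trans _ _ (M0%:R ^+ 2)); last by rewrite lerDr.
  by rewrite lerXn2r ?nnegrE ?ler0n// ler_nat.
exists (lim_sup_set F); split => //.
  by apply: bigcap_measurable => // n _; apply: bigcup_measurable.
move=> w /= Hw n _ ; apply: contrapT => nF; apply: Hw; exists n => m nm Fm.
by apply: nF; exists m.
Qed.

End borel_cantelli.

Section scales.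
Context {R : realType}.

Lemma ln_inv_expRN (x : R) : ln (expR (- x))^-1 = x.
Proof. by rewrite expRN invrK expRK. Qed.

(** Passage from a discrete scale [r'] with [nn] lattice steps to the normalization at a continuous
    radius [r], where [g] is the logarithmic factor; the loss is the constant [(c c')^(-al)]. *)
Lemma scale_ratio (al r r' nn g c c' : R) : 0 < al -> 0 < r -> 0 < r' -> 0 < nn -> 0 < g ->
  0 < c -> 0 < c' -> nn <= c * g -> r <= c' * r' ->
  powR (c * c') (- al) * (powR r al * powR g (- al)) <= powR (r' / nn) al.
Proof.
move=> al0 r0 r'0 n0 g0 c0 c'0 ng rr.
have Vp (x : R) : 0 < x -> powR x (- al) = powR x^-1 al.
  by move=> x0; rewrite -powR_inv1 ?ltW// -powRrM mulN1r.
have cc0 : 0 < c * c' by rewrite mulr_gt0.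
rewrite !Vp// -!powRM ?divr_ge0 ?mulr_ge0 ?invr_ge0 ?(ltW cc0) ?(ltW r0) ?(ltW g0)//.
have [q0 q1] : 0 <= (c * c')^-1 * (r * g^-1) /\ 0 <= r' / nn.
  by split; rewrite ltW// ?mulr_gt0 ?invr_gt0// mulr_gt0 ?invr_gt0.
apply: ge0_ler_powR => //; first exact: ltW.
have -> : (c * c')^-1 * (r * g^-1) = (r / c') / (c * g) by field; rewrite !gt_eqF.
apply: ler_pM.
- by rewrite divr_ge0// ltW.
- by rewrite invr_ge0 mulr_ge0// ltW.
- by rewrite ler_pdivrMr// mulrC.
- by rewrite lef_pV2 ?posrE ?mulr_gt0.
Qed.

(** The radius is rounded down to [exp (- m)], so that a displacement at the discrete scale stays
    within [r]; the rounding costs at most a factor [e]. *)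
Lemma scale_of_radius (r : R) : 0 < r -> r < 1 ->
  exists m : nat, [/\ expR (- m%:R) <= r, r <= expR 1 * expR (- m%:R) & m%:R <= ln r^-1 + 1].
Proof.
move=> r0 r1; have L0 : 0 <= ln r^-1 by rewrite ln_ge0// invf_ge1// ltW.
have rE : r = expR (- ln r^-1) by rewrite lnV ?posrE// opprK lnK ?posrE.
exists (Num.trunc (ln r^-1)).+1; have /andP[tL Lt] := truncn_itv L0; split.
- by rewrite [leRHS]rE ler_expR lerN2 ltW.
- by rewrite -expRD [leLHS]rE ler_expR -natr1 opprD addrCA subrr addr0 lerN2.
- by rewrite -natr1 lerD2r.
Qed.

End scales.

(** * Oscillation of the field *)

Section oscillation.
Context {R : realType} {d0 : measure_display} {Omega : measurableType d0} (P : probability Omega R).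
Context (N : nat) (N0 : (0 < N)%N) (v : R -> 'rV[R]_N -> Omega -> R) (t0 t1 al eps d1 : R).
Hypotheses (t01 : t0 <= t1) (al0 : 0 < al) (eps0 : 0 < eps) (d10 : 0 < d1).
Hypothesis mv : forall t x, t0 <= t <= t1 -> measurable_fun setT (v t x).
Local Notation lp := (lattice_point N N0).

(** The exceptional event fed to Borel-Cantelli. *)
Definition flat t x dl n : set Omega :=
  [set w | forall j, (j < n)%N -> (`|v t (lp x dl j.+1) w - v t x w| <= eps * powR dl al)%R].

Hypothesis small_ball : forall t x dl n, t0 <= t <= t1 -> 0 < dl -> dl <= d1 ->
  (P (flat t x dl n) <= (expR (- n%:R))%:E)%E.

Lemma measurable_flat t x dl n : t0 <= t <= t1 -> measurable (flat t x dl n).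
Proof.
move=> tt; rewrite (_ : flat _ _ _ _ = \bigcap_(j in [set j | (j < n)%N])
    [set w | `|v t (lp x dl j.+1) w - v t x w| <= eps * powR dl al]); last first.
  by apply/seteqP; split => w /=.
apply: bigcap_measurableType => // j _.
rewrite (_ : [set w | _] = (fun w => `|v t (lp x dl j.+1) w - v t x w|) @^-1` `]-oo, eps * powR dl al]).
  rewrite -[X in measurable X]setTI.
  have m : measurable_fun setT (fun w => `|v t (lp x dl j.+1) w - v t x w|).
    by apply: measurableT_comp => //; apply: measurable_funB; exact: mv.
  by apply: m => //; exact: measurable_itv.
by apply/seteqP; split => w /=; rewrite in_itv.
Qed.

Lemma not_flat t x dl n w : ~ flat t x dl n w ->
  exists2 j, (j < n)%N & eps * powR dl al < `|v t (lp x dl j.+1) w - v t x w|.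
Proof.
move=> nf; apply: contrapT => H; apply: nf => j jn; rewrite leNgt; apply/negP => h.
by apply: H; exists j.
Qed.

Lemma lattice_point_coord (x : 'rV[R]_N) (dl : R) n j l : 0 <= dl -> (j < n)%N ->
  0 <= lp x dl j.+1 0 l - x 0 l <= n%:R * dl.
Proof.
move=> dl0 jn; rewrite /lattice_point !mxE [X in X - _]addrC addrK.
rewrite !eqxx/=; case: (_ == _); rewrite ?mulr1 ?mulr0.
  by rewrite mulr_ge0//= ler_wpM2r// ler_nat.
by rewrite lexx/= mulr_ge0.
Qed.

Lemma expRN_nat_le (c : R) m : 0 < c -> (Num.bound c^-1 <= m)%N -> expR (- m%:R) <= c.
Proof.
move=> c0 cm; rewrite expRN -[leRHS]invrK lef_pV2 ?posrE ?invr_gt0 ?expR_gt0//.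
have := archi_boundP (ltW (_ : 0 < c^-1)); rewrite invr_gt0 => /(_ c0) h.
apply: (le_trans (ltW h)); apply: (@le_trans _ _ m%:R); first by rewrite ler_nat.
by apply: le_trans (expR_ge1Dx _); rewrite lerDr.
Qed.

Lemma expR1_le4 : expR 1 <= 4 :> R.
Proof.
have h : 2^-1 <= expR (- 2^-1) :> R by apply: le_trans (expR_ge1Dx _); lra.
have -> : 1 = 2^-1 + 2^-1 :> R by lra.
rewrite expRD; move: h; rewrite expRN lef_pV2 ?posrE ?expR_gt0// => h.
have := expR_gt0 (2^-1 : R); nra.
Qed.

Lemma local_oscillation t x : t0 <= t <= t1 ->
  {ae P, forall w, exists2 r0, 0 < r0 & forall r, 0 < r -> r < r0 ->
    exists2 y, Ibox r t x (t, y) &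
      eps * powR (5 * expR 1) (- al) * (powR r al * powR (ln (ln r^-1)) (- al))
        <= `|v t y w - v t x w|}.
Proof.
move=> tt.
(* The order of [n] is minimal for summability: [exp (- n) <= (m + 1)^(-2)]. *)
pose n m := (Num.trunc (2 * ln (m.+1%:R : R))).+1.
pose dl m : R := expR (- m%:R) / (n m)%:R.
have n0 m : 0 < (n m)%:R :> R by rewrite ltr0n.
have dl0 m : 0 < dl m by rewrite divr_gt0// expR_gt0.
have lnm m : 0 <= 2 * ln (m.+1%:R : R) by rewrite mulr_ge0// ln_ge0// ler1n.
have Fb m : (Num.bound d1^-1 <= m)%N -> (P (flat t x (dl m) (n m)) <= (1 / m.+1%:R ^+ 2)%:E)%E.
  move=> bm; apply: (le_trans (small_ball t x (dl m) (n m) tt (dl0 m) _)).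
    apply: le_trans (expRN_nat_le _ _ d10 bm).
    by rewrite ler_pdivrMr// ler_peMr ?expR_ge0// ler1n.
  rewrite lee_fin; apply: (@le_trans _ _ (expR (- (2 * ln m.+1%:R)))).
    by rewrite ler_expR lerN2; have /andP[_] := truncn_itv (lnm m); exact: ltW.
  by rewrite expRN div1r expRM_natl lnK ?posrE ?ltr0n.
have := ae_eventually_not P (fun m => flat t x (dl m) (n m)) 1 _ ler01
  (fun m => measurable_flat t x (dl m) (n m) tt) Fb.
move=> [Z [mZ Z0 sZ]]; exists Z; split => //; apply: subset_trans sZ; apply: subsetC.
(* [M] forces the discrete scale [m] of [r] past [M]; the extra 4 gives [ln r^-1 > 4 >= e], so that
   [ln (ln r^-1) >= 1] absorbs additive constants. *)
move=> w /= [M HM]; exists (expR (- M.+4%:R)); first exact: expR_gt0.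
move=> r r0 rM.
have L4 : M.+4%:R < ln r^-1.
  by rewrite lnV ?posrE// ltrNr -[ltRHS]expRK ltr_ln ?posrE ?expR_gt0.
have r1 : r < 1.
  by apply: lt_le_trans rM _; rewrite -expR0 ler_expR oppr_le0.
have [m [m1 m2 m3]] := scale_of_radius r r0 r1.
have Lm : ln r^-1 <= m%:R.
  by rewrite lnV ?posrE// lerNl -[leLHS]expRK ler_ln ?posrE ?expR_gt0.
have Mm : (M <= m)%N.
  rewrite -(ler_nat R); apply: le_trans Lm; apply: le_trans (ltW L4).
  by rewrite ler_nat -addn4 leq_addr.
have [j jn hj] := not_flat _ _ _ _ _ (HM m Mm).
exists (lp x (dl m) j.+1).
  split => /=; first by rewrite subrr normr0 ltW.
  move=> l; have /andP[c0 c1] := lattice_point_coord x (dl m) (n m) j l (ltW (dl0 m)) jn.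
  rewrite ger0_norm//; apply: (le_trans c1).
  by rewrite /dl mulrCA divff ?gt_eqF// mulr1.
apply: le_trans (ltW hj); rewrite -mulrA ler_pM2l//.
have L4' : 4 < ln r^-1 by apply: le_lt_trans L4; rewrite ler_nat.
apply: scale_ratio => //; rewrite ?expR_gt0//.
- by rewrite ln_gt0//; apply: lt_trans L4'; rewrite ltr1n.
set L := ln r^-1 in L4' m3 *.
have L0 : 0 < L by lra.
have lnL : 1 <= ln L.
  rewrite -[leLHS]expRK ler_ln ?posrE ?expR_gt0//.
  by apply: (le_trans expR1_le4); exact: ltW.
have : (n m)%:R <= 2 * ln (m.+1%:R : R) + 1.
  by rewrite /n -natr1 lerD2r; have /andP[] := truncn_itv (lnm m).
(* From [m + 1 <= L + 2 <= L^2]. Thus [n m <= 4 ln L + 1 <= 5 ln L], the origin of the constant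
   5. *)
have : ln (m.+1%:R : R) <= 2 * ln L.
  rewrite -[2 * _]/(2%:R * _) mulr_natl -lnXn// ler_ln ?posrE ?ltr0n ?exprn_gt0//.
  rewrite -natr1; move: m3; set mm := m%:R => m3; rewrite expr2; nra.
set q := ln m.+1%:R; set p := (n m)%:R => h1 h2; lra.
Qed.

Lemma oscillation_split (A p q s : R) : A < `|p - q| -> A / 2 <= `|p - s| \/ A / 2 <= `|q - s|.
Proof.
move=> h; have [|/ltW h1] := leP (A / 2) `|p - s|; first by left.
right; have := ler_normB (p - s) (q - s).
rewrite (_ : p - s - (q - s) = p - q); last by ring.
move: h h1; set x := `|p - q|; set y := `|p - s|; set z := `|q - s|; lra.
Qed.

(** Borel-Cantelli controls increments only from grid points. If two points near [(t, x)] have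
    values more than [A] apart, one of them differs from the value at [(t, x)] by at least [A / 2];
    hence the factor [eps / 2] and a witness [q] whose time may differ from [t]. *)
Lemma uniform_oscillation (a b : 'rV[R]_N) :
  {ae P, forall w, exists2 r0, 0 < r0 & forall r, 0 < r -> r < r0 ->
    forall (t : R) (x : 'rV[R]_N), t0 <= t <= t1 -> (forall l, a 0 l <= x 0 l <= b 0 l) ->
    exists q : R * 'rV[R]_N, Ibox r t x q /\ t0 <= q.1 <= t1 /\
      eps / 2 * powR (3 * N.+3%:R * (2 * expR 1)) (- al) * (powR r al * powR (ln r^-1) (- al))
        <= `|v q.1 q.2 w - v t x w|}.
Proof.
pose rho m : R := expR (- m%:R) / 2.
have rho0 m : 0 < rho m by rewrite divr_gt0// expR_gt0.
(* The grid has at most [C exp (m (N + 1))] points. This [n] beats their number and leaves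
   [exp (- 2 (m + 1)) <= (m + 1)^(-2)]. *)
pose n m := (N.+3 * m.+1)%N.
pose dl m : R := rho m / (n m)%:R.
have n0 m : 0 < (n m)%:R :> R by rewrite ltr0n.
have dl0 m : 0 < dl m by rewrite divr_gt0.
pose D := `|t1 - t0| + \sum_l `|b 0 l - a 0 l|.
have D0 : 0 <= D by rewrite addr_ge0// sumr_ge0.
pose K m := (Num.trunc (D / rho m)).+1.
have Klt m z : 0 <= z -> z <= D -> (Num.trunc (z / rho m) < K m)%N.
  by move=> z0 zD; rewrite ltnS; apply: le_truncn; rewrite ler_pM2r ?invr_gt0.
pose T m : finType := ('I_(K m) * {ffun 'I_N -> 'I_(K m)})%type.
(* Times are truncated at [t1], beyond which neither measurability nor the small-ball bound is
   assumed. The truncation is inactive at the grid points chosen later. *)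
pose gt m (p : T m) : R := Num.min (t0 + p.1%:R * rho m) t1.
pose gx m (p : T m) : 'rV[R]_N := \row_l (a 0 l + (p.2 l)%:R * rho m).
have gtt m p : t0 <= gt m p <= t1.
  by rewrite le_min ge_min lexx orbT t01 !andbT lerDl mulr_ge0// ltW.
pose F m := \big[setU/set0]_(i < #|T m|) flat (gt m (enum_val i)) (gx m (enum_val i)) (dl m) (n m).
have mF m : measurable (F m).
  by apply: bigsetU_measurable => i _; apply: measurable_flat; exact: gtt.
pose C := (2 * D + 1) ^+ N.+1.
have C0 : 0 <= C by rewrite exprn_ge0// addr_ge0// mulr_ge0.
have Fb m : (Num.bound d1^-1 <= m)%N -> (P (F m) <= (C / m.+1%:R ^+ 2)%:E)%E.
  move=> bm.
  have dld : dl m <= d1.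
    apply: le_trans (expRN_nat_le _ _ d10 bm).
    rewrite /dl /rho ler_pdivrMr// ler_pdivrMr// -mulrA ler_peMr ?expR_ge0//.
    by rewrite -natrM ler1n.
  apply: (@le_trans _ _ (\sum_(i < #|T m|) P (flat (gt m (enum_val i)) (gx m (enum_val i)) (dl m) (n m)))%E).
    pose A k := if insub k is Some i then
      flat (gt m (enum_val (i : 'I_#|T m|))) (gx m (enum_val i)) (dl m) (n m) else set0.
    have AE (i : 'I_#|T m|) : A i = flat (gt m (enum_val i)) (gx m (enum_val i)) (dl m) (n m).
      by rewrite /A valK.
    have -> : F m = \big[setU/set0]_(i < #|T m|) A i by apply: eq_bigr => i _; rewrite AE.
    rewrite (eq_bigr (fun i : 'I_#|T m| => P (A i))) => [|i _]; last by rewrite AE.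
    apply: Boole_inequality => i iT; rewrite /A; case: insubP => // k _ _.
    by apply: measurable_flat; exact: gtt.
  apply: (@le_trans _ _ (\sum_(i < #|T m|) (expR (- (n m)%:R))%:E)%E).
    by apply: lee_sum => i _; exact: small_ball.
  rewrite sumEFin lee_fin sumr_const card_ord card_prod card_ffun !card_ord -expnS.
  rewrite -[leLHS]mulr_natl natrX.
  have Kle : (K m)%:R <= (2 * D + 1) * expR m%:R.
    have /andP[h _] := truncn_itv (divr_ge0 D0 (ltW (rho0 m))).
    rewrite /K -[(Num.trunc _).+1%:R]natr1 (mulrDl (2 * D) 1) mul1r; apply: lerD.
      by apply: (le_trans h); rewrite /rho expRN invf_div invrK mulrCA mulrA.
    by apply: le_trans (expR_ge1Dx _); rewrite lerDl.
  have h1 : (K m)%:R ^+ N.+1 <= C * expR m%:R ^+ N.+1.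
    by rewrite -exprMn lerXn2r ?nnegrE ?mulr_ge0 ?addr_ge0 ?mulr_ge0 ?expR_ge0.
  apply: (@le_trans _ _ (C * expR m%:R ^+ N.+1 * expR (- (n m)%:R))).
    by rewrite ler_wpM2r ?expR_ge0.
  rewrite -mulrA ler_wpM2l// -expRM_natl -expRD.
  apply: (@le_trans _ _ (expR (2%:R * - m.+1%:R))).
    rewrite ler_expR /n natrM -!natr1.
    have := ler0n R N; have := ler0n R m; set x := m%:R; set y := N%:R => ? ?; nra.
  rewrite expRM_natl expRN exprVn lef_pV2 ?posrE ?exprn_gt0 ?expR_gt0 ?ltr0n//.
  rewrite lerXn2r ?nnegrE ?expR_ge0//.
  by apply: le_trans (expR_ge1Dx _); rewrite lerDr.
have := ae_eventually_not P F C _ C0 mF Fb.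
move=> [Z [mZ Z0 sZ]]; exists Z; split => //; apply: subset_trans sZ; apply: subsetC.
move=> w /= [M HM]; exists (expR (- M.+1%:R)); first exact: expR_gt0.
move=> r r0 rM t x tt xab.
have L1' : M.+1%:R < ln r^-1.
  by rewrite lnV ?posrE// ltrNr -[ltRHS]expRK ltr_ln ?posrE ?expR_gt0.
have r1 : r < 1.
  by apply: lt_le_trans rM _; rewrite -expR0 ler_expR oppr_le0.
have [m [m1 m2 m3]] := scale_of_radius r r0 r1.
have Lm : ln r^-1 <= m%:R.
  by rewrite lnV ?posrE// lerNl -[leLHS]expRK ler_ln ?posrE ?expR_gt0.
have Mm : (M <= m)%N.
  rewrite -(ler_nat R); apply: le_trans Lm; apply: le_trans (ltW L1').
  by rewrite ler_nat.
have /andP[t0t tt1] := tt.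
have kt : (Num.trunc ((t - t0) / rho m)%R < K m)%N.
  apply: Klt; rewrite ?subr_ge0// (@le_trans _ _ `|t1 - t0|)//.
    by rewrite ger0_norm ?subr_ge0// lerD2r.
  by rewrite lerDl sumr_ge0.
have kx (l : 'I_N) : (Num.trunc ((x 0%R l - a 0%R l) / rho m)%R < K m)%N.
  have /andP[x0 x1] := xab l.
  apply: Klt; rewrite ?subr_ge0// (@le_trans _ _ `|b 0 l - a 0 l|)//.
    by rewrite ger0_norm ?lerD2r// subr_ge0 (le_trans x0).
  by rewrite /D (bigD1 l)//= addrCA lerDl addr_ge0// sumr_ge0.
(* The grid point obtained by rounding every coordinate of [(t, x)] down. *)
pose p : T m := (Ordinal kt, [ffun l => Ordinal (kx l)]).
have floor_near (z z0 : R) : z0 <= z ->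
    0 <= z - (z0 + (Num.trunc ((z - z0) / rho m))%:R * rho m) <= rho m.
  move=> zz; have /andP[h1 h2] : ((Num.trunc ((z - z0) / rho m))%:R <= (z - z0) / rho m < (Num.trunc ((z - z0) / rho m)).+1%:R).
    by apply: truncn_itv; rewrite divr_ge0 ?subr_ge0// ltW.
  move: h1 h2; rewrite ler_pdivlMr// ltr_pdivrMr// -natr1.
  set k := (Num.trunc _)%:R => h1 h2; rewrite (mulrDl k 1) mul1r in h2.
  by move: h1 h2; set y := k * rho m; move=> h1 h2; apply/andP; split; lra.
have gtE : gt m p = t0 + (Num.trunc ((t - t0) / rho m))%:R * rho m.
  rewrite /gt /=; apply/min_idPl; have /andP[h _] := floor_near t t0 t0t.
  by apply: le_trans tt1; rewrite -subr_ge0.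
have gtn : (0 <= t - gt m p <= rho m)%R by rewrite gtE; exact: floor_near.
have gxn (l : 'I_N) : (0 <= x 0%R l - gx m p 0%R l <= rho m)%R.
  by have /andP[x0 x1] := xab l; rewrite /gx mxE ffunE/=; exact: floor_near.
have nf : ~ flat (gt m p) (gx m p) (dl m) (n m) w.
  move=> f; apply: (HM m Mm); rewrite /F (bigD1 (enum_rank p))//=; left.
  by rewrite enum_rankK.
have [j jn hj] := not_flat _ _ _ _ _ nf.
have rr : rho m <= r.
  by apply: le_trans m1; rewrite ler_pdivrMr// ler_peMr ?expR_ge0// ler1n.
have tr : `|gt m p - t| <= r.
  by have /andP[h1 h2] := gtn; rewrite distrC ger0_norm// (le_trans h2).
pose z := lp (gx m p) (dl m) j.+1.
(* In each space coordinate the rounding error lies in [[- rho m, 0]] and the lattice displacement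
   in [[0, rho m]], so their sum stays within [rho m <= r]. *)
have Iz : Ibox r t x (gt m p, z).
  split => //= l; have /andP[h1 h2] := gxn l.
  have := lattice_point_coord (gx m p) (dl m) (n m) j l (ltW (dl0 m)) jn.
  rewrite -/z [(n m)%:R * _]mulrC /dl divfK ?gt_eqF// => /andP[h3 h4].
  by rewrite ler_norml; apply/andP; split; move: h1 h2 h3 h4 rr;
    set g := gx m p 0 l; set zz := z 0 l; set xx := x 0 l; set rh := rho m; lra.
have Iy : Ibox r t x (gt m p, gx m p).
  split => //= l; have /andP[h1 h2] := gxn l.
  by rewrite distrC ger0_norm// (le_trans h2).
have bound : eps / 2 * powR (3 * N.+3%:R * (2 * expR 1)) (- al) * (powR r al * powR (ln r^-1) (- al))
    <= eps * powR (dl m) al / 2.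
  rewrite -mulrA [leRHS]mulrAC ler_pM2l ?divr_gt0//.
  have L1 : 1 < ln r^-1 by apply: le_lt_trans L1'; rewrite ler1n.
  have N3 : 0 < N.+3%:R :> R by rewrite ltr0n.
  (* The constants: [n m = (N + 3)(m + 1) <= 3 (N + 3) ln r^-1] since [m <= ln r^-1 + 1] and
     [ln r^-1 > 1], and [r <= e exp (- m) = 2 e rho m]. *)
  apply: scale_ratio => //; rewrite ?mulr_gt0 ?expR_gt0//.
  - by apply: lt_trans L1.
  - rewrite /n natrM [3 * _]mulrC -mulrA ler_pM2l// -natr1.
    by move: m3 L1; set L := ln _; set mm := m%:R => m3 L1; lra.
  - by apply: (le_trans m2); rewrite /rho le_eqVlt; apply/orP; left; apply/eqP; field.
have [h|h] := oscillation_split _ _ _ (v t x w) hj.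
- by exists (gt m p, z); split => //; split => //=; apply: le_trans h.
- by exists (gt m p, gx m p); split => //; split => //=; apply: le_trans h.
Qed.

End oscillation.

(** * Consequences along a fixed path *)

Section pathwise.
Context {R : realType}.

Lemma liminf0_ge (C : R) (f : R -> \bar R) (r0 : R) : 0 < r0 ->
  (forall r, 0 < r -> r < r0 -> (C%:E <= f r)%E) -> (C%:E <= liminf0 f)%E.
Proof.
move=> r00 Hf; rewrite /liminf0 limf_einfE.
apply: (@le_trans _ _ (ereal_inf [set f x | x in [set x | 0 < x < r0]])).
  by apply: le_ereal_inf_tmp => _ [x /= /andP[x0 xr] <-]; exact: Hf.
apply: ereal_sup_ubound; exists [set x | 0 < x < r0] => //.
by near=> x => /=; apply/andP; split; near: x; [exact: nbhs_right_gt|exact: nbhs_right_lt].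
Unshelve. all: by end_near. Qed.

Lemma normr_coord_le_mx m (x : 'rV[R]_m) j : `|x 0 j| <= `|x|.
Proof.
have -> : `|x| = \big[Num.max/0]_ij `|x ij.1 ij.2| := mx_normrE x.
exact: (le_bigmax _ (fun ij => `|x ij.1 ij.2|) (0, j)).
Qed.

Lemma norm_Ibox_le (N : nat) (r t : R) (x : 'rV[R]_N) q : 0 <= r ->
  Ibox r t x q -> `|q - (t, x)| <= r.
Proof.
move=> r0 [h1 h2]; rewrite prod_normE ge_max h1/=.
have -> : `|q.2 - x| = \big[Num.max/0]_ij `|(q.2 - x) ij.1 ij.2| := mx_normrE _.
apply: bigmax_le => // -[i l] _ /=.
by rewrite ord1 !mxE; exact: h2.
Qed.

(** The product norm is a maximum norm, so [Ibox] lies in a ball of the same radius and the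
    first-order expansion applies to the whole box. *)
Lemma differentiable_oscillation (N d : nat) (f : R * 'rV[R]_N -> 'rV[R]_d) t x :
  differentiable f (t, x) -> exists K r0 : R, 0 < K /\ 0 < r0 /\
  forall r q j, 0 < r -> r < r0 -> Ibox r t x q -> `|f q 0 j - f (t, x) 0 j| <= K * r.
Proof.
move=> df; have L := diff_locallyx df.
have cancel (y z s : 'rV[R]_d) : y + z + s - y = z + s.
  by rewrite addrC addrA addrA addNr add0r.
have /eqOP O1 := diff_eqO df.
have [K [K1 HK]] : exists K : R, 1 <= K /\ \forall h \near (0 : R * 'rV[R]_N), `|'d f (t, x) h| <= K * `|h|.
  have : \forall k \near +oo, 1 <= k /\ \forall h \near (0 : R * 'rV[R]_N), `|'d f (t, x) h| <= k * `|h|.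
    near=> k; split; near: k => //.
    by apply: nbhs_pinfty_ge; rewrite num_real.
  by move=> /filter_ex[k [? ?]]; exists k.
(* [K] bounds the derivative and the extra 1 the remainder. *)
have : \forall h \near (0 : R * 'rV[R]_N), `|f (h + (t, x)) - f (t, x)| <= (K + 1) * `|h|.
  near=> h; rewrite (L h) cancel.
  apply: (le_trans (ler_normD _ _)); rewrite mulrDl; apply: lerD; near: h; first exact: HK.
  exact: (littleoP _ ltr01).
move=> /nbhs_ballP[e /= e0 He].
exists (K + 1), e; split; first by rewrite addr_gt0// (lt_le_trans _ K1).
split => // r q j r0 re Iq.
have nq := norm_Ibox_le N r t x q (ltW r0) Iq.
have := He (q - (t, x)); rewrite subrK => /(_ _) h.
apply: (@le_trans _ _ `|f q - f (t, x)|).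
  by have := normr_coord_le_mx d (f q - f (t, x)) j; rewrite !mxE.
apply: (le_trans (h _)).
  by rewrite -ball_normE/= sub0r normrN; apply: le_lt_trans re.
by rewrite ler_wpM2l// addr_ge0// (le_trans _ K1).
Unshelve. all: by end_near. Qed.

(** At [r = exp (- m)] the ratio of the oscillation scale to [r] is [exp (m (1 - al)) m^(-al)],
    unbounded in [m] because [al < 1]. *)
Lemma oscillation_not_linear (C K al r0 : R) : 0 < C -> 0 < al -> al < 1 -> 0 < r0 ->
  exists r, [/\ 0 < r, r < r0 & K * r < C * (powR r al * powR (ln r^-1) (- al))].
Proof.
move=> C0 al0 al1 r00.
(* Halving the exponent makes [exp (m (1 - al))] a square exceeding [(m e)^2]. Against
   [m^(-al) >= m^-1] a linear growth [C e^2 m] survives, and it exceeds [|K|] for [m > B]. *)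
pose e := (1 - al) / 2.
have e0 : 0 < e by rewrite divr_gt0// subr_gt0.
pose B := `|K| / (C * e ^+ 2).
pose m := Num.max (Num.max (B + 1) 2) (`|ln r0| + 1).
have mB : B < m by rewrite !lt_max ltrDl ltr01.
have m2 : 1 < m by rewrite !lt_max ltr1n orbT.
have mr : - ln r0 < m by rewrite lt_max; apply/orP; right; have := ler_norm (- ln r0); rewrite normrN; lra.
have m0 : 0 < m by apply: lt_trans m2.
exists (expR (- m)); split; first exact: expR_gt0.
  by rewrite -[ltRHS]lnK ?posrE// ltr_expR ltrNl.
rewrite ln_inv_expRN; apply: (@le_lt_trans _ _ (`|K| * expR (- m))).
  by rewrite ler_wpM2r ?expR_ge0 ?ler_norm.
have -> : powR (expR (- m)) al = expR (- m) * expR (m * (1 - al)).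
  by rewrite -expRM -expRD; congr expR; ring.
have ml : m^-1 <= powR m (- al).
  by rewrite -(powR_inv1 (ltW m0)) ler_powR ?(ltW m2)// lerN2 ltW.
have me : (m * e) ^+ 2 < expR (m * (1 - al)).
  have -> : m * (1 - al) = 2%:R * (m * e) by rewrite /e; field.
  have me0 : 0 <= m * e by rewrite ltW// mulr_gt0.
  have lt_exp : m * e < expR (m * e) by apply: lt_le_trans (expR_ge1Dx _); rewrite ltrDr.
  by rewrite expRM_natl !expr2; apply: ltr_pM.
have E0 : 0 < expR (- m) by exact: expR_gt0.
apply: (@lt_le_trans _ _ (C * (expR (- m) * (m * e) ^+ 2 * m^-1))); last first.
  have ge1 : 0 <= expR (- m) * (m * e) ^+ 2 by rewrite mulr_ge0 ?sqr_ge0 ?(ltW E0).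
  have ge2 : 0 <= m^-1 by rewrite invr_ge0 ltW.
  by rewrite ler_pM2l//; apply: ler_pM => //; rewrite ler_pM2l// ltW.
have -> : C * (expR (- m) * (m * e) ^+ 2 * m^-1) = C * e ^+ 2 * m * expR (- m).
  by field; rewrite gt_eqF.
have Ce : 0 < C * e ^+ 2 by apply: mulr_gt0 => //; exact: exprn_gt0.
rewrite ltr_pM2r//; move: mB; rewrite /B ltr_pdivrMr//.
by rewrite mulrC.
Qed.

End pathwise.

(** * The two lower bounds and nowhere differentiability *)

Theorem theorem5p5
  (R : realType) (N d : nat) (H beta c1 c2 cH : R)
  (h : 'rV[R]_N -> R)
  (d0 : measure_display) (Omega : measurableType d0) (P : probability Omega R)
  (u : 'I_d -> R -> 'rV[R]_N -> Omega -> R)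
  (a0 b0 : R) (a b : 'rV[R]_N) :
  (1 <= N)%N -> (1 <= d)%N ->
  1 / 2 <= H -> H < 1 ->
  0 < beta -> beta < N%:R ->
  N%:R - 2 * H - 1 < beta -> beta < N%:R - 2 * H + 1 ->
  (* h_beta *)
  0 < c1 -> c1 <= c2 ->
  measurable_fun [set: N.-tuple R] (fun v => h (\row_(l < N) tnth v l)) ->
  (forall xi, 0 <= h xi) ->
  (forall xi, xi != 0 ->
     c1 * powR (enorm xi) (- beta) <= h xi /\ h xi <= c2 * powR (enorm xi) (- beta)) ->
  (* the solution u: continuous version, i.i.d. centered Gaussian components *)
  0 < cH ->
  (forall j w, {within [set p : R * 'rV[R]_N | 0 <= p.1],
                 continuous (fun p : R * 'rV[R]_N => u j p.1 p.2 w)}) ->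
  (forall j, centered_gaussian_field P (u j)) ->
  independent_fields P u ->
  (forall j (t : R) (x : 'rV[R]_N) (s : R) (y : 'rV[R]_N), 0 <= t -> 0 <= s ->
     'E_P[fun w => (u j t x w * u j s y w)%R]%E
       = (cH * complex.Re (cov_integral H h t x s y))%:E /\
     complex.Im (cov_integral H h t x s y) = 0) ->
  (* T = [a0,b0] x prod_l [a_l, b_l], a compact interval in (0,oo) x R^N *)
  0 < a0 -> a0 <= b0 -> (forall l, a 0 l <= b 0 l) ->
  let alpha := (2 * H + 1 - N%:R + beta) / 2 in
  let T := [set p : R * 'rV[R]_N |
              a0 <= p.1 <= b0 /\ forall l, a 0 l <= p.2 0 l <= b 0 l] in
  exists C3 C4 : R, 0 < C3 /\ 0 < C4 /\
    (forall t x, T (t, x) ->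
       {ae P, forall w,
         (C3%:E <= liminf0 (fun r => supI r t x (fun p => (
             enorm (uvec u w p.1 p.2 - uvec u w t x)
             / (powR r alpha * powR (ln (ln r^-1)) (- alpha)))%R)))%E}) /\
    {ae P, forall w,
       (C4%:E <= liminf0 (fun r =>
          ereal_inf [set supI r p.1 p.2 (fun q => (
             enorm (uvec u w q.1 q.2 - uvec u w p.1 p.2)
             / (powR r alpha * powR (ln r^-1) (- alpha)))%R) | p in T]))%E} /\
    {ae P, forall w, forall (t : R) (x : 'rV[R]_N), 0 < t ->
       ~ differentiable (fun p : R * 'rV[R]_N => uvec u w p.1 p.2) (t, x)}.
Proof.
move=> N1 d1 H1 H2 b0' bN bH1 bH2 c10 c12 mh h0 hbd cH0 ucont ug uind ucov a00 ab0 abl alpha T.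
have al0 : 0 < alpha by rewrite /alpha divr_gt0//; move: bH1; set y := N%:R; lra.
have al1 : alpha < 1 by rewrite /alpha ltr_pdivrMr//; move: bH2; set y := N%:R; lra.
pose j0 := Ordinal d1; pose v := u j0.
have c20 : 0 < c2 by exact: lt_le_trans c12.
have hge xi : xi != 0 -> c1 * powR (enorm xi) (- beta) <= h xi by case/hbd.
have hle xi : xi != 0 -> h xi <= c2 * powR (enorm xi) (- beta) by case/hbd.
have vcov t x s y (t0 : 0 <= t) (s0 : 0 <= s) := (ucov j0 t x s y t0 s0).1.
have mv t x : 0 <= t -> measurable_fun setT (v t x).
  move=> t0; have [|+ _] := ug j0 [:: (1, (t, x))]; first by move=> q; rewrite inE => /eqP ->.
  rewrite (_ : (fun w => _) = v t x)//.
  by apply/funext => w; rewrite big_seq1/= mul1r.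
have comp_le w q p : `|v q.1 q.2 w - v p.1 p.2 w| <= enorm (uvec u w q.1 q.2 - uvec u w p.1 p.2).
  by apply: le_trans (coord_le_enorm d _ j0); rewrite !mxE.
(* Stated for an arbitrary time window: [[a0, b0]] yields the constants of the theorem, while
   nowhere differentiability needs windows exhausting the positive half-line. *)
have key t0 t1 : 0 < t0 -> t0 <= t1 -> exists2 eps : R, 0 < eps &
    (forall t x, t0 <= t <= t1 -> {ae P, forall w, exists2 r0, 0 < r0 & forall r, 0 < r -> r < r0 ->
      exists2 y, Ibox r t x (t, y) &
        eps * powR (5 * expR 1) (- alpha) * (powR r alpha * powR (ln (ln r^-1)) (- alpha))
          <= `|v t y w - v t x w|}) /\
    (forall a b : 'rV[R]_N,
      {ae P, forall w, exists2 r0, 0 < r0 & forall r, 0 < r -> r < r0 ->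
        forall (t : R) (x : 'rV[R]_N), t0 <= t <= t1 -> (forall l, a 0 l <= x 0 l <= b 0 l) ->
        exists q : R * 'rV[R]_N, Ibox r t x q /\ t0 <= q.1 <= t1 /\
          eps / 2 * powR (3 * N.+3%:R * (2 * expR 1)) (- alpha) * (powR r alpha * powR (ln r^-1) (- alpha))
            <= `|v q.1 q.2 w - v t x w|}).
  move=> t00 t01.
  have [eps [e1 [eps0 [e10 SB]]]] := field_small_ball P N H beta c1 c2 cH h v N1 t0 t1
    H1 H2 b0' bN bH1 c10 c20 mh h0 hge hle cH0 (ug j0) vcov t00 t01.
  have mv' t x : t0 <= t <= t1 -> measurable_fun setT (v t x).
    by case/andP => tt _; apply: mv; apply: le_trans tt; exact: ltW.
  exists eps => //; split.
  - by move=> t x; apply: (local_oscillation P N N1 v t0 t1 alpha eps e1).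
  - by move=> a' b'; apply: (uniform_oscillation P N N1 v t0 t1 alpha eps e1).
have [eps eps0 [loc unif]] := key a0 b0 a00 ab0.
have e1 : 0 < expR 1 :> R by exact: expR_gt0.
have N3 : 0 < 3 * N.+3%:R :> R by rewrite mulr_gt0 ?ltr0n.
exists (eps * powR (5 * expR 1) (- alpha)), (eps / 2 * powR (3 * N.+3%:R * (2 * expR 1)) (- alpha)).
split; first by rewrite mulr_gt0// powR_gt0// mulr_gt0.
split; first by rewrite mulr_gt0 ?divr_gt0// powR_gt0// !mulr_gt0.
split.
  move=> t x [/= tt _]; have [Z [mZ Z0 sZ]] := loc t x tt.
  exists Z; split => //; apply: subset_trans sZ; apply: subsetC => w /= [r0 r00 Hw].
  (* Below [exp (-1)] the iterated logarithm is positive, so the normalization can be divided by. *)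
  apply: (liminf0_ge _ _ (Num.min r0 (expR (-1)))); first by rewrite lt_min r00 expR_gt0.
  move=> r rp; rewrite lt_min => /andP[rr0 re].
  have [y Iy Hy] := Hw r rp rr0.
  apply: le_trans; last first.
    by apply: ereal_sup_ubound; exists (t, y) => //.
  rewrite lee_fin ler_pdivlMr; last first.
    rewrite mulr_gt0 ?powR_gt0// ln_gt0//.
    by rewrite lnV ?posrE// ltrNr -[ltRHS]expRK ltr_ln ?posrE ?expR_gt0.
  by apply: (le_trans Hy); exact: (comp_le w (t, y) (t, x)).
split.
  have [Z [mZ Z0 sZ]] := unif a b.
  exists Z; split => //; apply: subset_trans sZ; apply: subsetC => w /= [r0 r00 Hw].
  apply: (liminf0_ge _ _ (Num.min r0 1)); first by rewrite lt_min r00 ltr01.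
  move=> r rp; rewrite lt_min => /andP[rr0 re].
  apply: le_ereal_inf_tmp => _ [[t x] [/= tt xx] <-].
  have [q [Iq [_ Hq]]] := Hw r rp rr0 t x tt xx.
  apply: le_trans; last first.
    by apply: ereal_sup_ubound; exists q => //.
  rewrite lee_fin ler_pdivlMr; last first.
    by rewrite mulr_gt0 ?powR_gt0// ln_gt0// invf_gt1.
  by apply: (le_trans Hq); exact: (comp_le w q (t, x)).
(* Countably many boxes [[1 / (M + 1), M + 1] x [- M, M]^N] exhaust the domain, so a single null set
   serves all points; [C] and [r0] may depend on [M]. *)
have box (M : nat) : {ae P, forall w, exists C r0 : R, 0 < C /\ 0 < r0 /\ forall r, 0 < r -> r < r0 ->
    forall (t : R) (x : 'rV[R]_N), M.+1%:R^-1 <= t <= M.+1%:R -> (forall l, `|x 0 l| <= M%:R) ->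
    exists2 q : R * 'rV[R]_N, Ibox r t x q &
      C * (powR r alpha * powR (ln r^-1) (- alpha)) <= `|v q.1 q.2 w - v t x w|}.
  have M1 : 1 <= M.+1%:R :> R by rewrite ler1n.
  have [| |ep ep0 [_ un]] := key M.+1%:R^-1 M.+1%:R.
  - by rewrite invr_gt0 ltr0n.
  - by apply: le_trans M1; rewrite invf_le1 ?ltr0n// ler1n.
  have [Z [mZ Z0 sZ]] := un (const_mx (- M%:R)) (const_mx M%:R).
  exists Z; split => //; apply: subset_trans sZ; apply: subsetC => w /= [r0 r00 Hw].
  exists (ep / 2 * powR (3 * N.+3%:R * (2 * expR 1)) (- alpha)), r0; split.
    by rewrite mulr_gt0 ?divr_gt0// powR_gt0// !mulr_gt0.
  split => // r rp rr t x tt xx.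
  have [|q [Iq [_ Hq]]] := Hw r rp rr t x tt; last by exists q.
  by move=> l; rewrite !mxE -ler_norml.
have [Z [mZ Z0 sZ]] := ae_foralln box.
exists Z; split => //; apply: subset_trans sZ; apply: subsetC => w /= Hw t x tp df.
(* The three terms place the coordinates of [x], the upper and the lower bound on [t] inside the box
   of index [M]. *)
pose M := Num.bound (`|x| + t + t^-1).
have MB : `|x| + t + t^-1 <= M%:R.
  by apply: ltW; apply: archi_boundP; rewrite !addr_ge0 ?invr_ge0// ltW.
have ti0 : 0 < t^-1 by rewrite invr_gt0.
have x0 : 0 <= `|x| by exact: normr_ge0.
have M1 : M.+1%:R = M%:R + 1 :> R by rewrite natr1.
have [C [r0 [C0 [r00 HC]]]] := Hw M.
have [K [r1 [K0 [r10 HK]]]] := differentiable_oscillation N d _ t x df.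
have r01 : 0 < Num.min r0 r1 by rewrite lt_min r00.
have [r [rp + Kr]] := oscillation_not_linear C K alpha _ C0 al0 al1 r01.
rewrite lt_min => /andP[rr0 rr1].
have [||q Iq Hq] := HC r rp rr0 t x.
- apply/andP; split.
    rewrite -[leRHS]invrK lef_pV2 ?posrE ?ltr0n//.
    by rewrite M1; move: MB; set y := M%:R; lra.
  by rewrite M1; move: MB; set y := M%:R; lra.
- move=> l; apply: (le_trans (normr_coord_le_mx N x l)).
  by move: MB; set y := M%:R; lra.
have := HK r q j0 rp rr1 Iq; rewrite /= !mxE -/v.
by apply/negP; rewrite -ltNge; apply: lt_le_trans Hq.
Qed.
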